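(* Let $b,\sigma\in\mathbb{R}$ and let $\nu$ be a Lévy measure on $\mathbb{R}\setminus\{0\}$, i.e. $\int_{\mathbb{R}\setminus\{0\}}(1\wedge k^2)\,\nu(dk)<\infty$, which is symmetric under $k\to -k$. Let $(\xi_t)_{t\ge 0}$ be the real-valued Lévy process with drift $b$, Gaussian coefficient $\sigma^2$ and Lévy measure $\nu$, i.e. when started at $0$ its characteristic function is $\mathbb{E}[e^{-ix\xi_t}]=e^{-tV(x)}$, $x\in\mathbb{R}$, with $$V(x)=ibx+\frac{\sigma^2}{2}x^2-\int_{\mathbb{R}\setminus\{0\}}\left(e^{-ixk}-1+ixk\mathbf{1}_{\{|k|\le 1\}}\right)\nu(dk).$$ Assume that $\nu$ has moments of all orders. Let $U:\mathbb{R}\to\mathbb{R}$ be a smooth function for which there exist $c>0$, $a\ge 1$ and $C>0$ such that $$U(p)\ge c|p|^a,\qquad |p|>C,$$ and such that for every $n\ge 1$ there exist $c(n),k(n)>0$ with $$\left|U^{(n)}(p)\right|\le c(n)\left(1+|p|^{k(n)}\right),\qquad |p|>C.$$ Let $g\in S(\mathbb{R})$. Then the function $$u(t,p)=\mathbb{E}\left[g(\xi_t)\exp\left(-\int_0^tU(\xi_s)\,ds\right)\,\Big|\,\xi_0=p\right]$$ is a solution of $$\begin{cases}\dfrac{\partial u}{\partial t}(t,p)=-U(p)u(t,p)-V(i\nabla)u(t,p),&(t,p)\in(0,\infty)\times\mathbb{R},\\[2mm] u(0,p)=g(p),&p\in\mathbb{R}.\end{cases}$$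
   Context: The operator $V(i\nabla)$ acts in the variable $p$ by $$V(i\nabla)u(p)=-bu'(p)-\frac{\sigma^2}{2}u''(p)-\int_{\mathbb{R}\setminus\{0\}}\left(u(p+k)-u(p)-ku'(p)\mathbf{1}_{\{|k|\le1\}}\right)\nu(dk).$$ Since $\nu$ is symmetric, the compensating terms $ixk\mathbf{1}_{\{|k|\le 1\}}$ and $ku'(p)\mathbf{1}_{\{|k|\le 1\}}$ may be omitted (integrals being understood in the symmetric sense). $S(\mathbb{R})$ is the Schwartz space of infinitely differentiable functions $f:\mathbb{R}\to\mathbb{R}$ with $\sup_x|x^mf^{(n)}(x)|<\infty$ for all $m,n\in\mathbb{N}$. $(\xi_t)_{t\ge0}$ is taken right-continuous with left limits; conditioning on $\xi_0=p$ means that the process is started at $p$, i.e. $\xi$ is replaced by $p+\xi$ with $\xi$ started at $0$. ''$\nu$ has moments of all orders'' means $\int_{\{|k|>1\}}|k|^m\,\nu(dk)<\infty$ for all $m\ge1$. ''Solution'' is meant pointwise: for every $t>0$ the function $u(t,\cdot)$ is regular enough for $V(i\nabla)u(t,\cdot)$ to be defined, the (two-sided) derivative $\partial u/\partial t(t,p)$ exists at each $(t,p)\in(0,\infty)\times\mathbb{R}$, the equation holds there, and $u(0,p)=g(p)$. *)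

(* Defs.v *)
From HB Require Import structures.
From mathcomp Require Import all_boot all_order all_algebra.
From mathcomp Require Import complex.
From mathcomp Require Import all_classical all_reals all_analysis.

Set Implicit Arguments.
Unset Strict Implicit.
Unset Printing Implicit Defensive.

Import Order.TTheory GRing.Theory Num.Theory.
Import numFieldNormedType.Exports.

Local Open Scope classical_set_scope.
Local Open Scope ring_scope.

Definition smooth (R : realType) (f : R -> R) : Prop :=
  forall (n : nat) (x : R), derivable (derive1n n f) x 1.

Definition schwartz (R : realType) (f : R -> R) : Prop :=
  smooth f /\
  forall m n : nat, exists M : R, forall x : R, `|x ^+ m * derive1n n f x| <= M.

Definition cexp (R : realType) (z : R[i]) : R[i] :=
  Complex (expR (complex.Re z) * cos (complex.Im z))
          (expR (complex.Re z) * sin (complex.Im z)).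

Definition cintegral (d : measure_display) (T : measurableType d)
    (R : realType) (mu : {measure set T -> \bar R}) (D : set T)
    (f : T -> R[i]) : R[i] :=
  Complex (\int[mu]_(x in D) complex.Re (f x))
          (\int[mu]_(x in D) complex.Im (f x)).

(* A measure on R \ {0} is represented by the measure on R that extends it and
   gives no mass to {0}. *)
Definition levy_measure (R : realType)
    (nu : {measure set (measurableTypeR R) -> \bar R}) : Prop :=
  nu [set 0%R] = 0%E /\
  (\int[nu]_(k in ~` [set (0 : R)%R]) (Num.min 1 (k ^+ 2))%:E < +oo)%E.

Definition symmetric_measure (R : realType)
    (nu : {measure set (measurableTypeR R) -> \bar R}) : Prop :=
  forall A : set (measurableTypeR R),
    measurable A -> nu ((fun k : R => - k) @^-1` A) = nu A.

Definition moments_of_all_orders (R : realType)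
    (nu : {measure set (measurableTypeR R) -> \bar R}) : Prop :=
  forall m : nat, (1 <= m)%N ->
    (\int[nu]_(k in [set k : R | (1 < `|k|)%R]) (`|k| ^+ m)%:E < +oo)%E.

Definition small_jumps (R : realType) : set R := [set k : R | `|k| <= 1].

Definition levy_symbol (R : realType) (b sigma : R)
    (nu : {measure set (measurableTypeR R) -> \bar R}) (x : R) : R[i] :=
  'i%C * (b * x)%:C%C + (sigma ^+ 2 / 2 * x ^+ 2)%:C%C
  - cintegral nu (~` [set (0 : R)])
      (fun k : R => cexp (- ('i%C * (x * k)%:C%C)) - 1
                    + 'i%C * (x * k * \1_(@small_jumps R) k)%:C%C).

Definition jump_integrand (R : realType) (f : R -> R) (p k : R) : R :=
  f (p + k) - f p - k * derive1 f p * \1_(@small_jumps R) k.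

Definition V_inabla (R : realType) (b sigma : R)
    (nu : {measure set (measurableTypeR R) -> \bar R}) (f : R -> R) (p : R)
    : R :=
  - b * derive1 f p - sigma ^+ 2 / 2 * derive1n 2 f p
  - \int[nu]_(k in ~` [set (0 : R)%R]) jump_integrand f p k.

Definition V_inabla_defined (R : realType)
    (nu : {measure set (measurableTypeR R) -> \bar R}) (f : R -> R) : Prop :=
  forall p : R,
    [/\ derivable f p 1, derivable (derive1 f) p 1
      & nu.-integrable (~` [set (0 : R)]) (EFin \o jump_integrand f p)].

(* Processes are indexed by all of R; only times t >= 0 are ever constrained or
   used. *)

Definition increment (d : measure_display) (Omega : measurableType d)
    (R : realType) (P : probability Omega R) (xi : R -> {RV P >-> R})
    (s t : R) (w : Omega) : R :=
  xi t w - xi s w.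

Definition independent_increments (d : measure_display)
    (Omega : measurableType d) (R : realType) (P : probability Omega R)
    (xi : R -> {RV P >-> R}) : Prop :=
  forall (n : nat) (t : nat -> R) (A : nat -> set R),
    0 <= t 0%N ->
    (forall i : nat, (i < n)%N -> t i <= t i.+1) ->
    (forall i : nat, (i < n)%N -> measurable (A i)) ->
    P (\big[setI/setT]_(i < n) (increment xi (t i) (t i.+1) @^-1` A i))
    = (\prod_(i < n) P (increment xi (t i) (t i.+1) @^-1` A i))%E.

Definition stationary_increments (d : measure_display)
    (Omega : measurableType d) (R : realType) (P : probability Omega R)
    (xi : R -> {RV P >-> R}) : Prop :=
  forall (s h : R) (A : set R), 0 <= s -> 0 <= h -> measurable A ->
    P (increment xi s (s + h) @^-1` A) = P (xi h @^-1` A).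

Definition cadlag (R : realType) (f : R -> R) : Prop :=
  (forall t : R, 0 <= t -> f s @[s --> t^'+] --> f t) /\
  (forall t : R, 0 < t -> cvg (f s @[s --> t^'-])).

Definition levy_process (d : measure_display) (Omega : measurableType d)
    (R : realType) (P : probability Omega R) (b sigma : R)
    (nu : {measure set (measurableTypeR R) -> \bar R})
    (xi : R -> {RV P >-> R}) : Prop :=
  [/\ P (xi 0%R @^-1` [set 0%R]) = 1%E,
      independent_increments xi,
      stationary_increments xi,
      forall w : Omega, cadlag (fun t => xi t w)
    & forall t x : R, 0 <= t ->
        cintegral P setT (fun w => cexp (- ('i%C * (x * xi t w)%:C%C)))
        = cexp (- (t%:C%C * levy_symbol b sigma nu x))].

Definition feynman_kac (d : measure_display) (Omega : measurableType d)
    (R : realType) (P : probability Omega R) (xi : R -> {RV P >-> R})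
    (U g : R -> R) (t p : R) : R :=
  fine 'E_P[fun w : Omega =>
    g (p + xi t w) *
    expR (- \int[lebesgue_measure]_(s in `[0, t]) U (p + xi s w))].

Definition is_solution (R : realType) (b sigma : R)
    (nu : {measure set (measurableTypeR R) -> \bar R}) (U g : R -> R)
    (u : R -> R -> R) : Prop :=
  (forall t : R, 0 < t ->
     V_inabla_defined nu (u t) /\
     forall p : R,
       derivable (fun s => u s p) t 1 /\
       derive1 (fun s => u s p) t
       = - U p * u t p - V_inabla b sigma nu (u t) p) /\
  (forall p : R, u 0 p = g p).

(* Main.v *)
Require Import Defs.
From HB Require Import structures.
From mathcomp Require Import all_boot all_order all_algebra.
From mathcomp Require Import complex.
From mathcomp Require Import all_classical all_reals all_analysis.
From mathcomp Require Import measurable_realfun.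
From mathcomp Require Import ring lra.

Set Implicit Arguments.
Unset Strict Implicit.
Unset Printing Implicit Defensive.

Import Order.TTheory GRing.Theory Num.Theory.
Import numFieldNormedType.Exports.

Local Open Scope classical_set_scope.
Local Open Scope ring_scope.

(** The Levy measure having all moments, [E (xi t)^(2m)] is finite and [E (xi t)^2 = O(t)];
    both follow from the characteristic function alone, by testing it against powers of
    [(2 - 2 cos (h x)) / h^2], which stay below [x^2] and tend to it as [h -> 0], with a
    Gronwall bound uniform in [h].
    Approximating [(f (p + k) - f p - f' p sin k) / k^2] by trigonometric polynomials then
    gives [(E f (p + xi h) - f p) / h -> - V(i nabla) f p] for every [f] of class C^3 with
    polynomially bounded derivatives.
    Independence and stationarity of the increments, applied along grids whose Riemann sums
    converge to the exponent, yield the semigroup identity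
    [u (s + h) p = E (exp (- int_0^h U (p + xi)) u s (p + xi h))].
    Differentiating the Feynman-Kac functional three times in [p], path by path, bounds the
    [p]-derivatives of [u t] polynomially, uniformly on bounded time intervals.
    Expanding the semigroup identity for small [h] gives the right derivative in time. For the
    left derivative one expands around [u (t - h)] instead, and passes to the limit because
    [u (t - h) - u t] is small together with its first two derivatives, by interpolation
    between its sup bound and the bound on the third derivative. *)

(** * Integrability with explicit bounds *)

(** The process is known only through the law of its increments: no decomposition into a Brownian
    part and jumps is available, so every estimate has to come from [levy_symbol], which gives
    expectations of trigonometric polynomials and nothing else explicitly. To leave that class,
    errors are measured against [k ^+ 2 * wt k ^+ m]. The factor [k ^+ 2] makes this function
    integrable for [nu] near 0 and makes its expectation at [xi h] of order [h], so that one
    pointwise inequality controls both the difference quotient, after division by [h], and the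
    limiting jump integral. Since the derivatives of [U] may grow polynomially and are brought down
    from the exponential, bounds in the starting point are weighted rather than uniform. The time
    derivative has to be two-sided, while the semigroup identity compares a time with a later one
    only. For a left increment the function fed to the generator moves with the increment, and the
    convergence of the difference quotients is not uniform in that function. Hence the need for
    smallness of [u (t - h) - u t] together with two derivatives, and for a third derivative of
    [u]. *)

Section L1le.
Context d (T : measurableType d) (R : realType) (mu : {measure set T -> \bar R}).
Variables (D : set T) (mD : measurable D).
Implicit Types (X Y : T -> R) (c : R).

(** Integrability is carried together with a bound on the norm, because the estimates must be
    uniform in time, starting point and mesh. Such bounds pass through domination, finite sums and
    pointwise limits. *)
Definition L1le X c :=
  measurable_fun D X /\ (\int[mu]_(x in D) `|X x|%:E <= c%:E)%E.

Lemma L1le_integrable X c : L1le X c -> mu.-integrable D (EFin \o X).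
Proof.
move=> [mX Xc]; apply/integrableP; split; first exact/measurable_EFinP.
by apply: le_lt_trans Xc _; rewrite ltry.
Qed.

Lemma L1le_ge0 X c : L1le X c -> 0 <= c.
Proof. by case=> _; rewrite -lee_fin; apply: le_trans; exact: integral_ge0. Qed.

Lemma L1le_norm X c : L1le X c -> `|\int[mu]_(x in D) X x| <= c.
Proof.
move=> Xc; have iX := L1le_integrable Xc; case: Xc => mX Xc.
rewrite -lee_fin; apply: le_trans Xc.
rewrite EFin_normr_Rintegral//.
by apply: le_abse_integral => //; exact/measurable_EFinP.
Qed.

Lemma integrable_L1le X : mu.-integrable D (EFin \o X) ->
  L1le X (\int[mu]_(x in D) `|X x|).
Proof.
move=> iX; split; first exact/measurable_EFinP/(measurable_int mu iX).
rewrite /Rintegral fineK//; apply: integrable_fin_num => //.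
exact: (integrable_norm iX).
Qed.

Lemma L1le_dom X Y c : measurable_fun D Y ->
  (forall x, D x -> `|Y x| <= `|X x|) -> L1le X c -> L1le Y c.
Proof.
move=> mY YX [mX Xc]; split => //; apply: le_trans Xc.
apply: ge0_le_integral => //.
- by do 2 apply: measurableT_comp => //.
- by do 2 apply: measurableT_comp => //.
Qed.

Lemma L1le_weak X c c' : c <= c' -> L1le X c -> L1le X c'.
Proof. by move=> cc' [mX Xc]; split=> //; apply: le_trans Xc _; rewrite lee_fin. Qed.

Lemma L1le_scale X c k : L1le X c -> L1le (fun x => k * X x) (`|k| * c).
Proof.
move=> [mX Xc]; split; first exact: measurable_funM.
under eq_integral do rewrite normrM EFinM.
rewrite ge0_integralZl//; last by do 2 apply: measurableT_comp => //.
by rewrite EFinM; apply: lee_pmul => //; exact: integral_ge0.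
Qed.

Lemma L1le_add X Y c c' : L1le X c -> L1le Y c' ->
  L1le (fun x => X x + Y x) (c + c').
Proof.
move=> [mX Xc] [mY Yc]; split; first exact: measurable_funD.
have mX' : measurable_fun D (fun x => `|X x|%:E).
  by do 2 apply: measurableT_comp => //.
have mY' : measurable_fun D (fun x => `|Y x|%:E).
  by do 2 apply: measurableT_comp => //.
apply: (@le_trans _ _ (\int[mu]_(x in D) (`|X x|%:E + `|Y x|%:E))%E).
  apply: ge0_le_integral => //.
  - by do 2 apply: measurableT_comp => //; exact: measurable_funD.
  - exact: emeasurable_funD.
  - by move=> x _; rewrite -EFinD lee_fin ler_normD.
by rewrite ge0_integralD// EFinD leeD.
Qed.

Lemma L1le_sum (I : Type) (s : seq I) (X : I -> T -> R) (c : I -> R) :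
  (forall i, L1le (X i) (c i)) ->
  L1le (fun x => \sum_(i <- s) X i x) (\sum_(i <- s) c i).
Proof.
move=> Xc; elim: s => [|i s ih].
  rewrite big_nil; under eq_fun do rewrite big_nil.
  split; first exact: measurable_cst.
  by rewrite normr0 integral0.
rewrite big_cons; under eq_fun do rewrite big_cons.
exact: L1le_add.
Qed.

(** Fatou's lemma: no dominating function is required. This is how moments are reached from bounded
    trigonometric functions, and integrals along paths from Riemann sums. *)
Lemma L1le_lim (X : nat -> T -> R) Y c : (forall n, L1le (X n) c) ->
  (forall x, D x -> X n x @[n --> \oo] --> Y x) -> L1le Y c.
Proof.
move=> Xc XY; have mY : measurable_fun D Y.
  apply: (@measurable_fun_cvg _ _ _ D X) => // n.
  by case: (Xc n).
split=> //.
have mn n : measurable_fun D (fun x => `|X n x|%:E).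
  by do 2 apply: measurableT_comp => //; case: (Xc n).
have := fatou mu mD mn (fun n x _ => ltac:(by [])).
rewrite (_ : (\int[mu]_(x in D) limn_einf _)%E = (\int[mu]_(x in D) `|Y x|%:E)%E); last first.
  apply: eq_integral => x; rewrite inE => Dx.
  apply: (cvg_limn_einf_sup _).1.
  by apply: cvg_EFin; [exact: nearW|apply: cvg_norm; exact: XY].
move=> h; apply: (le_trans h).
rewrite limn_einf_lim; apply: lime_le; first exact: is_cvg_einfs.
apply: nearW => n; apply: le_trans (proj2 (Xc n)).
by apply: ereal_inf_lbound; exists n => /=.
Qed.

End L1le.

Section integrable_real.
Context d (T : measurableType d) (R : realType) (mu : {measure set T -> \bar R}).
Variables (D : set T) (mD : measurable D).
Implicit Types (f g : T -> R).

Lemma integrable_scale a f : mu.-integrable D (EFin \o f) ->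
  mu.-integrable D (EFin \o (fun x => a * f x)).
Proof.
move=> h; rewrite (_ : EFin \o _ = (fun x => a%:E * (EFin \o f) x)%E); last exact/funext.
exact: integrableZl.
Qed.

Lemma integrable_add f g : mu.-integrable D (EFin \o f) -> mu.-integrable D (EFin \o g) ->
  mu.-integrable D (EFin \o (fun x => f x + g x)).
Proof.
move=> hf hg; rewrite (_ : EFin \o _ = ((EFin \o f) \+ (EFin \o g))%E); last exact/funext.
exact: integrableD.
Qed.

Lemma integrable_sub f g : mu.-integrable D (EFin \o f) -> mu.-integrable D (EFin \o g) ->
  mu.-integrable D (EFin \o (fun x => f x - g x)).
Proof.
move=> hf hg; have := integrable_add hf (integrable_scale (-1) hg).
by under [X in _ -> _.-integrable _ (_ \o X)]eq_fun do rewrite -mulN1r.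
Qed.

Lemma integrable_dom f g : measurable_fun D f -> (forall x, D x -> `|f x| <= g x) ->
  mu.-integrable D (EFin \o g) -> mu.-integrable D (EFin \o f).
Proof.
move=> mf fg; apply: le_integrable => //; first exact/measurable_EFinP.
by move=> x Dx /=; rewrite lee_fin (le_trans (fg x Dx))// ler_norm.
Qed.

End integrable_real.

(** * Taylor estimates and polynomial weights *)

Lemma is_derive_translate (R : realType) (F F1 : R -> R) (q : R) :
  (forall x : R, is_derive x 1 F (F1 x)) ->
  forall y : R, is_derive y 1 (fun z => F (z + q)) (F1 (y + q)).
Proof.
move=> dF y; have h2 : is_derive y (1 : R) (fun z : R => z + q) (1 : R).
  by apply: is_derive_eq; rewrite addr0.
have := @is_derive1_comp _ F (fun z => z + q) y _ _ (dF (y + q)) h2.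
by rewrite mulr1.
Qed.

Lemma continuous_itv_bounded (R : realType) (f : R -> R) (C : R) : 0 <= C -> continuous f ->
  exists2 M : R, 0 <= M & forall x, `|x| <= C -> `|f x| <= M.
Proof.
move=> C0 cf; have CC : - C <= C by lra.
have cNf : {within `[- C, C], continuous (fun z => `|f z|)}.
  by apply: continuous_subspaceT => z; apply: continuous_comp; [exact: cf|exact: norm_continuous].
have [y _ hy] := EVT_max CC cNf.
by exists `|f y| => // x xC; apply: hy; rewrite in_itv/= -ler_norml.
Qed.

Section calculus.
Context (R : realType).
Implicit Types (f g : R -> R) (x a r M : R).

Lemma is_derive_continuous f x df : is_derive x 1 f df -> {for x, continuous f}.
Proof. by move=> fx; apply/differentiable_continuous/derivable1_diffP. Qed.

Lemma derive_lipschitz f f' a r M x : (forall y : R, is_derive y 1 f (f' y)) ->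
  (forall y, `|y - a| <= r -> `|f' y| <= M) -> `|x - a| <= r ->
  `|f x - f a| <= M * `|x - a|.
Proof.
move=> ff' fM xar.
have cf : continuous f by move=> y; apply: is_derive_continuous.
have wcf (I : set R) : {within I, continuous f} by exact: continuous_subspaceT.
have [ax|xa] := leP a x.
  have [c] := MVT_segment ax (fun y _ => ff' y) (wcf _).
  rewrite in_itv/= => /andP[ac cx] ->; rewrite normrM ler_wpM2r// fM//.
  by rewrite ger0_norm ?subr_ge0//; apply: le_trans xar; rewrite ger0_norm ?subr_ge0 ?lerB.
have [c] := MVT_segment (ltW xa) (fun y _ => ff' y) (wcf _).
rewrite in_itv/= => /andP[xc ca] fE.
rewrite distrC fE distrC normrM ler_wpM2r// fM//.
apply: le_trans xar; rewrite (distrC c) (distrC x) !ger0_norm ?subr_ge0//; last exact: ltW.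
by rewrite lerB.
Qed.

Lemma derive_bound0 f f' r M x : (forall y : R, is_derive y 1 f (f' y)) -> f 0 = 0 ->
  (forall y, `|y| <= r -> `|f' y| <= M) -> `|x| <= r -> `|f x| <= M * `|x|.
Proof.
move=> ff' f0 fM xr; have := @derive_lipschitz f f' 0 r M x ff'.
by rewrite f0 !subr0; apply => // y; rewrite subr0; exact: fM.
Qed.

(** Two applications of the mean value theorem, at the price of the constant [M] where Taylor's
    formula has [M / 2]; constants do not matter below. *)
Lemma taylor2 f f' f'' x M : (forall y : R, is_derive y 1 f (f' y)) ->
  (forall y : R, is_derive y 1 f' (f'' y)) ->
  (forall y, `|y| <= `|x| -> `|f'' y| <= M) ->
  `|f x - f 0 - f' 0 * x| <= M * x ^+ 2.
Proof.
move=> ff' ff'' fM.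
have h1 y : `|y| <= `|x| -> `|f' y - f' 0| <= M * `|x|.
  move=> yx; apply: le_trans (_ : _ <= M * `|y|) _; last first.
    rewrite ler_wpM2l//.
    by rewrite (le_trans _ (fM 0 _))// normr0.
  have := @derive_lipschitz f' f'' 0 `|x| M y ff''.
  by rewrite !subr0; apply=> // z; rewrite subr0; exact: fM.
have h (y : R) : is_derive y 1 (fun z => f z - f 0 - f' 0 * z) (f' y - f' 0).
  by apply: is_derive_eq; rewrite subr0 /GRing.scale/= mulr1.
have := @derive_bound0 _ _ `|x| (M * `|x|) x h _ h1 (lexx _).
by rewrite mulr0 subrr subr0 -mulrA -expr2 real_normK ?num_real//; apply.
Qed.

Lemma taylor3 f f' f'' f3 x M : (forall y : R, is_derive y 1 f (f' y)) ->
  (forall y : R, is_derive y 1 f' (f'' y)) -> (forall y : R, is_derive y 1 f'' (f3 y)) ->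
  (forall y, `|y| <= `|x| -> `|f3 y| <= M) ->
  `|f x - f 0 - f' 0 * x - f'' 0 / 2 * x ^+ 2| <= M * `|x| ^+ 3.
Proof.
move=> ff' ff'' ff3 fM.
have M0 : 0 <= M by rewrite (le_trans _ (fM 0 _))// normr0.
have h1 y : `|y| <= `|x| -> `|f' y - f' 0 - f'' 0 * y| <= M * `|x| ^+ 2.
  move=> yx; apply: le_trans (_ : _ <= M * y ^+ 2) _; last first.
    by rewrite ler_wpM2l// -normrX -[X in X <= _]ger0_norm ?sqr_ge0// !normrX lerXn2r ?nnegrE.
  by apply: taylor2 ff'' ff3 _ => z zy; apply: fM; exact: le_trans yx.
have h (y : R) : is_derive y 1 (fun z => f z - f 0 - f' 0 * z - f'' 0 / 2 * z ^+ 2)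
   (f' y - f' 0 - f'' 0 * y).
  by apply: is_derive_eq; rewrite /GRing.scale/=; field.
have := @derive_bound0 _ _ `|x| (M * `|x| ^+ 2) x h _ h1 (lexx _).
by rewrite -(mulrA M) -(exprSr `|x|); apply; rewrite expr0n/= !mulr0 subrr !subr0.
Qed.

Lemma cosB1_le x : `|1 - cos x| <= x ^+ 2.
Proof.
have := @taylor2 (@cos R) (fun y => - sin y) (fun y => - cos y) x 1.
rewrite cos0 sin0 oppr0 mul0r subr0 mul1r distrC; apply => y _.
by rewrite normrN cos_max.
Qed.

Lemma sinB_le x : `|sin x - x| <= x ^+ 2.
Proof.
have := @taylor2 (@sin R) (fun y => cos y) (fun y => - sin y) x 1.
rewrite cos0 sin0 subr0 mul1r mul1r; apply => y _.
by rewrite normrN sin_max.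
Qed.

Lemma sin_le_abs x : `|sin x| <= `|x|.
Proof.
have := @derive_bound0 (@sin R) (@cos R) `|x| 1 x.
rewrite mul1r sin0; apply => // y _; exact: cos_max.
Qed.

Lemma cosB3_le x : `|1 - cos x - x ^+ 2 / 2| <= `|x| ^+ 3.
Proof.
have := @taylor3 (@cos R) (fun y => - sin y) (fun y => - cos y) (fun y => sin y) x 1.
rewrite cos0 sin0 oppr0 mul0r subr0 mul1r => h.
rewrite -normrN; have -> : - (1 - cos x - x ^+ 2 / 2) = cos x - 1 - -1 / 2 * x ^+ 2 by field.
apply: h => y; last by rewrite sin_max.
by apply: is_derive_eq; rewrite opprK.
Qed.

End calculus.

Section weight.
Context (R : realType).
Implicit Types (f g : R -> R) (x y c p C M : R).

Definition wt x := 1 + x ^+ 2.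

Lemma wt_ge1 x : 1 <= wt x.
Proof. by rewrite lerDl sqr_ge0. Qed.

Lemma wt_gt0 x : 0 < wt x.
Proof. exact: lt_le_trans (wt_ge1 x). Qed.

Lemma wt_ge0 x : 0 <= wt x.
Proof. exact/ltW/wt_gt0. Qed.

Lemma wtX_ge1 x m : 1 <= wt x ^+ m.
Proof. exact/exprn_ege1/wt_ge1. Qed.

Lemma wtX_ge0 x m : 0 <= wt x ^+ m.
Proof. exact/exprn_ge0/ltW/wt_gt0. Qed.

Lemma norm_le_wt x : `|x| <= wt x.
Proof. by rewrite /wt; case: (ler0P x) => _; nra. Qed.

Lemma wtX_le x m n : (m <= n)%N -> wt x ^+ m <= wt x ^+ n.
Proof. by move=> mn; exact: (ler_weXn2l (wt_ge1 x)). Qed.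

(** This near-submultiplicativity splits a bound at a displaced point [p + xi t w] into a factor in
    [p] and a random factor with finite moments. *)
Lemma wtD x y : wt (x + y) <= 2 * (wt x * wt y).
Proof. by rewrite /wt; have := sqr_ge0 (x - y); have := sqr_ge0 (x * y); nra. Qed.

Lemma wtXD x y m : wt (x + y) ^+ m <= 2 ^+ m * (wt x ^+ m * wt y ^+ m).
Proof.
by rewrite -!exprMn lerXn2r ?wtD// nnegrE ltW// ?mulr_gt0 // ?mulr_gt0 ?wt_gt0.
Qed.

Lemma wt_norm_le x y : `|x| <= `|y| -> wt x <= wt y.
Proof. by move=> xy; rewrite lerD2l -(real_normK (num_real x)) -(real_normK (num_real y)) lerXn2r ?nnegrE. Qed.

Lemma wtX_norm_le x y m : `|x| <= `|y| -> wt x ^+ m <= wt y ^+ m.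
Proof. by move=> xy; rewrite lerXn2r ?wt_norm_le// nnegrE ltW// wt_gt0. Qed.

(* Polynomially bounded functions. *)
Definition pbd (f : R -> R) := exists C m, 0 <= C /\ forall x, `|f x| <= C * wt x ^+ m.

Lemma pbd_weak f C m n : 0 <= C -> (forall x, `|f x| <= C * wt x ^+ m) -> (m <= n)%N ->
  forall x, `|f x| <= C * wt x ^+ n.
Proof. by move=> C0 fC mn x; apply: le_trans (fC x) _; rewrite ler_wpM2l ?wtX_le. Qed.

Lemma pbdD f g : pbd f -> pbd g -> pbd (fun x => f x + g x).
Proof.
move=> [C [m [C0 fC]]] [C' [m' [C'0 gC]]]; exists (C + C'), (maxn m m').
split=> [|x]; first exact: addr_ge0.
rewrite (le_trans (ler_normD _ _))// mulrDl lerD//.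
- by apply: pbd_weak fC _ _ => //; exact: leq_maxl.
- by apply: pbd_weak gC _ _ => //; exact: leq_maxr.
Qed.

Lemma pbdM f g : pbd f -> pbd g -> pbd (fun x => f x * g x).
Proof.
move=> [C [m [C0 fC]]] [C' [m' [C'0 gC]]]; exists (C * C'), (m + m')%N.
split=> [|x]; first exact: mulr_ge0.
by rewrite normrM exprD mulrACA ler_pM.
Qed.

Lemma pbd_cst c : pbd (fun=> c).
Proof. by exists `|c|, 0%N; split=> // x; rewrite expr0 mulr1. Qed.

Lemma pbd_shift f p : pbd f -> pbd (fun x => f (p + x)).
Proof.
move=> [C [m [C0 fC]]]; exists (C * (2 ^+ m * wt p ^+ m)), m; split=> [|x].
  by rewrite !mulr_ge0 ?wtX_ge0 ?exprn_ge0.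
by apply: le_trans (fC _) _; rewrite -mulrA ler_wpM2l// -mulrA wtXD.
Qed.

Lemma pbd_bounded f M : (forall x, `|f x| <= M) -> pbd f.
Proof.
move=> fM; exists M, 0%N; split; first exact: le_trans (fM 0).
by move=> x; rewrite expr0 mulr1.
Qed.

End weight.

Ltac nonneg := do ?[by [] | apply: addr_ge0 | apply: sqr_ge0 | apply: wtX_ge0 |
  apply: wt_ge0 | apply: expR_ge0 | apply: exprn_ge0 | apply: mulr_ge0 | by rewrite invr_ge0].

(** * Trigonometric approximation *)

Section heine.
Context (R : realType).

Lemma continuous_integrable_itv (f : R -> R) a b : continuous f ->
  (@lebesgue_measure R).-integrable `[a, b] (EFin \o f).
Proof.
move=> cf; apply: continuous_compact_integrable; first exact: segment_compact.
exact: continuous_subspaceT.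
Qed.

Lemma FTC_Rintegral (F f : R -> R) a b : (forall x : R, is_derive x 1 F (f x)) ->
  continuous f -> a < b -> \int[lebesgue_measure]_(x in `[a, b]) f x = F b - F a.
Proof.
move=> Ff cf ab; rewrite /Rintegral (@continuous_FTC2 _ f F)//.
- exact: continuous_subspaceT.
- split => [x _||].
  + exact/ex_derive.
  + exact/cvg_at_right_filter/is_derive_continuous.
  + exact/cvg_at_left_filter/is_derive_continuous.
- by move=> x _; rewrite derive1E derive_val.
Qed.

(** Compactness of the segment in its near-covering form. Halving both the tolerance and the radius
    leaves room for the detour through the centre of a covering ball. *)
Lemma uniform_continuity_itv (f : R -> R) (a b e : R) : continuous f -> 0 < e ->
  exists2 dl : R, 0 < dl & forall x y : R, a <= x <= b -> `|y - x| < dl -> `|f y - f x| <= e.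
Proof.
move=> cf e0.
have /compact_near_coveringP/near_covering_withinP := @segment_compact R a b.
move=> /(_ _ (0^'+) (fun dl x => forall y, `|y - x| < dl -> `|f y - f x| <= e) _).
case.
  move=> x _.
  have /cvgrPdist_lt/(_ (e / 2) ltac:(lra))[r /= r0 xr] := cf x.
  exists (ball x (r / 2), `]-oo, r / 2[%classic) => /=.
    split; first by apply: nbhsx_ballx; lra.
    by apply: nbhs_right_lt; lra.
  move=> [x' dl]/= [xx' dlr] _ y yx'.
  rewrite in_itv/= in dlr.
  rewrite /ball/= in xx'.
  have h1 : `|f x - f x'| < e / 2 by apply: xr => /=; lra.
  have h2 : `|f x - f y| < e / 2.
    apply: xr => /=; apply: le_lt_trans (ler_distD x' _ _) _.
    rewrite (distrC x'); lra.
  apply: le_trans (ler_distD (f x) _ _) _.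
  rewrite (distrC (f y)); lra.
move=> dl /= dl0 h; exists (dl / 2); first lra.
move=> x y xab; apply: (h (dl / 2)) => //=.
- by rewrite sub0r normrN gtr0_norm; lra.
- lra.
Qed.

End heine.

Section trig.
Context (R : realType).
Implicit Types (T F : R -> R).

(** Real trigonometric polynomials with arbitrary real frequencies, so that the class is stable
    under rescaling. Only linear operations are built in; products come from the product-to-sum
    formulas, and statements linear in the function follow by induction. *)
Inductive trig : (R -> R) -> Prop :=
| trig_cos x : trig (fun q => cos (x * q))
| trig_sin x : trig (fun q => sin (x * q))
| trig_add S T : trig S -> trig T -> trig (fun q => S q + T q)
| trig_scale a T : trig T -> trig (fun q => a * T q).

Lemma trig_ext S T : S =1 T -> trig S -> trig T.
Proof. by move=> /funext ->. Qed.

Lemma trig_cst a : trig (fun=> a).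
Proof.
apply: trig_ext (trig_scale a (trig_cos 0)) => q.
by rewrite mul0r cos0 mulr1.
Qed.

Lemma trig_mul S T : trig S -> trig T -> trig (fun q => S q * T q).
Proof.
move=> tS; elim: tS T => {S}.
- move=> x T; elim => {T}.
  + move=> y.
    apply: trig_ext (trig_scale (1/2) (trig_add (trig_cos (x + y)) (trig_cos (x - y)))) => q.
    by rewrite mulrBl mulrDl cosB cosD; field.
  + move=> y.
    apply: trig_ext (trig_scale (1/2) (trig_add (trig_sin (x + y)) (trig_scale (-1) (trig_sin (x - y))))) => q.
    by rewrite mulrBl mulrDl sinB sinD; field.
  + by move=> S T _ h1 _ h2; apply: trig_ext (trig_add h1 h2) => q; rewrite mulrDr.
  + by move=> a T _ h; apply: trig_ext (trig_scale a h) => q; rewrite mulrCA.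
- move=> x T; elim => {T}.
  + move=> y.
    apply: trig_ext (trig_scale (1/2) (trig_add (trig_sin (x + y)) (trig_sin (x - y)))) => q.
    by rewrite mulrBl mulrDl sinB sinD; field.
  + move=> y.
    apply: trig_ext (trig_scale (1/2) (trig_add (trig_cos (x - y)) (trig_scale (-1) (trig_cos (x + y))))) => q.
    by rewrite mulrBl mulrDl cosB cosD; field.
  + by move=> S T _ h1 _ h2; apply: trig_ext (trig_add h1 h2) => q; rewrite mulrDr.
  + by move=> a T _ h; apply: trig_ext (trig_scale a h) => q; rewrite mulrCA.
- by move=> S1 S2 _ h1 _ h2 T tT; apply: trig_ext (trig_add (h1 _ tT) (h2 _ tT)) => q; rewrite mulrDl.
- by move=> a S _ h T tT; apply: trig_ext (trig_scale a (h _ tT)) => q; rewrite mulrA.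
Qed.

Lemma trig_exp T n : trig T -> trig (fun q => T q ^+ n).
Proof.
move=> tT; elim: n => [|n ih]; first by apply: trig_ext (trig_cst 1).
by apply: trig_ext (trig_mul tT ih) => q; rewrite exprS.
Qed.

Lemma trig_comp T s : trig T -> trig (fun q => T (s * q)).
Proof.
elim=> {T} [x|x|S T _ h1 _ h2|a T _ h].
- by apply: trig_ext (trig_cos (x * s)) => q; rewrite mulrA.
- by apply: trig_ext (trig_sin (x * s)) => q; rewrite mulrA.
- exact: trig_add h1 h2.
- by apply: trig_ext (trig_scale a h) => q.
Qed.

Lemma trig_continuous T : trig T -> continuous T.
Proof.
elim=> {T} [x|x|S T _ h1 _ h2|a T _ h] q.
- by apply: continuous_comp; [exact: mulrl_continuous|exact: continuous_cos].
- by apply: continuous_comp; [exact: mulrl_continuous|exact: continuous_sin].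
- by apply: cvgD; [exact: h1|exact: h2].
- by apply: cvgMr; exact: h.
Qed.

(** The addition formulas separate [k] from [y], leaving integrals of [F] against cosines and sines
    as coefficients. *)
Lemma trig_conv F T : continuous F -> trig T ->
  trig (fun k => \int[lebesgue_measure]_(y in `[- pi, pi]) (F y * T (k - y))).
Proof.
move=> cF.
have cM (f g : R -> R) : continuous f -> continuous g -> continuous (fun y => f y * g y).
  by move=> cf cg y; apply: cvgM; [exact: cf|exact: cg].
have int (f g : R -> R) : continuous f -> continuous g ->
    (@lebesgue_measure R).-integrable `[- pi, pi] (EFin \o (fun y => f y * g y)).
  by move=> cf cg; apply: continuous_integrable_itv; exact: cM.
elim=> {T} [x|x|S T tS h1 tT h2|a T tT h].
- have cc := trig_continuous (trig_cos x); have cs := trig_continuous (trig_sin x).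
  pose A := \int[lebesgue_measure]_(y in `[- pi, pi]) (F y * cos (x * y)).
  pose B := \int[lebesgue_measure]_(y in `[- pi, pi]) (F y * sin (x * y)).
  apply: trig_ext (trig_add (trig_scale A (trig_cos x)) (trig_scale B (trig_sin x))) => k.
  rewrite mulrC (mulrC B) -!RintegralZl//; [|exact: int|exact: int].
  rewrite -RintegralD//; last 2 first.
  + by apply: continuous_integrable_itv => y; apply: cvgMr; exact: cM.
  + by apply: continuous_integrable_itv => y; apply: cvgMr; exact: cM.
  by apply: eq_Rintegral => y _; rewrite mulrBr cosB; ring.
- have cc := trig_continuous (trig_cos x); have cs := trig_continuous (trig_sin x).
  pose A := \int[lebesgue_measure]_(y in `[- pi, pi]) (F y * cos (x * y)).
  pose B := \int[lebesgue_measure]_(y in `[- pi, pi]) (- F y * sin (x * y)).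
  apply: trig_ext (trig_add (trig_scale A (trig_sin x)) (trig_scale B (trig_cos x))) => k.
  have cNF : continuous (fun y => - F y) by move=> y; apply: cvgN; exact: cF.
  rewrite mulrC (mulrC B) -!RintegralZl//; [|exact: (int _ _ cNF cs)|exact: int].
  rewrite -RintegralD//; last 2 first.
  + by apply: continuous_integrable_itv => y; apply: cvgMr; exact: cM.
  + by apply: continuous_integrable_itv => y; apply: cvgMr; exact: (cM _ _ cNF cs).
  by apply: eq_Rintegral => y _; rewrite mulrBr sinB; ring.
- have c1 := trig_continuous tS; have c2 := trig_continuous tT.
  have cB (f : R -> R) k : continuous f -> continuous (fun y => f (k - y)).
    move=> cf y; apply: continuous_comp; last exact: cf.
    by apply: cvgB; [exact: cvg_cst|exact: cvg_id].
  apply: trig_ext (trig_add h1 h2) => k.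
  rewrite -RintegralD//; [|by apply: int => //; exact: cB|by apply: int => //; exact: cB].
  by apply: eq_Rintegral => y _; rewrite mulrDr.
- have cB (f : R -> R) k : continuous f -> continuous (fun y => f (k - y)).
    move=> cf y; apply: continuous_comp; last exact: cf.
    by apply: cvgB; [exact: cvg_cst|exact: cvg_id].
  have c1 := trig_continuous tT.
  apply: trig_ext (trig_scale a h) => k.
  rewrite -RintegralZl//; last by apply: int => //; exact: cB.
  by apply: eq_Rintegral => y _; rewrite mulrCA.
Qed.

End trig.

Section korovkin.
Context (R : realType).
Implicit Types (F T : R -> R) (D N e k t : R).

(* The de la Vallee-Poussin kernel, up to normalisation. *)
Definition vpker (n : nat) (t : R) : R := ((1 + cos t) / 2) ^+ n.

Lemma trig_vpker n : trig (vpker n).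
Proof.
apply: trig_exp; apply: trig_ext (trig_scale (1/2) (trig_add (trig_cst 1) (trig_cos 1))) => q.
by rewrite (mul1r q); field.
Qed.

Lemma vpker_ge0 n t : 0 <= vpker n t.
Proof. by rewrite exprn_ge0// divr_ge0// -lerBlDl sub0r cos_geN1. Qed.

Lemma vpkerS n t : vpker n.+1 t = (1 + cos t) / 2 * vpker n t.
Proof. exact: exprS. Qed.

(** A combination of two consecutive kernels is an exact derivative of a periodic function.
    Integrated over a period, this becomes the two-term recursion for the masses. *)
Lemma is_derive_sin_vpker n (t : R) : is_derive t 1 (fun y => sin y * vpker n y)
  (2 * n.+1%:R * vpker n.+1 t - (2 * n%:R + 1) * vpker n t).
Proof.
elim: n => [|n ih].
  have -> : (fun y : R => sin y * vpker 0 y) = (fun y => sin y).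
    by apply/funext => y; rewrite /vpker expr0 mulr1.
  by apply: is_derive_eq; rewrite vpkerS /vpker expr0; field.
have -> : (fun y : R => sin y * vpker n.+1 y) =
    (fun y => (sin y * vpker n y) * ((1 + cos y) / 2)).
  by apply/funext => y; rewrite vpkerS; ring.
have h : is_derive t 1 (fun y : R => (1 + cos y) / 2) (- sin t / 2).
  by apply: is_derive_eq; rewrite /GRing.scale/=; field.
apply: is_derive_eq; rewrite /GRing.scale/= !vpkerS -!natr1.
have := cos2Dsin2 t; move: (sin t) (cos t) (vpker n t) (n%:R) => s c v m sc.
rewrite [X in X + _](_ : _ = - (s ^+ 2) * v / 2); last by field.
by rewrite (_ : s ^+ 2 = 1 - c ^+ 2); [field|rewrite -sc; ring].
Qed.

Let mass n k := \int[lebesgue_measure]_(y in `[- pi, pi]) vpker n (k - y).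

Let cB (f : R -> R) k : continuous f -> continuous (fun y => f (k - y)).
Proof.
move=> cf y; apply: continuous_comp; last exact: cf.
by apply: cvgB; [exact: cvg_cst|exact: cvg_id].
Qed.

Let int_ker n k :
  (@lebesgue_measure R).-integrable `[- pi, pi] (EFin \o (fun y => vpker n (k - y))).
Proof. by apply/continuous_integrable_itv/cB/trig_continuous/trig_vpker. Qed.

Lemma vpker_massS n k : 2 * n.+1%:R * mass n.+1 k = (2 * n%:R + 1) * mass n k.
Proof.
apply/eqP; rewrite -subr_eq0 /mass -!RintegralZl//.
rewrite -RintegralB//; last 2 first.
- by apply/continuous_integrable_itv => y; apply: cvgMr; apply/cB/trig_continuous/trig_vpker.
- by apply/continuous_integrable_itv => y; apply: cvgMr; apply/cB/trig_continuous/trig_vpker.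
have dG (y : R) : is_derive y 1 (fun y => - (sin (k - y) * vpker n (k - y)))
    (2 * n.+1%:R * vpker n.+1 (k - y) - (2 * n%:R + 1) * vpker n (k - y)).
  have h1 : is_derive y 1 (fun y => k - y) (- 1).
    by apply: is_derive_eq; ring.
  have h2 := is_derive_sin_vpker n (k - y).
  have h3 := @is_derive1_comp _ (fun y => sin y * vpker n y) (fun y => k - y) y _ _ h2 h1.
  have h := is_deriveN h3.
  by apply: is_derive_eq; rewrite mulrN1 opprK.
rewrite (FTC_Rintegral dG).
- rewrite /vpker subr_eq0 eqr_opp (opprK pi).
  have -> : k + pi = k - pi + pi *+ 2 by rewrite mulr2n; ring.
  by rewrite sinD2pi cosD2pi.
- by move=> y; apply: cvgB; apply: cvgMr; apply/cB/trig_continuous/trig_vpker.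
- by rewrite -subr_gt0 opprK addr_gt0// pi_gt0.
Qed.

(** The recursion of [vpker_massS] has coefficients independent of [k], and the mass for [n = 0] is
    that of a constant; translation invariance follows by induction, without a change of
    variables. *)
Lemma vpker_mass_cst n k : mass n k = mass n 0.
Proof.
elim: n => [|n ih]; first by [].
have : 2 * n.+1%:R != 0 :> R by rewrite mulf_neq0// pnatr_eq0.
by move=> /mulfI; apply; rewrite !vpker_massS ih.
Qed.

Lemma vpker_mass_gt0 n k : 0 < mass n k.
Proof.
elim: n => [|n ih].
  rewrite /mass (_ : (fun y => vpker 0 (k - y)) = cst 1) // Rintegral_cst//.
  rewrite mul1r /= lebesgue_measure_itv/= lte_fin ifT; last by rewrite -subr_gt0 opprK addr_gt0// pi_gt0.
  by rewrite /= opprK addr_gt0// pi_gt0.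
have : 0 < 2 * n.+1%:R * mass n.+1 k by rewrite vpker_massS mulr_gt0// -natrM natr1.
by rewrite pmulr_rgt0// mulr_gt0.
Qed.

(** For [k] in the inner half of the period and [y] in the whole of it, [k - y] stays within
    [3 * pi / 2], hence away from the zeros of [1 - cos] other than 0. *)
Let cos_sep (dl : R) t : 0 < dl -> dl < pi -> dl <= `|t| -> `|t| <= pi + pi / 2 ->
  Num.min 1 (1 - cos dl) <= 1 - cos t.
Proof.
move=> dl0 dlpi dlt tp; rewrite ge_min; have pi0 := pi_gt0 R.
have ct : cos t = cos `|t| by case: (ler0P t) => // _; rewrite cosN.
have [tpi|pit] := leP `|t| pi.
  apply/orP; right; rewrite lerD2l lerN2 ct.
  move: dlt; rewrite le_eqVlt => /predU1P[->//|dlt].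
  by rewrite ltW// ltr_cos// in_itv/=; apply/andP; split=> //; lra.
apply/orP; left; rewrite lerDl oppr_ge0 ct.
have -> : `|t| = (`|t| - pi) + pi by lra.
by rewrite cosDpi oppr_le0 cos_ge0_pihalf//; apply/andP; split; lra.
Qed.

(** Korovkin's argument. Near the diagonal [F y - F k] is at most [e / 2]; elsewhere a multiple of
    [1 - (1 + cos (k - y)) / 2] dominates it. Integrated against [vpker n], that function gives the
    difference of two consecutive masses. Positivity of the kernel also makes the approximant
    inherit the bound [D] on the whole line. *)
Lemma trig_approx_pi F D e : continuous F -> 0 < e ->
  (forall y, `|y| <= pi -> `|F y| <= D) ->
  exists T, [/\ trig T, forall k, `|k| <= pi / 2 -> `|F k - T k| <= e &
    forall k, `|T k| <= D].
Proof.
move=> cF e0 FD; have pi0 := pi_gt0 R.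
have D0 : 0 <= D by apply: le_trans (FD 0 _); rewrite ?normr0 ?pi_ge0.
have [dl' dl'0 Fdl'] := @uniform_continuity_itv R F (- pi) pi (e / 2) cF ltac:(lra).
pose dl := Num.min dl' 1.
have dl0 : 0 < dl by rewrite lt_min dl'0 ltr01.
have dlpi : dl < pi.
  rewrite gt_min; apply/orP; right; have := pi_ge2 R; lra.
have Fdl x y : `|x| <= pi -> `|y - x| < dl -> `|F y - F x| <= e / 2.
  by rewrite ler_norml => xpi; rewrite lt_min => /andP[yx _]; exact: Fdl'.
pose ka := Num.min 1 (1 - cos dl).
have ka0 : 0 < ka.
  rewrite lt_min ltr01/= subr_gt0 -cos0 ltr_cos// in_itv/= ?lexx ?ltW//.
pose M := 4 * D / ka.
have M0 : 0 <= M by rewrite divr_ge0 ?mulr_ge0// ltW.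
have key k y : `|k| <= pi / 2 -> `|y| <= pi ->
    `|F y - F k| <= e / 2 + M * (1 - (1 + cos (k - y)) / 2).
  move=> kpi ypi.
  have [kydl|dlky] := ltP `|y - k| dl.
    rewrite (le_trans (Fdl _ _ _ kydl))//; first by apply: le_trans kpi _; lra.
    rewrite lerDl mulr_ge0//; have := cos_le1 (k - y); lra.
  apply: (@le_trans _ _ (D + D)).
    rewrite (le_trans (ler_normB _ _))// lerD// FD//.
    by apply: le_trans kpi _; lra.
  have : ka <= 1 - cos (k - y).
    apply: cos_sep => //; rewrite distrC//.
    by rewrite (le_trans (ler_normB _ _))// lerD.
  rewrite -[X in X <= _]mul1r -ler_pdivlMr// => h.
  rewrite (_ : M * _ = 2 * D * ((1 - cos (k - y)) / ka)); last first.
    by rewrite /M; field; rewrite gt_eqF.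
  have : 2 * D * 1 <= 2 * D * ((1 - cos (k - y)) / ka) by rewrite ler_wpM2l// mulr_ge0.
  lra.
(* The ratio of consecutive masses makes the average of [1 - (1 + cos) / 2] equal to
   [1 / (2 * n.+1)], and [n] is chosen so that [M] times this is at most [e / 2]. *)
pose n := Num.truncn (M / e).
have nM : M / (2 * n.+1%:R) <= e / 2.
  have := truncnS_gt (M / e); rewrite -/n ltr_pdivrMr// ler_pdivrMr ?mulr_gt0//.
  by set z := n.+1%:R; lra.
pose c := mass n 0.
have c0 : 0 < c by exact: vpker_mass_gt0.
have cqk k : continuous (fun y => vpker n (k - y)) by apply/cB/trig_continuous/trig_vpker.
have cFqk k : continuous (fun y => F y * vpker n (k - y)).
  by move=> y; apply: cvgM; [exact: cF|exact: cqk].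
exists (fun k => c^-1 * \int[lebesgue_measure]_(y in `[- pi, pi]) (F y * vpker n (k - y))).
split=> [|k kpi|k].
- by apply: trig_scale; exact: trig_conv (trig_vpker n).
- have -> : F k = c^-1 * \int[lebesgue_measure]_(y in `[- pi, pi]) (F k * vpker n (k - y)).
    rewrite RintegralZl// -/(mass n k) vpker_mass_cst -/c mulrCA mulVf ?mulr1//.
    by rewrite gt_eqF.
  rewrite -mulrBr -RintegralB//; last 2 first.
    by apply/continuous_integrable_itv => y; apply: cvgMr; exact: cqk.
    exact: continuous_integrable_itv.
  rewrite normrM gtr0_norm ?invr_gt0// mulrC ler_pdivrMr//.
  have cd : continuous (fun y => F k * vpker n (k - y) - F y * vpker n (k - y)).
    by move=> y; apply: cvgB; [apply: cvgMr; exact: cqk|exact: cFqk].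
  apply: le_trans (le_normr_Rintegral _ _) _ => //; first exact: continuous_integrable_itv.
  have cq' : continuous (fun y => vpker n.+1 (k - y)) by apply/cB/trig_continuous/trig_vpker.
  apply: (@le_trans _ _ (\int[lebesgue_measure]_(y in `[- pi, pi])
      ((e / 2 + M) * vpker n (k - y) - M * vpker n.+1 (k - y)))).
    apply: le_Rintegral => //.
    + by apply: continuous_integrable_itv => y; apply: cvg_norm; exact: cd.
    + apply: continuous_integrable_itv => y.
      by apply: cvgB; apply: cvgMr; [exact: cqk|exact: cq'].
    + move=> y; rewrite /= in_itv/= -ler_norml => ypi.
      rewrite -mulrBl normrM (ger0_norm (vpker_ge0 _ _)) distrC.
      apply: le_trans (ler_wpM2r (vpker_ge0 _ _) (key _ _ kpi ypi)) _.
      by rewrite vpkerS; lra.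
  rewrite RintegralB//; last 2 first.
    by apply: continuous_integrable_itv => y; apply: cvgMr; exact: cqk.
    by apply: continuous_integrable_itv => y; apply: cvgMr; exact: cq'.
  rewrite !RintegralZl// -/(mass n k) -/(mass n.+1 k).
  have -> : mass n.+1 k = (2 * n%:R + 1) / (2 * n.+1%:R) * mass n k.
    rewrite mulrAC -vpker_massS mulrAC divff ?mul1r// mulf_neq0// pnatr_eq0//.
  rewrite vpker_mass_cst -/c mulrA -mulrBl ler_wpM2r//; first exact: ltW.
  rewrite (_ : _ - _ = e / 2 + M / (2 * n.+1%:R)); first by move: nM; set z := M / _; lra.
  have gen (x y z : R) : 0 <= z ->
      x + y - y * ((2 * z + 1) / (2 * (z + 1))) = x + y / (2 * (z + 1)).
    by move=> z0; field; apply: lt0r_neq0; lra.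
  by rewrite -(natr1 n) gen.
- rewrite normrM gtr0_norm ?invr_gt0// mulrC ler_pdivrMr//.
  apply: le_trans (le_normr_Rintegral _ _) _ => //; first exact: continuous_integrable_itv.
  rewrite /c -(vpker_mass_cst n k) /mass -RintegralZl//.
  apply: le_Rintegral => //.
  + by apply: continuous_integrable_itv => y; apply: cvg_norm; exact: cFqk.
  + by apply: continuous_integrable_itv => y; apply: cvgMr; exact: cqk.
  + move=> y; rewrite /= in_itv/= -ler_norml => ypi.
    by rewrite normrM (ger0_norm (vpker_ge0 _ _)) ler_wpM2r ?vpker_ge0// FD.
Qed.

(** Rescaling by [2 * N / pi] sends the half period to [N] and the full one to [2 * N]. Outside
    [[-N, N]] the approximant is no longer close to [F], but the bound [D] persists there, and
    weights will absorb it. *)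
Lemma trig_approx F N D e : continuous F -> 0 < e -> 0 < N ->
  (forall y, `|y| <= 2 * N -> `|F y| <= D) ->
  exists T, [/\ trig T, forall k, `|k| <= N -> `|F k - T k| <= e &
    forall k, `|T k| <= D].
Proof.
move=> cF e0 N0 FD; have pi0 := pi_gt0 R.
pose s := 2 * N / pi; have s0 : 0 < s by rewrite divr_gt0// mulr_gt0.
have [||T [tT FT TD]] := @trig_approx_pi (fun y => F (s * y)) D e _ e0.
- by move=> y; apply: continuous_comp; [exact: mulrl_continuous|exact: cF].
- move=> y ypi; apply: FD; rewrite normrM gtr0_norm// /s mulrAC ler_pdivrMr// ler_wpM2l//.
  by rewrite ltW// mulr_gt0.
exists (fun k => T (s^-1 * k)); split => //; first exact: trig_comp.
move=> k kN; have := FT (s^-1 * k); rewrite mulrA divff ?gt_eqF// mul1r; apply.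
rewrite normrM gtr0_norm ?invr_gt0// mulrC ler_pdivrMr// /s.
have gen (z : R) : 0 < z -> z / 2 * (2 * N / z) = N.
  by move=> z0; field; exact: lt0r_neq0.
by rewrite gen.
Qed.

End korovkin.

Lemma wtX_continuous (R : realType) m : continuous (fun x : R => wt x ^+ m).
Proof.
move=> x; apply: (@continuous_comp _ _ _ (@wt R) (fun y => y ^+ m)); last exact: exprn_continuous.
by apply: cvgD; [exact: cvg_cst|exact: exprn_continuous].
Qed.

(** * Levy measures with moments of all orders *)

Section levy_measure_facts.
Context (R : realType) (nu : {measure set (measurableTypeR R) -> \bar R}).
Implicit Types (f : R -> R) (x k : R).

Lemma continuous_measurable (D : set R) f : continuous f -> measurable_fun D f.
Proof. by move=> cf; apply: measurable_funTS; exact: continuous_measurable_fun. Qed.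

Lemma integral_punctured (g : R -> \bar R) : g 0 = 0%E ->
  (\int[nu]_(k in ~` [set 0%R]) g k = \int[nu]_k g k)%E.
Proof.
move=> g0; rewrite integral_mkcond; congr (integral _ _ _); apply/funext => k.
by rewrite patchE; case: ifPn => // /negP; rewrite inE/= => /contrapT ->.
Qed.

Lemma Rintegral_punctured f : f 0 = 0 ->
  \int[nu]_(k in ~` [set 0]) f k = \int[nu]_k f k.
Proof. by move=> f0; rewrite /Rintegral integral_punctured// f0. Qed.

Lemma integrable_punctured f : nu.-integrable setT (EFin \o f) ->
  nu.-integrable (~` [set 0]) (EFin \o f).
Proof. by apply: integrableS => //; exact: measurableC. Qed.

Hypothesis nu_levy : levy_measure nu.
Hypothesis nu_sym : symmetric_measure nu.
Hypothesis nu_mom : moments_of_all_orders nu.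

(** The reference function for all jump integrals. Jumps of size at most 1 are controlled by
    [Num.min 1 (k ^+ 2)] with [wt k <= 2], the others by the moment of order [2 * m + 2] with
    [wt k <= 2 * k ^+ 2]; hence the factor [2 ^+ m]. *)
Lemma levy_moment m : exists K, L1le nu setT (fun k => k ^+ 2 * wt k ^+ m) K.
Proof.
have [_ h1] := nu_levy; have h2 := nu_mom (ltac:(by rewrite addn2) : (1 <= 2 * m + 2)%N).
have mD : measurable [set k : R | 1 < `|k|].
  rewrite (_ : [set _ | _] = (fun k : R => `|k|) @^-1` `]1, +oo[); last first.
    by apply/seteqP; split => k /=; rewrite in_itv/= andbT.
  rewrite -[X in measurable X]setTI; apply: continuous_measurable => //.
  by move=> k; apply: cvg_norm.
pose f1 (k : R) := Num.min 1 (k ^+ 2).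
pose f2 (k : R) := (\1_[set k : R | 1 < `|k|] k) * `|k| ^+ (2 * m + 2).
have mf1 : measurable_fun setT f1.
  apply: measurable_minr => //; apply: continuous_measurable => k; exact: exprn_continuous.
have mnX n : measurable_fun setT (fun k : R => `|k| ^+ n).
  apply: measurable_funX; apply: continuous_measurable => k; exact: norm_continuous.
have mf2 : measurable_fun setT f2 by apply: measurable_funM.
have f10 k : 0 <= f1 k by rewrite le_min ler01 sqr_ge0.
have f20 k : 0 <= f2 k by rewrite mulr_ge0// exprn_ge0.
have [i1 i1E] : exists i1 : R, (\int[nu]_k `|f1 k|%:E <= i1%:E)%E.
  exists (fine (\int[nu]_k `|f1 k|%:E)); rewrite fineK//.
  have h1' : (\int[nu]_k `|f1 k|%:E < +oo)%E.
    move: h1; rewrite integral_punctured; last by rewrite expr0n/= min_r.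
    by move=> h; under eq_integral do rewrite ger0_norm//.
  by rewrite ge0_fin_numE// integral_ge0.
have [i2 i2E] : exists i2 : R, (\int[nu]_k `|f2 k|%:E <= i2%:E)%E.
  exists (fine (\int[nu]_k `|f2 k|%:E)); rewrite fineK//.
  have h2' : (\int[nu]_k `|f2 k|%:E < +oo)%E.
    move: h2; rewrite integral_mkcond.
    congr (_ < _)%E; apply: eq_integral => k _; rewrite ger0_norm// patchE /f2 indicE.
    by case: ifPn => kD; rewrite ?mul1r ?mul0r.
  by rewrite ge0_fin_numE// integral_ge0.
exists (`|2 ^+ m| * (i1 + i2)).
have F1 : L1le nu setT f1 i1 by split.
have F2 : L1le nu setT f2 i2 by split.
have F3 := L1le_scale measurableT (2 ^+ m) (L1le_add measurableT F1 F2).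
refine (L1le_dom measurableT _ _ F3).
  apply: measurable_funM; apply: continuous_measurable => k; first exact: exprn_continuous.
  exact: wtX_continuous.
move=> k _; rewrite !ger0_norm; last 2 first.
- by rewrite mulr_ge0 ?exprn_ge0 ?addr_ge0.
- by rewrite mulr_ge0 ?sqr_ge0 ?wtX_ge0.
have [k1|k1] := leP `|k| 1.
  have k21 : k ^+ 2 <= 1 by rewrite -(real_normK (num_real k)) expr_le1.
  rewrite /f1 min_r// (@le_trans _ _ (2 ^+ m * k ^+ 2))//; last first.
    by rewrite ler_wpM2l ?exprn_ge0// lerDl.
  by rewrite mulrC ler_wpM2r ?sqr_ge0// lerXn2r ?nnegrE ?wt_ge0// /wt; lra.
rewrite (@le_trans _ _ (2 ^+ m * f2 k))//; last by rewrite ler_wpM2l ?exprn_ge0// lerDr.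
rewrite /f2 indicE mem_set// mul1r exprD exprM real_normK ?num_real// mulrA mulrC.
rewrite ler_wpM2r ?sqr_ge0// -exprMn lerXn2r ?nnegrE ?wt_ge0//.
  by rewrite mulr_ge0// sqr_ge0.
rewrite /wt; have : 1 < k ^+ 2 by rewrite -(real_normK (num_real k)) exprn_egt1.
lra.
Qed.

Lemma levy_L1le f M m : measurable_fun setT f ->
  (forall k, `|f k| <= M * (k ^+ 2 * wt k ^+ m)) -> exists K, L1le nu setT f K.
Proof.
move=> mf fM; have [K hK] := levy_moment m.
exists (`|M| * K); refine (L1le_dom measurableT _ _ (L1le_scale measurableT M hK)); first exact: mf.
move=> k _.
apply: le_trans (fM k) _; exact: ler_norm.
Qed.

Lemma levy_integrable f M m : measurable_fun setT f ->
  (forall k, `|f k| <= M * (k ^+ 2 * wt k ^+ m)) -> nu.-integrable setT (EFin \o f).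
Proof. by move=> mf fM; have [K /L1le_integrable] := levy_L1le mf fM; exact. Qed.

Lemma Rintegral_opp f : nu.-integrable setT (EFin \o f) ->
  \int[nu]_k f (- k) = \int[nu]_k f k.
Proof.
move=> intf; rewrite /Rintegral; congr fine.
have mo : measurable_fun setT (fun k : measurableTypeR R => - k : measurableTypeR R).
  by apply: continuous_measurable => k; exact: opp_continuous.
have mf : measurable_fun setT (EFin \o f) by exact: measurable_int intf.
have E (g : R -> \bar R) : measurable_fun setT g -> (forall k, 0 <= g k)%E ->
    (\int[nu]_k g (- k)%R = \int[nu]_k g k)%E.
  move=> mg g0.
  rewrite [RHS](@eq_measure_integral _ _ _ _ (pushforward nu (fun k : measurableTypeR R => - k : measurableTypeR R))).
    rewrite (@ge0_integral_pushforward _ _ (measurableTypeR R) (measurableTypeR R) _ _ mo nu setT g measurableT mg)//.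
  by move=> A mA _; rewrite -(nu_sym mA).
rewrite [LHS]integralE [RHS]integralE; congr (_ - _)%E.
  rewrite -(E (funepos (EFin \o f)))//; last exact: measurable_funepos.
  by apply: eq_integral => k _; rewrite !funeposE.
rewrite -(E (funeneg (EFin \o f)))//; last exact: measurable_funeneg.
by apply: eq_integral => k _; rewrite !funenegE.
Qed.

Lemma Rintegral_odd f : nu.-integrable setT (EFin \o f) ->
  (forall k, f (- k) = - f k) -> \int[nu]_k f k = 0.
Proof.
move=> intf fN; have := Rintegral_opp intf.
under eq_Rintegral do rewrite fN -mulN1r.
by rewrite RintegralZl// => h; lra.
Qed.

End levy_measure_facts.

(** * Characteristic function and moments of the process *)

Section characteristic_function.
Context (R : realType) (b sigma : R) (nu : {measure set (measurableTypeR R) -> \bar R}).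
Context (d : measure_display) (Omega : measurableType d) (P : probability Omega R)
        (xi : R -> {RV P >-> R}).
Implicit Types (T S : R -> R) (x q t : R).

Hypothesis nu_levy : levy_measure nu.
Hypothesis nu_sym : symmetric_measure nu.
Hypothesis nu_mom : moments_of_all_orders nu.
Hypothesis xi_chf : forall t x, 0 <= t ->
  cintegral P setT (fun w => cexp (- ('i%C * (x * xi t w)%:C%C)))
  = cexp (- (t%:C%C * levy_symbol b sigma nu x)).

(** The real part of the Levy symbol. By symmetry of [nu] the compensated sine integrates to 0, and
    the imaginary part reduces to the drift [b * x]. *)
Definition lpsi x := sigma ^+ 2 / 2 * x ^+ 2 + \int[nu]_k (1 - cos (x * k)).

Lemma continuous_cosM x : continuous (fun k => cos (x * k)).
Proof. exact: trig_continuous (trig_cos x). Qed.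

Lemma continuous_sinM x : continuous (fun k => sin (x * k)).
Proof. exact: trig_continuous (trig_sin x). Qed.

Lemma integrable_1Bcos x : nu.-integrable setT (EFin \o (fun k => 1 - cos (x * k))).
Proof.
apply: (levy_integrable nu_levy nu_mom (M := x ^+ 2) (m := 0)).
  apply: continuous_measurable => k; apply: cvgB; [exact: cvg_cst|exact: continuous_cosM].
by move=> k; rewrite mulr1 (le_trans (cosB1_le _))// exprMn.
Qed.

(** On small jumps the compensated sine is at most [(x * k) ^+ 2]; on the others the compensator is
    absent and [|sin|] is at most 1, which is less than [k ^+ 2]. *)
Lemma integrable_compensated_sin x : nu.-integrable setT
  (EFin \o (fun k => sin (x * k) - x * k * \1_(@small_jumps R) k)).
Proof.
apply: (levy_integrable nu_levy nu_mom (M := x ^+ 2 + 1) (m := 0)).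
  apply: measurable_funB.
    by apply: continuous_measurable; exact: continuous_sinM.
  apply: measurable_funM; first by apply: continuous_measurable; exact: mulrl_continuous.
  apply: measurable_indic; rewrite /small_jumps.
  rewrite (_ : [set _ | _] = `[-1, 1]%classic); first exact: measurable_itv.
  by apply/seteqP; split => k /=; rewrite in_itv/= ler_norml.
move=> k; rewrite mulr1 indicE; case: (boolP (k \in _)) => /= kD.
  rewrite mulr1 (le_trans (sinB_le _))// exprMn mulrDl lerDl mul1r sqr_ge0//.
rewrite mulr0 subr0 (le_trans (sin_max _))//.
have : 1 < k ^+ 2.
  rewrite -(real_normK (num_real k)) exprn_egt1// ltNge; apply/negP => k1.
  by move/negP : kD; apply; rewrite inE.
by move=> k1; have := sqr_ge0 x; nra.
Qed.

Lemma levy_symbolE x : levy_symbol b sigma nu x = Complex (lpsi x) (b * x).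
Proof.
have e1 : (fun k : R => complex.Re (cexp (- ('i%C * (x * k)%:C%C)) - 1
                    + 'i%C * (x * k * \1_(@small_jumps R) k)%:C%C)) =
    (fun k => - (1 - cos (x * k))).
  apply/funext => k /=; rewrite !(mul0r, mul1r, mulr0, add0r, addr0, subr0, oppr0, sub0r).
  by rewrite expR0 cosN mul1r opprB.
have e2 : (fun k : R => complex.Im (cexp (- ('i%C * (x * k)%:C%C)) - 1
                    + 'i%C * (x * k * \1_(@small_jumps R) k)%:C%C)) =
    (fun k => - (sin (x * k) - x * k * \1_(@small_jumps R) k)).
  apply/funext => k /=; rewrite !(mul0r, mul1r, mulr0, add0r, addr0, subr0, oppr0, sub0r).
  by rewrite expR0 sinN mul1r opprB addrC.
rewrite /levy_symbol /cintegral e1 e2.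
rewrite !Rintegral_punctured ?mulr0 ?cos0 ?sin0 ?mul0r ?subrr ?oppr0//.
have -> : \int[nu]_k (- (sin (x * k) - x * k * \1_(@small_jumps R) k)) = 0.
  have h := integrable_compensated_sin x.
  under eq_Rintegral do rewrite -mulN1r.
  rewrite RintegralZl// (Rintegral_odd nu_sym)// ?mulr0// => k.
  rewrite !mulrN sinN !indicE (_ : (- k \in _) = (k \in @small_jumps R)); last first.
    by apply/idP/idP; rewrite !inE /small_jumps/= normrN.
  by rewrite opprB mulNr opprK addrC.
have -> : \int[nu]_k (- (1 - cos (x * k))) = - \int[nu]_k (1 - cos (x * k)).
  under eq_Rintegral do rewrite -mulN1r.
  by rewrite RintegralZl ?mulN1r//; exact: integrable_1Bcos.
rewrite /lpsi; apply/eqP; rewrite eq_complex /=; apply/andP; split; apply/eqP; ring.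
Qed.

Notation EP f := (\int[P]_w f w).

Lemma E_cos_sin t x : 0 <= t ->
  EP (fun w => cos (x * xi t w)) = expR (- (t * lpsi x)) * cos (t * (b * x)) /\
  EP (fun w => sin (x * xi t w)) = expR (- (t * lpsi x)) * sin (t * (b * x)).
Proof.
move=> t0; have := xi_chf x t0; rewrite levy_symbolE /cintegral.
have e1 : (fun w => complex.Re (cexp (- ('i%C * (x * xi t w)%:C%C)))) = (fun w => cos (x * xi t w)).
  apply/funext => k /=; rewrite !(mul0r, mul1r, mulr0, add0r, addr0, subr0, oppr0, sub0r).
  by rewrite expR0 cosN mul1r.
have e2 : (fun w => complex.Im (cexp (- ('i%C * (x * xi t w)%:C%C)))) = (fun w => - sin (x * xi t w)).
  apply/funext => k /=; rewrite !(mul0r, mul1r, mulr0, add0r, addr0, subr0, oppr0, sub0r).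
  by rewrite expR0 sinN mul1r.
rewrite e1 e2 /cexp /= !(mul0r, subr0, addr0) => -[-> hs].
rewrite cosN; split=> //.
move: hs; under eq_Rintegral do rewrite -mulN1r.
rewrite RintegralZl//; last first.
  apply: (@le_integrable _ _ _ _ _ _ _ (cst 1%E)) => //.
  - apply/measurable_EFinP; apply: (measurableT_comp (f := fun y => sin (x * y))) => //.
    by apply: continuous_measurable; exact: continuous_sinM.
  - by move=> w _ /=; rewrite lee_fin normr1 sin_max.
  - exact: finite_measure_integrable_cst.
by rewrite mulN1r sinN mulrN => /oppr_inj.
Qed.

End characteristic_function.

(** * Gronwall's inequality and differences of powers *)

Section elementary.
Context (R : realType).
Implicit Types (x s t A B C : R).

Lemma is_derive_cosM x (q : R) : is_derive q 1 (fun q => cos (x * q)) (- x * sin (x * q)).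
Proof.
have h1 : is_derive q 1 (fun q => x * q) x.
  by apply: is_derive_eq; rewrite /GRing.scale/=; ring.
have := @is_derive1_comp _ (@cos R) (fun q => x * q) q _ _ (is_derive_cos _) h1.
by move=> h; apply: is_derive_eq; ring.
Qed.

Lemma is_derive_sinM x (q : R) : is_derive q 1 (fun q => sin (x * q)) (x * cos (x * q)).
Proof.
have h1 : is_derive q 1 (fun q => x * q) x.
  by apply: is_derive_eq; rewrite /GRing.scale/=; ring.
have := @is_derive1_comp _ (@sin R) (fun q => x * q) q _ _ (is_derive_sin _) h1.
by move=> h; apply: is_derive_eq; ring.
Qed.

Lemma is_derive_expRM x (q : R) : is_derive q 1 (fun q => expR (x * q)) (x * expR (x * q)).
Proof.
have h1 : is_derive q 1 (fun q => x * q) x.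
  by apply: is_derive_eq; rewrite /GRing.scale/=; ring.
have := @is_derive1_comp _ (@expR R) (fun q => x * q) q _ _ (is_derive_expR _) h1.
by move=> h; apply: is_derive_eq; ring.
Qed.

Lemma gronwall (y y' : R -> R) C : (forall t : R, is_derive t 1 y (y' t)) ->
  (forall t, 0 <= t -> y' t <= C * (1 + y t)) -> y 0 <= 0 ->
  forall t, 0 <= t -> y t <= expR (C * t) - 1.
Proof.
move=> dy y'C y0 t t0.
pose z (t : R) := (1 + y t) * expR (- C * t).
have dz (s : R) : is_derive s 1 z ((y' s - C * (1 + y s)) * expR (- C * s)).
  have h := is_derive_expRM (- C) s.
  by apply: is_derive_eq; rewrite /GRing.scale/=; ring.
have cz : continuous z by move=> s; exact: is_derive_continuous.
have [c] := MVT_segment t0 (fun s _ => dz s) (continuous_subspaceT cz).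
rewrite in_itv/= => /andP[c0 _] zE.
have : z t <= z 0.
  rewrite -subr_le0 zE subr0 mulr_le0_ge0// mulr_le0_ge0 ?expR_ge0//.
  by rewrite subr_le0 y'C.
rewrite /z mulr0 expR0 mulr1 => h.
have : (1 + y t) / expR (C * t) <= 1 by rewrite -expRN -mulNr (le_trans h)//; lra.
by rewrite ler_pdivrMr ?expR_gt0// mul1r => h'; lra.
Qed.

Lemma normX_le1D s j N : (j <= N)%N -> `|s| ^+ j <= 1 + `|s| ^+ N.
Proof.
move=> jN; have [s1|s1] := leP `|s| 1.
  by rewrite (@le_trans _ _ 1)// ?exprn_ile1// lerDl exprn_ge0.
by rewrite (@le_trans _ _ (`|s| ^+ N))// ?ler_weXn2l ?lerDr// ltW.
Qed.

Lemma wtX_le_sqr x m : wt x ^+ m <= 2 ^+ m * (1 + `|x| ^+ (2 * m)).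
Proof.
have [s1|s1] := leP `|x| 1.
  rewrite (@le_trans _ _ (2 ^+ m))//; last first.
    by rewrite -[X in X <= _]mulr1 ler_wpM2l ?exprn_ge0// lerDl exprn_ge0.
  rewrite lerXn2r ?nnegrE ?wt_ge0// /wt.
  have : x ^+ 2 <= 1 by rewrite -(real_normK (num_real x)) expr_le1.
  lra.
rewrite (@le_trans _ _ (2 ^+ m * `|x| ^+ (2 * m)))//; last first.
  by rewrite ler_wpM2l ?exprn_ge0// lerDr.
have h2 : 0 <= 2 * x ^+ 2 by rewrite mulr_ge0// sqr_ge0.
rewrite exprM real_normK ?num_real// -exprMn lerXn2r ?nnegrE ?wt_ge0//.
rewrite /wt; have : 1 < x ^+ 2 by rewrite -(real_normK (num_real x)) exprn_egt1.
lra.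
Qed.

Lemma pow_diff A B n :
  `|(A + B) ^+ n.+1 - (A - B) ^+ n.+1| <= 2 * n.+1%:R * `|B| * (`|A| + `|B|) ^+ n.
Proof.
elim: n => [|n ih].
  rewrite !expr1 expr0 !mulr1 (_ : A + B - (A - B) = 2 * B); last by ring.
  by rewrite normrM ger0_norm.
have -> : (A + B) ^+ n.+2 - (A - B) ^+ n.+2 =
  A * ((A + B) ^+ n.+1 - (A - B) ^+ n.+1) + B * ((A + B) ^+ n.+1 + (A - B) ^+ n.+1).
  by rewrite !(exprS _ n.+1); ring.
rewrite (le_trans (ler_normD _ _))// !normrM.
set W := `|A| + `|B|.
have W0 : 0 <= W by rewrite addr_ge0.
have h : `|(A + B) ^+ n.+1 + (A - B) ^+ n.+1| <= 2 * W ^+ n.+1.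
  rewrite (le_trans (ler_normD _ _))// mulr_natl mulr2n !normrX.
  by rewrite lerD// lerXn2r ?nnegrE ?ler_normD ?ler_normB.
apply: (@le_trans _ _ (W * (2 * n.+1%:R * `|B| * W ^+ n) + `|B| * (2 * W ^+ n.+1))).
  by rewrite lerD ?ler_wpM2l// ler_pM// lerDl.
by rewrite -(natr1 n.+1) (exprS W); lra.
Qed.

(** The factor [B ^+ 2] is what counts: with [B] at most of order [k] it makes the second difference
    integrable for [nu] near 0. The induction combines the second difference, multiplied by [A],
    with the first one, multiplied by [B]. *)
Lemma pow_diff2 A B n :
  `|(A + B) ^+ n.+2 + (A - B) ^+ n.+2 - 2 * A ^+ n.+2|
   <= n.+2%:R ^+ 2 * B ^+ 2 * (`|A| + `|B|) ^+ n.
Proof.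
elim: n => [|n ih].
  rewrite expr0 !mulr1 (_ : (A + B) ^+ 2 + _ - _ = 2 * B ^+ 2); last by ring.
  by have h := sqr_ge0 B; rewrite ger0_norm; lra.
have -> : (A + B) ^+ n.+3 + (A - B) ^+ n.+3 - 2 * A ^+ n.+3 =
  A * ((A + B) ^+ n.+2 + (A - B) ^+ n.+2 - 2 * A ^+ n.+2)
  + B * ((A + B) ^+ n.+2 - (A - B) ^+ n.+2).
  by rewrite !(exprS _ n.+2); ring.
rewrite (le_trans (ler_normD _ _))// !normrM.
have hq := pow_diff A B n.+1.
move: ih hq; set W := `|A| + `|B| => ih hq.
have W0 : 0 <= W by rewrite addr_ge0.
apply: (@le_trans _ _ (W * (n.+2%:R ^+ 2 * B ^+ 2 * W ^+ n) +
    `|B| * (2 * n.+2%:R * `|B| * W ^+ n.+1))).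
  by rewrite lerD ?ler_wpM2l// ler_pM// lerDl.
rewrite -(natr1 n.+2) (exprS W n) -(real_normK (num_real B)).
have : 0 <= `|B| ^+ 2 * (W * W ^+ n) by rewrite !mulr_ge0 ?exprn_ge0.
set z := n.+2%:R; set u := `|B|; set v := W ^+ n => h.
rewrite (_ : _ * _ + _ = (z ^+ 2 + 2 * z) * (u ^+ 2 * (W * v))); last by ring.
rewrite (_ : (z + 1) ^+ 2 * _ * _ = (z + 1) ^+ 2 * (u ^+ 2 * (W * v))); last by ring.
rewrite ler_wpM2r//; lra.
Qed.

End elementary.

(** * The generator on trigonometric polynomials *)

Section trig_generator.
Context (R : realType) (b sigma : R) (nu : {measure set (measurableTypeR R) -> \bar R}).
Context (d : measure_display) (Omega : measurableType d) (P : probability Omega R)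
        (xi : R -> {RV P >-> R}).
Implicit Types (T S A : R -> R) (x q t : R).

Hypothesis nu_levy : levy_measure nu.
Hypothesis nu_sym : symmetric_measure nu.
Hypothesis nu_mom : moments_of_all_orders nu.
Hypothesis xi_chf : forall t x, 0 <= t ->
  cintegral P setT (fun w => cexp (- ('i%C * (x * xi t w)%:C%C)))
  = cexp (- (t%:C%C * levy_symbol b sigma nu x)).

Notation EP f := (\int[P]_w f w).

(* [trigL T T1 T2 A]: [T1] and [T2] are the first two derivatives of the trigonometric
   polynomial [T], and [A] is its image under the generator of the process. *)
Inductive trigL : (R -> R) -> (R -> R) -> (R -> R) -> (R -> R) -> Prop :=
| trigL_cos x : trigL (fun q => cos (x * q)) (fun q => - x * sin (x * q))
    (fun q => - x ^+ 2 * cos (x * q))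
    (fun q => - lpsi sigma nu x * cos (x * q) + - (b * x) * sin (x * q))
| trigL_sin x : trigL (fun q => sin (x * q)) (fun q => x * cos (x * q))
    (fun q => - x ^+ 2 * sin (x * q))
    (fun q => - lpsi sigma nu x * sin (x * q) + b * x * cos (x * q))
| trigL_add T T1 T2 A S S1 S2 B : trigL T T1 T2 A -> trigL S S1 S2 B ->
    trigL (fun q => T q + S q) (fun q => T1 q + S1 q) (fun q => T2 q + S2 q)
      (fun q => A q + B q)
| trigL_scale a T T1 T2 A : trigL T T1 T2 A ->
    trigL (fun q => a * T q) (fun q => a * T1 q) (fun q => a * T2 q)
      (fun q => a * A q).

Lemma trig_trigL T : trig T -> exists T1 T2 A, trigL T T1 T2 A.
Proof.
elim=> {T} [x|x|S T _ [S1 [S2 [B hS]]] _ [T1 [T2 [A hT]]]|a T _ [T1 [T2 [A hT]]]].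
- by do 3 eexists; exact: trigL_cos.
- by do 3 eexists; exact: trigL_sin.
- by do 3 eexists; exact: (trigL_add hS hT).
- by do 3 eexists; exact: (trigL_scale a hT).
Qed.

Lemma trigL_trig T T1 T2 A : trigL T T1 T2 A -> [/\ trig T, trig T1, trig T2 & trig A].
Proof.
elim=> {T T1 T2 A} [x|x|T T1 T2 A S S1 S2 B _ [h1 h2 h3 h4] _ [k1 k2 k3 k4]|
  a T T1 T2 A _ [h1 h2 h3 h4]].
- split; first exact: trig_cos.
  + exact: trig_scale (trig_sin x).
  + exact: trig_scale (trig_cos x).
  + exact: trig_add (trig_scale _ (trig_cos x)) (trig_scale _ (trig_sin x)).
- split; first exact: trig_sin.
  + exact: trig_scale (trig_cos x).
  + exact: trig_scale (trig_sin x).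
  + exact: trig_add (trig_scale _ (trig_sin x)) (trig_scale _ (trig_cos x)).
- by split; exact: trig_add.
- by split; exact: trig_scale.
Qed.

Lemma trigL_derive T T1 T2 A : trigL T T1 T2 A ->
  (forall q : R, is_derive q 1 T (T1 q)) /\ (forall q : R, is_derive q 1 T1 (T2 q)).
Proof.
elim=> {T T1 T2 A} [x|x|T T1 T2 A S S1 S2 B _ [h1 h2] _ [k1 k2]|a T T1 T2 A _ [h1 h2]].
- split=> q; first exact: is_derive_cosM.
  by have h := is_derive_sinM x q; apply: is_derive_eq; rewrite /GRing.scale/=; ring.
- split=> q; first exact: is_derive_sinM.
  by have h := is_derive_cosM x q; apply: is_derive_eq; rewrite /GRing.scale/=; ring.
- by split=> q; apply: is_derive_eq.
- by split=> q; apply: is_derive_eq; rewrite /GRing.scale/=; ring.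
Qed.

Definition diff2 T q k : R := T (q + k) + T (q - k) - 2 * T q.

(** Pairing the jump [k] with [- k] cancels the compensator and leaves a second difference, of order
    [k ^+ 2]; the factor 1/2 corrects the double counting. *)
Lemma trigL_generator T T1 T2 A : trigL T T1 T2 A -> forall q,
  nu.-integrable setT (EFin \o diff2 T q) /\
  A q = b * T1 q + sigma ^+ 2 / 2 * T2 q + \int[nu]_k (diff2 T q k) / 2.
Proof.
elim=> {T T1 T2 A} [x|x|T T1 T2 A S S1 S2 B _ h _ k|a T T1 T2 A _ h] q.
- have e : diff2 (fun q => cos (x * q)) q = (fun k => - 2 * cos (x * q) * (1 - cos (x * k))).
    by apply/funext => k; rewrite /diff2 mulrBr mulrDr cosB cosD; ring.
  have i := integrable_1Bcos nu_levy nu_mom x.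
  split; first by rewrite e; exact: integrable_scale.
  rewrite (_ : \int[nu]_k _ = - 2 * cos (x * q) * \int[nu]_k (1 - cos (x * k))).
    by rewrite /lpsi; field.
  by rewrite -RintegralZl//; apply: eq_Rintegral => k _; rewrite e.
- have e : diff2 (fun q => sin (x * q)) q = (fun k => - 2 * sin (x * q) * (1 - cos (x * k))).
    by apply/funext => k; rewrite /diff2 mulrBr mulrDr sinB sinD; ring.
  have i := integrable_1Bcos nu_levy nu_mom x.
  split; first by rewrite e; exact: integrable_scale.
  rewrite (_ : \int[nu]_k _ = - 2 * sin (x * q) * \int[nu]_k (1 - cos (x * k))).
    by rewrite /lpsi; field.
  by rewrite -RintegralZl//; apply: eq_Rintegral => k _; rewrite e.
- have [h1 h2] := h q; have [k1 k2] := k q.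
  have e : diff2 (fun q => T q + S q) q = (fun k => diff2 T q k + diff2 S q k).
    by apply/funext => z; rewrite /diff2; ring.
  split; first by rewrite e; exact: integrable_add.
  rewrite h2 k2 (_ : \int[nu]_k0 diff2 (fun q0 => T q0 + S q0) q k0 = \int[nu]_k diff2 T q k + \int[nu]_k diff2 S q k).
    by ring.
  by rewrite -RintegralD//; apply: eq_Rintegral => z _; rewrite e.
- have [h1 h2] := h q.
  have e : diff2 (fun q => a * T q) q = (fun k => a * diff2 T q k).
    by apply/funext => z; rewrite /diff2; ring.
  split; first by rewrite e; exact: integrable_scale.
  rewrite h2 (_ : \int[nu]_k diff2 (fun q0 => a * T q0) q k = a * \int[nu]_k diff2 T q k).
    by ring.
  by rewrite -RintegralZl//; apply: eq_Rintegral => z _; rewrite e.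
Qed.

Lemma trig_bounded T : trig T -> exists M : R, forall q, `|T q| <= M.
Proof.
elim=> {T} [x|x|S T _ [M hM] _ [N hN]|a T _ [M hM]].
- by exists 1 => q; exact: cos_max.
- by exists 1 => q; exact: sin_max.
- by exists (M + N) => q; rewrite (le_trans (ler_normD _ _))// lerD.
- by exists (`|a| * M) => q; rewrite normrM ler_wpM2l.
Qed.

Lemma bounded_L1le (f : Omega -> R) M : measurable_fun setT f -> (forall w, `|f w| <= M) ->
  L1le P setT f M.
Proof.
move=> mf fM; split => //; apply: (@le_trans _ _ (\int[P]_w M%:E)%E).
  apply: ge0_le_integral => //; first by do 2 apply: measurableT_comp => //.
  by move=> w _; rewrite lee_fin.
by rewrite integral_cst//= [X in (_ * X)%E]probability_setT mule1.
Qed.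

Lemma trig_integrable T t : trig T -> P.-integrable setT (EFin \o (fun w => T (xi t w))).
Proof.
move=> tT; have [M hM] := trig_bounded tT.
apply: (L1le_integrable (c := M)); apply: bounded_L1le => //.
by apply: (measurableT_comp (f := T)) => //; apply: continuous_measurable; exact: trig_continuous.
Qed.

(** Dynkin's formula in differentiated form. The explicit expressions are smooth on the whole line,
    so [y] has an ordinary derivative even at [t = 0], although it represents an expectation for
    [t >= 0] only. *)
Lemma trigL_expectation T T1 T2 A : trigL T T1 T2 A -> exists y y' : R -> R,
  (forall t : R, is_derive t 1 y (y' t)) /\ forall t, 0 <= t ->
    y t = EP (fun w => T (xi t w)) /\ y' t = EP (fun w => A (xi t w)).
Proof.
have aux T' a t : trig T' -> EP (fun w => a * T' (xi t w)) = a * EP (fun w => T' (xi t w)).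
  by move=> tT; rewrite RintegralZl//; exact: trig_integrable.
have auxD T' S t : trig T' -> trig S ->
    EP (fun w => T' (xi t w) + S (xi t w)) = EP (fun w => T' (xi t w)) + EP (fun w => S (xi t w)).
  by move=> tT tS; rewrite RintegralD//; exact: trig_integrable.
elim=> {T T1 T2 A} [x|x|T T1 T2 A S S1 S2 B hT [y [y' [dy Ey]]] hS [z [z' [dz Ez]]]|
   a T T1 T2 A hT [y [y' [dy Ey]]]].
- pose y t := expR (- lpsi sigma nu x * t) * cos (b * x * t).
  exists y, (fun t => - lpsi sigma nu x * (expR (- lpsi sigma nu x * t) * cos (b * x * t)) +
     - (b * x) * (expR (- lpsi sigma nu x * t) * sin (b * x * t))); split => [t|t t0].
    have h1 := is_derive_cosM (b * x) t; have h2 := is_derive_expRM (- lpsi sigma nu x) t.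
    by apply: is_derive_eq; rewrite /GRing.scale/=; ring.
  have [E1 E2] := E_cos_sin nu_levy nu_sym nu_mom xi_chf x t0.
  rewrite (auxD (fun q => - lpsi sigma nu x * cos (x * q)) (fun q => - (b * x) * sin (x * q))); last 2 first.
    exact: trig_scale (trig_cos x). exact: trig_scale (trig_sin x).
  rewrite (aux (fun q => cos (x * q))) ?(aux (fun q => sin (x * q)));
    [|exact: trig_sin|exact: trig_cos].
  by rewrite E1 E2 /y mulNr (mulrC _ t) (mulrC (b * x) t).
- pose y t := expR (- lpsi sigma nu x * t) * sin (b * x * t).
  exists y, (fun t => - lpsi sigma nu x * (expR (- lpsi sigma nu x * t) * sin (b * x * t)) +
     b * x * (expR (- lpsi sigma nu x * t) * cos (b * x * t))); split => [t|t t0].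
    have h1 := is_derive_sinM (b * x) t; have h2 := is_derive_expRM (- lpsi sigma nu x) t.
    by apply: is_derive_eq; rewrite /GRing.scale/=; ring.
  have [E1 E2] := E_cos_sin nu_levy nu_sym nu_mom xi_chf x t0.
  rewrite (auxD (fun q => - lpsi sigma nu x * sin (x * q)) (fun q => b * x * cos (x * q))); last 2 first.
    exact: trig_scale (trig_sin x). exact: trig_scale (trig_cos x).
  rewrite (aux (fun q => cos (x * q))) ?(aux (fun q => sin (x * q)));
    [|exact: trig_sin|exact: trig_cos].
  by rewrite E1 E2 /y mulNr (mulrC _ t) (mulrC (b * x) t).
- have [t1 _ _ t4] := trigL_trig hT; have [s1 _ _ s4] := trigL_trig hS.
  exists (fun t => y t + z t), (fun t => y' t + z' t); split=> [t|t t0].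
    exact: is_derive_eq.
  have [-> ->] := Ey t t0; have [-> ->] := Ez t t0.
  by rewrite !auxD.
- have [t1 _ _ t4] := trigL_trig hT.
  exists (fun t => a * y t), (fun t => a * y' t); split=> [t|t t0].
    by apply: is_derive_eq; rewrite /GRing.scale/=; ring.
  have [-> ->] := Ey t t0.
  by rewrite !aux.
Qed.

End trig_generator.

(** * Moments of the process *)

Section moments.
Context (R : realType) (b sigma : R) (nu : {measure set (measurableTypeR R) -> \bar R}).
Context (d : measure_display) (Omega : measurableType d) (P : probability Omega R)
        (xi : R -> {RV P >-> R}).
Implicit Types (T S A : R -> R) (x q t h : R).

Hypothesis nu_levy : levy_measure nu.
Hypothesis nu_sym : symmetric_measure nu.
Hypothesis nu_mom : moments_of_all_orders nu.
Hypothesis xi_chf : forall t x, 0 <= t ->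
  cintegral P setT (fun w => cexp (- ('i%C * (x * xi t w)%:C%C)))
  = cexp (- (t%:C%C * levy_symbol b sigma nu x)).

Hypothesis xi0 : forall w, xi 0 w = 0.

Notation EP f := (\int[P]_w f w).

Lemma is_derive_inj (f : R -> R) (x a a' : R) :
  is_derive x 1 f a -> is_derive x 1 f a' -> a = a'.
Proof. by move=> [_ <-] [_ <-]. Qed.

Lemma is_derive_exprn (f : R -> R) (x df : R) n : is_derive x 1 f df ->
  is_derive x 1 (fun y => f y ^+ n.+1) (n.+1%:R * f x ^+ n * df).
Proof.
move=> h; rewrite (_ : (fun y => f y ^+ n.+1) = f ^+ n.+1); last first.
  by apply/funext => y; rewrite exprfctE.
by have h1 := is_deriveX n h; apply: is_derive_eq; rewrite /GRing.scale/= mulr_natl.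
Qed.

(* A trigonometric polynomial approximating [q ^+ 2] from below as [h] tends to [0]. *)
Definition trig_sqr h q := (2 - 2 * cos (h * q)) / h ^+ 2.

Lemma trig_trig_sqr h : trig (trig_sqr h).
Proof.
apply: trig_ext (trig_scale (2 / h ^+ 2) (trig_add (trig_cst 1) (trig_scale (-1) (trig_cos h)))) => q.
by rewrite /trig_sqr; ring.
Qed.

Lemma trig_sqrE h q : trig_sqr h q = (2 / h * sin (h / 2 * q)) ^+ 2.
Proof.
rewrite /trig_sqr; have -> : h * q = h / 2 * q + h / 2 * q by field.
have := cos2Dsin2 (h / 2 * q); rewrite cosD; set c := cos _; set s := sin _ => cs.
have -> : 2 - 2 * (c * c - s * s) = 4 * s ^+ 2.
  rewrite (_ : c * c = 1 - s ^+ 2); first by ring.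
  by rewrite -cs; ring.
by rewrite !exprMn exprVn; ring.
Qed.

Lemma trig_sqr_ge0 h q : 0 <= trig_sqr h q.
Proof. by rewrite trig_sqrE sqr_ge0. Qed.

Lemma trig_sqr_approx h q : 0 < h -> `|q ^+ 2 - trig_sqr h q| <= 2 * h * `|q| ^+ 3.
Proof.
move=> h0; rewrite /trig_sqr.
have -> : q ^+ 2 - (2 - 2 * cos (h * q)) / h ^+ 2 =
    - (2 / h ^+ 2) * (1 - cos (h * q) - (h * q) ^+ 2 / 2).
  by field; rewrite gt_eqF.
rewrite normrM normrN (@ger0_norm _ (2 / _)); last by rewrite divr_ge0// sqr_ge0.
have hh : 0 <= 2 / h ^+ 2 by rewrite divr_ge0// sqr_ge0.
apply: le_trans (ler_wpM2l hh (cosB3_le _)) _.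
rewrite normrM (gtr0_norm h0) exprMn le_eqVlt; apply/orP; left; apply/eqP.
by field; rewrite gt_eqF.
Qed.

(** With [s q = 2 / h * sin (h / 2 * q)] one has [trig_sqr h q = s q ^+ 2], and [s] imitates the
    identity uniformly in [h]: its derivative is a cosine, and it vanishes at 0 with [|s k| <= |k|].
    The generator therefore acts on even powers of [s] much as on even powers of [q]. An upper bound
    is enough for Gronwall. *)
Lemma trig_sqr_generator_le m : exists2 C : R, 0 <= C & forall h T1 T2 A, 0 < h ->
  trigL b sigma nu (fun q => trig_sqr h q ^+ m.+1) T1 T2 A ->
  forall q, A q <= C * (1 + trig_sqr h q ^+ m.+1).
Proof.
have [K hK] := levy_moment nu_levy nu_mom m; have K0 := L1le_ge0 hK.
pose n := (2 * m)%N; pose N : R := n.+2%:R.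
exists (`|b| * N + sigma ^+ 2 / 2 * (N * n.+1%:R) + N ^+ 2 * (2 * 4 ^+ m) * K / 2) => [|h T1 T2 A h0 hT q].
  by nonneg.
pose s q := 2 / h * sin (h / 2 * q); pose c q := cos (h / 2 * q).
have TE : (fun q => trig_sqr h q ^+ m.+1) = (fun q => s q ^+ n.+2).
  by apply/funext => y; rewrite trig_sqrE -exprM mulnS.
rewrite TE in hT; rewrite (congr1 (fun f => f q) TE).
have [dT dT1] := trigL_derive hT.
have [iD AE] := trigL_generator nu_levy nu_mom hT q.
have ds (y : R) : is_derive y 1 s (c y).
  have h1 := is_derive_sinM (h / 2) y.
  by apply: is_derive_eq; rewrite /GRing.scale/= /c; field; rewrite gt_eqF.
have dc (y : R) : is_derive y 1 c (- (h ^+ 2 / 4) * s y).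
  have h1 := is_derive_cosM (h / 2) y.
  by apply: is_derive_eq; rewrite /s; field; rewrite gt_eqF.
have T1E y : T1 y = N * s y ^+ n.+1 * c y.
  exact: is_derive_inj (dT y) (is_derive_exprn n.+1 (ds y)).
have T2E y : T2 y = N * (n.+1%:R * s y ^+ n * c y ^+ 2 - h ^+ 2 / 4 * s y ^+ n.+2).
  have h1 := dT1 y; rewrite (_ : T1 = (fun y => N * s y ^+ n.+1 * c y)) in h1; last exact/funext.
  apply: (is_derive_inj h1); move: {h1} (is_derive_exprn n (ds y)) => h1.
  by apply: is_derive_eq; rewrite /GRing.scale/= !(exprS _ n.+1) (exprS _ n); ring.
have s_ge0 y : 0 <= s y ^+ n.+2.
  have /= <- := congr1 (fun f => f y) TE; exact: exprn_ge0 (trig_sqr_ge0 _ _).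
have snE y : s y ^+ n.+2 = `|s y| ^+ n.+2 by rewrite -normrX ger0_norm.
have c1 y : `|c y| <= 1 by exact: cos_max.
set S := s q ^+ n.+2.
have S0 : 0 <= S by exact: s_ge0.
have b1 : b * T1 q <= `|b| * N * (1 + S).
  rewrite (le_trans (ler_norm _))// normrM -mulrA ler_wpM2l// T1E !normrM.
  rewrite (ger0_norm (ler0n _ _)) -mulrA ler_wpM2l// normrX.
  rewrite (@le_trans _ _ (`|s q| ^+ n.+1))//.
    by rewrite -[X in _ <= X]mulr1 ler_wpM2l ?exprn_ge0.
  by rewrite /S snE normX_le1D.
have b2 : sigma ^+ 2 / 2 * T2 q <= sigma ^+ 2 / 2 * (N * n.+1%:R) * (1 + S).
  have -> : sigma ^+ 2 / 2 * (N * n.+1%:R) * (1 + S) = sigma ^+ 2 / 2 * (N * (n.+1%:R * (1 + S))) by ring.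
  rewrite ler_wpM2l//; first by nonneg.
  rewrite T2E ler_wpM2l//.
  rewrite lerBlDr (@le_trans _ _ (n.+1%:R * (1 + S)))//; last first.
    by rewrite lerDl; nonneg.
  rewrite -(mulrA n.+1%:R) ler_wpM2l// (@le_trans _ _ (`|s q| ^+ n))//.
    rewrite -normrX (le_trans (ler_norm _))// normrM -[X in _ <= X]mulr1 ler_wpM2l//.
    by rewrite normrX expr_le1.
  by rewrite /S snE normX_le1D// (leq_trans (leqnSn _)).
have hb (k : R) : diff2 (fun q => s q ^+ n.+2) q k
    <= N ^+ 2 * (2 * 4 ^+ m) * (1 + S) * (k ^+ 2 * wt k ^+ m).
  rewrite /diff2.
  (* The addition formula gives [s (q + k) = X + Y] and [s (q - k) = X - Y] with [|X| <= |s q|] and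
     [|Y| <= |k|], which is the situation of [pow_diff2]. *)
  pose X := s q * c k; pose Y := c q * s k.
  have -> : s (q + k) = X + Y.
    by rewrite /X /Y /s /c (mulrDr (h / 2) q k) sinD; ring.
  have -> : s (q - k) = X - Y.
    by rewrite /X /Y /s /c (mulrBr (h / 2) q k) sinB; ring.
  have Xs : `|X| <= `|s q| by rewrite normrM -[X in _ <= X]mulr1 ler_wpM2l.
  have Yk : `|Y| <= `|k|.
    rewrite normrM (@le_trans _ _ (1 * `|s k|)) ?ler_wpM2r// mul1r /s normrM.
    rewrite (@le_trans _ _ (`|2 / h| * `|h / 2 * k|))//; first by rewrite ler_wpM2l// sin_le_abs.
    rewrite -normrM (_ : 2 / h * _ = k)//.
    by field; rewrite gt_eqF.
  have hp := pow_diff2 X Y n.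
  have XS : X ^+ n.+2 <= S by rewrite /S snE (le_trans (ler_norm _))// normrX lerXn2r ?nnegrE.
  apply: (@le_trans _ _ (N ^+ 2 * Y ^+ 2 * (`|X| + `|Y|) ^+ n)).
    have := le_trans (ler_norm _) hp; move: XS; rewrite -/N -/S.
    set u := (X + Y) ^+ _; set v := (X - Y) ^+ _; set r := X ^+ _; set z := N ^+ 2 * _ * _.
    by move=> ? ?; lra.
  have YK2 : Y ^+ 2 <= k ^+ 2.
    by rewrite -(real_normK (num_real Y)) -(real_normK (num_real k)) lerXn2r ?nnegrE.
  have hw : (`|X| + `|Y|) ^+ n <= 2 * 4 ^+ m * (1 + S) * wt k ^+ m.
    apply: (@le_trans _ _ ((`|s q| + `|k|) ^+ n)).
      by rewrite lerXn2r ?nnegrE ?addr_ge0// lerD.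
    rewrite /n exprM.
    apply: (@le_trans _ _ ((2 * (wt (s q) * wt k)) ^+ m)).
      have w0 : 0 <= 2 * (wt (s q) * wt k) by rewrite !mulr_ge0 ?wt_ge0.
      rewrite lerXn2r ?nnegrE ?sqr_ge0//.
      have := wtD `|s q| `|k|; rewrite /wt !real_normK ?num_real//; lra.
    rewrite !exprMn mulrA ler_wpM2r ?wtX_ge0// (_ : 4 ^+ m = 2 ^+ m * 2 ^+ m :> R); last first.
      by rewrite -exprMn -natrM.
    have -> : 2 * (2 ^+ m * 2 ^+ m) * (1 + S) = 2 ^+ m * (2 ^+ m * (2 * (1 + S))) by ring.
    rewrite ler_wpM2l ?exprn_ge0//.
    rewrite (le_trans (wtX_le_sqr _ _))// ler_wpM2l ?exprn_ge0//.
    have : `|s q| ^+ n <= 1 + `|s q| ^+ n.+2 by rewrite normX_le1D// (leq_trans (leqnSn _)).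
    rewrite -snE -/S /n; lra.
  apply: (@le_trans _ _ (N ^+ 2 * k ^+ 2 * (2 * 4 ^+ m * (1 + S) * wt k ^+ m))).
    apply: ler_pM; [by nonneg|by nonneg| |exact: hw].
    by apply: ler_wpM2l YK2; exact: sqr_ge0.
  by rewrite le_eqVlt; apply/orP; left; apply/eqP; ring.
have b3 : \int[nu]_k diff2 (fun q => s q ^+ n.+2) q k <= N ^+ 2 * (2 * 4 ^+ m) * (1 + S) * K.
  apply: (@le_trans _ _ (\int[nu]_k (N ^+ 2 * (2 * 4 ^+ m) * (1 + S) * (k ^+ 2 * wt k ^+ m)))); last first.
    rewrite RintegralZl//; last exact: L1le_integrable hK.
    rewrite ler_wpM2l//; first by rewrite !mulr_ge0 ?exprn_ge0// addr_ge0.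
    by rewrite (le_trans (ler_norm _))// (L1le_norm _ hK).
  apply: le_Rintegral => //.
    by apply: integrable_scale => //; exact: L1le_integrable hK.
rewrite AE; move: b1 b2 b3; rewrite -/S.
set x1 := b * _; set x2 := _ * T2 q; set x3 := \int[nu]_k _.
set y1 := `|b| * N; set y2 := sigma ^+ 2 / 2 * _; set y3 := N ^+ 2 * _.
by move=> ? ? ?; lra.
Qed.

(* The powers [T] of [trig_sqr h] are trigonometric polynomials whose images under the generator
   are bounded by [C * (1 + T)] with [C] independent of [h]; Gronwall, then Fatou as
   [h] tends to [0]. *)
Lemma xi_even_moment m : exists2 C : R, 0 <= C & forall t, 0 <= t ->
  L1le P setT (fun w => xi t w ^+ (2 * m.+1)) (expR (C * t) - 1).
Proof.
have [C C0 hC] := trig_sqr_generator_le m; exists C => // t t0.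
pose h (n : nat) : R := n.+1%:R^-1.
apply: (@L1le_lim _ _ _ _ _ measurableT (fun n w => trig_sqr (h n) (xi t w) ^+ m.+1)) => [n|w _].
  have tT : trig (fun q => trig_sqr (h n) q ^+ m.+1) by apply: trig_exp; exact: trig_trig_sqr.
  have [T1 [T2 [A hT]]] := trig_trigL b sigma nu tT.
  have [y [y' [dy Ey]]] := trigL_expectation nu_levy nu_sym nu_mom xi_chf hT.
  have [_ _ _ tA] := trigL_trig hT.
  have iT s := trig_integrable xi s tT.
  have iA s := trig_integrable xi s tA.
  apply: (@L1le_weak _ _ _ _ _ _ _ _ _ (integrable_L1le measurableT (iT t))).
  have -> : \int[P]_w `|trig_sqr (h n) (xi t w) ^+ m.+1| = y t.
    rewrite (Ey t t0).1; apply: eq_Rintegral => w _.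
    by rewrite ger0_norm// exprn_ge0// trig_sqr_ge0.
  apply: (gronwall dy) => //.
    move=> s s0; rewrite (Ey s s0).1 (Ey s s0).2.
    have -> : C * (1 + EP (fun w => trig_sqr (h n) (xi s w) ^+ m.+1)) =
        EP (fun w => C + C * trig_sqr (h n) (xi s w) ^+ m.+1).
      rewrite RintegralD//; last 2 first.
        exact: finite_measure_integrable_cst.
        by apply: integrable_scale => //; exact: (iT s).
      rewrite (@RintegralZl _ _ _ P setT _ C measurableT (iT s)).
      by rewrite Rintegral_cst// [X in _ * fine X]probability_setT/= mulrDr.
    apply: le_Rintegral => //.
      apply: integrable_add => //; first exact: finite_measure_integrable_cst.
      by apply: integrable_scale => //; exact: (iT s).
    by move=> w _; rewrite (le_trans (hC _ _ _ _ _ hT _)) ?invr_gt0// mulrDr mulr1.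
  rewrite (Ey 0 (lexx _)).1 (_ : (fun w => trig_sqr (h n) (xi 0 w) ^+ m.+1) = cst 0).
    by rewrite Rintegral_cst// mul0r.
  by apply/funext => w; rewrite xi0 /trig_sqr mulr0 cos0 mulr1 subrr mul0r expr0n.
rewrite exprM.
have : trig_sqr (h n) (xi t w) @[n --> \oo] --> xi t w ^+ 2.
  have [->|q0] := eqVneq (xi t w) 0.
    apply: cvg_near_cst; apply: nearW => n.
    by rewrite /trig_sqr mulr0 cos0 mulr1 subrr mul0r expr0n.
  have q30 : 0 < 2 * `|xi t w| ^+ 3 by rewrite mulr_gt0// exprn_gt0// normr_gt0.
  apply/cvgrPdist_le => e e0.
  have p0 : 0 < (e : R) / (2 * `|xi t w| ^+ 3) by rewrite divr_gt0.
  near=> n; apply: le_trans (trig_sqr_approx _ _) _; first by rewrite invr_gt0.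
  rewrite mulrAC -ler_pdivlMl// mulrC; apply: ltW; near: n.
  exact: (near_infty_natSinv_lt (PosNum p0)).
move=> h1; apply: (@cvg_comp _ _ _ _ (fun y => y ^+ m.+1) _ _ _ h1).
exact: exprn_continuous.
Unshelve. all: by end_near. Qed.

(** The bound [expR (C * t) - 1] vanishes at 0 and is at most [C * expR (C * T) * t]: the rate
    linear in [t] is what survives division by the time step later. The weight is absorbed by adding
    the moments of orders 2 and [2 * m + 2]. *)
Lemma xi_sqr_moment (T : R) m : exists2 K : R, 0 <= K & forall t, 0 <= t <= T ->
  L1le P setT (fun w => xi t w ^+ 2 * wt (xi t w) ^+ m) (K * t).
Proof.
have [C C0 hC] := xi_even_moment 0; have [D D0 hD] := xi_even_moment m.
have expB (c s : R) : 0 <= c -> 0 <= s <= T -> expR (c * s) - 1 <= c * expR (c * T) * s.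
  move=> c0 /andP[s0 sT]; have h := expR_ge1Dx (- (c * s)).
  have e0 : 0 < expR (c * s) by exact: expR_gt0.
  have : expR (c * s) * (1 - c * s) <= 1.
    by rewrite -[X in _ <= X](expRxMexpNx_1 (c * s)) ler_pM2l.
  have : c * s * expR (c * s) <= c * s * expR (c * T).
    by rewrite ler_wpM2l ?mulr_ge0// ler_expR ler_wpM2l.
  lra.
exists (2 ^+ m * (C * expR (C * T) + D * expR (D * T))); first by nonneg.
move=> t tT; have t0 : 0 <= t by case/andP: tT.
have h := L1le_scale measurableT (2 ^+ m) (L1le_add measurableT (hC t t0) (hD t t0)).
apply: (@L1le_weak _ _ _ _ _ _ _ _ _ (L1le_dom measurableT _ _ h)).
- have := expB C t C0 tT; have := expB D t D0 tT.
  rewrite ger0_norm ?exprn_ge0// -(mulrA (2 ^+ m)) => h1 h2.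
  by rewrite ler_wpM2l ?exprn_ge0//; lra.
- apply: measurable_funM; first exact: measurable_funX.
  by apply: (measurableT_comp (f := fun q => wt q ^+ m)) => //; apply: continuous_measurable; exact: wtX_continuous.
- move=> w _.
  have a0 : 0 <= xi t w ^+ 2 * wt (xi t w) ^+ m by nonneg.
  have b0 : 0 <= 2 ^+ m * (xi t w ^+ (2 * 1) + xi t w ^+ (2 * m.+1)).
    by rewrite !exprM; nonneg.
  rewrite (ger0_norm a0) (ger0_norm b0) muln1 mulnS exprD mulrC.
  rewrite (_ : xi t w ^+ 2 + _ = (1 + xi t w ^+ (2 * m)) * xi t w ^+ 2); last by ring.
  rewrite mulrA ler_wpM2r ?sqr_ge0//.
  by have := wtX_le_sqr (xi t w) m; rewrite !exprM real_normK ?num_real.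
Qed.

Lemma xi_wt_moment (T : R) m : exists2 K : R, 0 <= K & forall t, 0 <= t <= T ->
  L1le P setT (fun w => wt (xi t w) ^+ m) K.
Proof.
have [C C0 hC] := xi_sqr_moment T m.
exists (2 ^+ m + C * `|T|) => [|t tT]; first by nonneg.
have h1 : L1le P setT (fun=> 2 ^+ m) (2 ^+ m).
  by apply: bounded_L1le => // w; rewrite ger0_norm// exprn_ge0.
apply: (@L1le_weak _ _ _ _ _ _ _ _ _ (L1le_dom measurableT _ _ (L1le_add measurableT h1 (hC t tT)))).
- by rewrite lerD2l ler_wpM2l//; case/andP: tT => _ tT; rewrite (le_trans tT) ?ler_norm.
- by apply: (measurableT_comp (f := fun q => wt q ^+ m)) => //; apply: continuous_measurable; exact: wtX_continuous.
- move=> w _; rewrite !ger0_norm; [|by nonneg|by nonneg].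
  have [q1|q1] := leP `|xi t w| 1.
    rewrite (@le_trans _ _ (2 ^+ m))//; last by rewrite lerDl; nonneg.
    rewrite lerXn2r ?nnegrE ?wt_ge0// /wt.
    have : xi t w ^+ 2 <= 1 by rewrite -(real_normK (num_real _)) expr_le1.
    lra.
  rewrite (@le_trans _ _ (xi t w ^+ 2 * wt (xi t w) ^+ m))//; last by rewrite lerDr exprn_ge0.
  rewrite -[X in X <= _]mul1r ler_wpM2r ?wtX_ge0//.
  by rewrite -(real_normK (num_real _)) exprn_ege1// ltW.
Qed.

End moments.

(** * The generator as a limit of difference quotients *)

Section quotients.
Context (R : realType).
Implicit Types (f : R -> R).

Lemma is_derive_quotient f (x df : R) : is_derive x 1 f df -> forall e : R, 0 < e ->
  exists2 r : R, 0 < r & forall h : R, h != 0 -> `|h| < r ->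
    `|(f (x + h) - f x) / h - df| <= e.
Proof.
move=> fx e e0; have fE : 'D_1 f x = df by exact: derive_val.
have : derivable f x 1 by exact: ex_derive.
rewrite /derivable => c; have {}c : h^-1 *: ((f \o shift x) (h *: (1 : R)) - f x) @[h --> 0^'] --> df.
  by rewrite -fE.
have /cvgrPdist_le/(_ _ e0)[r /= r0 hr] := c.
exists r => // h h0 hltr; have := hr h; rewrite /ball/= sub0r normrN.
move=> /(_ hltr h0); rewrite distrC /GRing.scale/= mulr1 (addrC h) mulrC; exact.
Qed.

(** The epsilon form of the derivative allows positive and negative increments to be treated by
    separate arguments. *)
Lemma quotient_is_derive f (x df : R) : (forall e : R, 0 < e ->
    exists2 r : R, 0 < r & forall h : R, h != 0 -> `|h| < r ->
      `|(f (x + h) - f x) / h - df| <= e) ->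
  is_derive x 1 f df.
Proof.
move=> H.
have c : h^-1 *: ((f \o shift x) (h *: (1 : R)) - f x) @[h --> 0^'] --> df.
  apply/cvgrPdist_le => e e0; have [r r0 hr] := H e e0.
  exists r => //= h; rewrite /ball/= sub0r normrN => hltr h0.
  by rewrite distrC /GRing.scale/= mulr1 (addrC h) mulrC; exact: hr.
by apply: DeriveDef; [exact: cvgP c|exact: cvg_lim c].
Qed.

End quotients.

(** * Trigonometric approximation of functions vanishing to second order *)

Section quadratic_approximation.
Context (R : realType).
Implicit Types (F : R -> R).

(** The factor [k ^+ 2] is approximated by [trig_sqr dl] and [F] by [tau], so that the error keeps a
    factor [k ^+ 2]. The parameters are chosen in the order [N], [tau], [dl], since [dl] has to beat
    the global bound on [tau]. The extra power of [wt] in the error yields the small factor at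
    infinity. *)
Lemma quadratic_trig_approx F (C e : R) m : continuous F ->
  (forall k, `|F k| <= C * wt k ^+ m) -> 0 < e ->
  exists (dl : R) (tau : R -> R), [/\ 0 < dl, trig tau, `|F 0 - tau 0| <= e &
    forall k, `|k ^+ 2 * F k - trig_sqr dl k * tau k| <= e * (k ^+ 2 * wt k ^+ m.+1)].
Proof.
move=> cF FC e0.
have C0 : 0 <= C.
  by have := le_trans (normr_ge0 _) (FC 0); rewrite pmulr_lge0// exprn_gt0// wt_gt0.
have e20 : 0 < e / 2 by lra.
(* Beyond [N] both [F] and [tau] are bounded by multiples of [wt k ^+ m], that of [tau] containing
   [4 ^+ m] because [wt (2 * N) <= 4 * wt k]. Their sum is below [e / 2 * wt k ^+ m.+1] once
   [N ^+ 2] is at least [B]. *)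
pose B : R := C * (1 + 4 ^+ m) / (e / 2).
have B0 : 0 <= B by apply: divr_ge0; [nonneg|exact: ltW].
pose N : R := 1 + B.
have N1 : 1 <= N by rewrite /N; lra.
have N0 : 0 < N by lra.
have NB : C * (1 + 4 ^+ m) <= e / 2 * N ^+ 2.
  rewrite [X in _ <= X]mulrC -ler_pdivrMr// -/B expr2 /N.
  have h (z : R) : 0 <= z -> z <= (1 + z) * (1 + z) by move=> z0; nra.
  exact: h.
have [tau [ttau Ftau tauD]] := @trig_approx R F N (C * wt (2 * N) ^+ m) (e / 2) cF e20 N0
  (fun y yN => le_trans (FC y) (ler_wpM2l C0 (wtX_norm_le _ (le_trans yN (ler_norm _))))).
pose D := C * wt (2 * N) ^+ m.
have D0 : 0 <= D by nonneg.
(* Makes [2 * dl * D], the coefficient of the error in replacing [k ^+ 2] by [trig_sqr dl k], at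
   most [e / 2]. *)
pose dl := e / (4 * (D + 1)).
have dl0 : 0 < dl by rewrite divr_gt0// mulr_gt0//; lra.
exists dl, tau; split => //.
  by rewrite (le_trans (Ftau 0 _)) ?normr0 ?ltW//; lra.
move=> k.
have w1 := wt_ge1 k.
have part2 : `|k ^+ 2 - trig_sqr dl k| * `|tau k| <= e / 2 * (k ^+ 2 * wt k ^+ m.+1).
  apply: (@le_trans _ _ (2 * dl * `|k| ^+ 3 * D)).
    by rewrite ler_pM// trig_sqr_approx.
  have h1 : 2 * dl * D <= e / 2.
    rewrite /dl (_ : 2 * _ * D = e / 2 * (D / (D + 1))); last by field; rewrite gt_eqF//; lra.
    rewrite -[X in _ <= X]mulr1 (ler_wpM2l (ltW e20))// ler_pdivrMr; lra.
  have dD : 0 <= 2 * dl * D by rewrite mulr_ge0// mulr_ge0// ltW.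
  rewrite mulrAC ler_pM// ?exprn_ge0//.
  rewrite exprSr real_normK ?num_real// ler_wpM2l ?sqr_ge0//.
  by rewrite (le_trans (norm_le_wt _))// -[X in X <= _]expr1 wtX_le.
have part1 : `|F k - tau k| <= e / 2 * wt k ^+ m.+1.
  have [kN|kN] := leP `|k| N.
    rewrite (le_trans (Ftau k kN))// -[X in X <= _]mulr1 (ler_wpM2l (ltW e20))//.
    by rewrite wtX_ge1.
  apply: (@le_trans _ _ (C * (1 + 4 ^+ m) * wt k ^+ m)).
    rewrite (le_trans (ler_normB _ _))// mulrDr mulr1 mulrDl lerD//.
    rewrite (le_trans (tauD k))// -mulrA ler_wpM2l// -exprMn lerXn2r ?nnegrE ?mulr_ge0 ?wt_ge0//.
    rewrite /wt exprMn; have : N ^+ 2 <= k ^+ 2.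
      by rewrite -(real_normK (num_real k)) lerXn2r ?nnegrE// ltW.
    lra.
  rewrite exprS mulrA ler_wpM2r ?wtX_ge0// (le_trans NB)// (ler_wpM2l (ltW e20))//.
  rewrite /wt; have : N ^+ 2 <= k ^+ 2.
    by rewrite -(real_normK (num_real k)) lerXn2r ?nnegrE// ltW.
  lra.
have -> : k ^+ 2 * F k - trig_sqr dl k * tau k =
   k ^+ 2 * (F k - tau k) + (k ^+ 2 - trig_sqr dl k) * tau k by ring.
rewrite (le_trans (ler_normD _ _))// normrM (normrM (_ - _)) (ger0_norm (sqr_ge0 k)).
have : k ^+ 2 * `|F k - tau k| <= k ^+ 2 * (e / 2 * wt k ^+ m.+1).
  by rewrite ler_wpM2l ?sqr_ge0.
move: part2; set u := wt k ^+ _; set v := `|_ - _|; set x := _ * `|tau k|.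
by move=> ? ?; lra.
Qed.

End quadratic_approximation.

Section generator.
Context (R : realType) (b sigma : R) (nu : {measure set (measurableTypeR R) -> \bar R}).
Context (d : measure_display) (Omega : measurableType d) (P : probability Omega R)
        (xi : R -> {RV P >-> R}).
Implicit Types (T S A f : R -> R) (x q t h p k : R).

Hypothesis nu_levy : levy_measure nu.
Hypothesis nu_sym : symmetric_measure nu.
Hypothesis nu_mom : moments_of_all_orders nu.
Hypothesis xi_chf : forall t x, 0 <= t ->
  cintegral P setT (fun w => cexp (- ('i%C * (x * xi t w)%:C%C)))
  = cexp (- (t%:C%C * levy_symbol b sigma nu x)).
Hypothesis xi0 : forall w, xi 0 w = 0.

Notation EP f := (\int[P]_w f w).

Lemma measurable_xi t f : continuous f -> measurable_fun setT (fun w => f (xi t w)).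
Proof.
by move=> cf; apply: (measurableT_comp (f := f)) => //; exact: continuous_measurable.
Qed.

Lemma trig_limit T T1 T2 A e : trigL b sigma nu T T1 T2 A -> 0 < e ->
  exists2 r : R, 0 < r & forall h, 0 < h -> h < r ->
    `|(EP (fun w => T (xi h w)) - T 0) / h - A 0| <= e.
Proof.
move=> hT e0.
have [y [y' [dy Ey]]] := trigL_expectation nu_levy nu_sym nu_mom xi_chf hT.
have E0 f : EP (fun w => f (xi 0 w)) = f 0.
  under eq_Rintegral do rewrite xi0.
  by rewrite Rintegral_cst// [X in _ * fine X]probability_setT mulr1.
have [r r0 hr] := is_derive_quotient (dy 0) e0.
exists r => // h h0 hltr.
have := hr h; rewrite gt_eqF// gtr0_norm// add0r => /(_ isT hltr).
have [-> _] := Ey h (ltW h0); have [-> ->] := Ey 0 (lexx 0).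
by rewrite !E0.
Qed.

(** The product vanishes at 0 together with its first derivative, and its second derivative there is
    [2 * tau 0]. So at 0 the drift and the compensator disappear, and the symmetrised jump integral
    becomes a plain one by symmetry of [nu]. *)
Lemma quadratic_trig_generator (dl : R) tau : 0 < dl -> trig tau ->
  exists S1 S2 A, [/\ trigL b sigma nu (fun k => trig_sqr dl k * tau k) S1 S2 A,
    nu.-integrable setT (EFin \o (fun k => trig_sqr dl k * tau k)) &
    A 0 = sigma ^+ 2 * tau 0 + \int[nu]_k (trig_sqr dl k * tau k)].
Proof.
move=> dl0 ttau; pose S k := trig_sqr dl k * tau k.
have tS : trig S by exact: trig_mul (trig_trig_sqr dl) ttau.
have [S1 [S2 [A hS]]] := trig_trigL b sigma nu tS.
have [tau1 [tau2 [At ht]]] := trig_trigL b sigma nu ttau.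
have [dS dS1] := trigL_derive hS; have [dt dt1] := trigL_derive ht.
have dQ (y : R) : is_derive y 1 (trig_sqr dl) (2 / dl * sin (dl * y)).
  have h1 := is_derive_cosM dl y.
  have -> : trig_sqr dl = (fun k => 2 / dl ^+ 2 * (1 - cos (dl * k))).
    by apply/funext => k; rewrite /trig_sqr; field; rewrite gt_eqF.
  by apply: is_derive_eq; rewrite /GRing.scale/=; field; rewrite gt_eqF.
have dQ1 (y : R) : is_derive y 1 (fun y => 2 / dl * sin (dl * y)) (2 * cos (dl * y)).
  have h1 := is_derive_sinM dl y.
  by apply: is_derive_eq; rewrite /GRing.scale/=; field; rewrite gt_eqF.
have S1E : S1 = (fun y => trig_sqr dl y * tau1 y + tau y * (2 / dl * sin (dl * y))).
  apply/funext => y; have h1 := dt y; have h2 := dQ y.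
  have h : is_derive y 1 S (trig_sqr dl y * tau1 y + tau y * (2 / dl * sin (dl * y))).
    clear dS dS1; rewrite /S.
    by apply: is_derive_eq; rewrite /GRing.scale/=; ring.
  exact: is_derive_inj (dS y) h.
have Q0 : trig_sqr dl 0 = 0 by rewrite /trig_sqr mulr0 cos0 mulr1 subrr mul0r.
have S10 : S1 0 = 0 by rewrite S1E Q0 mulr0 sin0 !mulr0 mul0r addr0.
have S20 : S2 0 = 2 * tau 0.
  have h1 := dt1 0; have h2 := dQ 0; have h3 := dt 0; have h4 := dQ1 0.
  have h : is_derive (0 : R) 1 S1 (2 * tau 0).
    clear dS dS1; rewrite S1E; apply: is_derive_eq; rewrite /GRing.scale/= Q0 mulr0 sin0 cos0; ring.
  exact: is_derive_inj (dS1 0) h.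
have cS : continuous S by exact: trig_continuous.
have [M hM] := trig_bounded ttau.
have Qle k : trig_sqr dl k <= k ^+ 2.
  rewrite trig_sqrE -(real_normK (num_real k)) -(real_normK (num_real (2 / dl * _))).
  rewrite lerXn2r ?nnegrE// normrM (le_trans (ler_wpM2l _ (sin_le_abs _)))//.
  by rewrite -normrM (_ : 2 / dl * _ = k)//; field; rewrite gt_eqF.
have iS : nu.-integrable setT (EFin \o S).
  apply: (levy_integrable nu_levy nu_mom (M := M) (m := 0)).
    exact: continuous_measurable.
  move=> k; rewrite expr0 mulr1 normrM (ger0_norm (trig_sqr_ge0 _ _)) mulrC.
  by rewrite ler_pM ?trig_sqr_ge0.
exists S1, S2, A; split => //.
have [iD AE] := trigL_generator nu_levy nu_mom hS 0.
rewrite AE S10 S20 mulr0 add0r.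
have -> : \int[nu]_k diff2 S 0 k = 2 * \int[nu]_k S k.
  have e (k : R) : diff2 S 0 k = S k + S (- k).
    by rewrite /diff2 add0r sub0r {3}/S Q0 mul0r mulr0 subr0.
  under eq_Rintegral do rewrite e.
  have iSN : nu.-integrable setT (EFin \o (fun k => S (- k))).
    apply: (levy_integrable nu_levy nu_mom (M := M) (m := 0)).
      apply: continuous_measurable => k; apply: (continuous_comp (f := -%R) (g := S)); last exact: cS.
      exact: opp_continuous.
    move=> k; rewrite expr0 mulr1 normrM (ger0_norm (trig_sqr_ge0 _ _)) mulrC.
    by rewrite ler_pM ?trig_sqr_ge0// -(sqrrN k).
  by rewrite RintegralD// (Rintegral_opp nu_sym iS); ring.
by rewrite /S; field.
Qed.

Section jump.
Variables (f f1 f2 f3 : R -> R) (p : R).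
Hypotheses (df : forall x : R, is_derive x 1 f (f1 x))
  (df1 : forall x : R, is_derive x 1 f1 (f2 x))
  (df2 : forall x : R, is_derive x 1 f2 (f3 x)).
Hypotheses (bf2 : pbd f2) (bf3 : pbd f3).

(* [sin] serves as compensator because [E (sin (xi h))] is explicit and [nu] is symmetric. *)
Definition sin_remainder k := f (p + k) - f p - f1 p * sin k.

Let phi := sin_remainder.
Let phi1 k := f1 (p + k) - f1 p * cos k.
Let phi2 k := f2 (p + k) + f1 p * sin k.
Let phi3 k := f3 (p + k) + f1 p * cos k.

Let dshift (g g' : R -> R) (k : R) : (forall x : R, is_derive x 1 g (g' x)) ->
  is_derive k 1 (fun k => g (p + k)) (g' (p + k)).
Proof.
move=> dg; have h1 : is_derive k 1 (fun k => p + k) 1.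
  by have h := is_deriveD (is_derive_cst p k 1) (is_derive_id k 1); rewrite add0r in h.
have h := @is_derive1_comp _ g (fun k => p + k) k _ _ (dg _) h1.
by apply: is_derive_eq; rewrite mulr1.
Qed.

Let dphi (k : R) : is_derive k 1 phi (phi1 k).
Proof.
have h := dshift k df; rewrite /phi /sin_remainder /phi1.
by apply: is_derive_eq; rewrite /GRing.scale/=; ring.
Qed.

Let dphi1 (k : R) : is_derive k 1 phi1 (phi2 k).
Proof.
have h := dshift k df1; rewrite /phi1 /phi2.
by apply: is_derive_eq; rewrite /GRing.scale/=; ring.
Qed.

Let dphi2 (k : R) : is_derive k 1 phi2 (phi3 k).
Proof.
have h := dshift k df2; rewrite /phi2 /phi3.
by apply: is_derive_eq; rewrite /GRing.scale/=; ring.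
Qed.

Let pbd_shift_add (g h : R -> R) : pbd g -> (forall k, `|h k| <= 1) ->
  pbd (fun k => g (p + k) + f1 p * h k).
Proof.
move=> bg h1; apply: pbdD; first exact: pbd_shift.
by apply: pbdM; [exact: pbd_cst|exact: pbd_bounded h1].
Qed.

Let phi_0 : phi 0 = 0. Proof. by rewrite /phi /sin_remainder addr0 sin0 mulr0 !subrr. Qed.
Let phi1_0 : phi1 0 = 0. Proof. by rewrite /phi1 addr0 cos0 mulr1 subrr. Qed.
Let phi2_0 : phi2 0 = f2 p. Proof. by rewrite /phi2 addr0 sin0 mulr0 addr0. Qed.

Lemma sin_remainder_bound : exists (C : R) (m : nat), 0 <= C /\
  forall k, `|sin_remainder k| <= C * (k ^+ 2 * wt k ^+ m).
Proof.
have [C [m [C0 hC]]] := pbd_shift_add bf2 (@sin_max R).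
exists C, m; split => // k.
have := @taylor2 _ phi phi1 phi2 k (C * wt k ^+ m) dphi dphi1.
rewrite phi_0 phi1_0 mul0r !subr0 mulrAC -mulrA; apply => y yk.
by rewrite (le_trans (hC y))// ler_wpM2l// wtX_norm_le.
Qed.

Lemma sin_remainder_bound3 : exists (C : R) (m : nat), 0 <= C /\
  forall k, `|sin_remainder k - f2 p / 2 * k ^+ 2| <= C * wt k ^+ m * `|k| ^+ 3.
Proof.
have [C [m [C0 hC]]] := pbd_shift_add bf3 (@cos_max R).
exists C, m; split => // k.
have := @taylor3 _ phi phi1 phi2 phi3 k (C * wt k ^+ m) dphi dphi1 dphi2.
rewrite phi_0 phi1_0 phi2_0 mul0r !subr0; apply => y yk.
by rewrite (le_trans (hC y))// ler_wpM2l// wtX_norm_le.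
Qed.

(** The value at 0 is the second Taylor coefficient of the remainder; the bound on the third
    derivative makes [F] continuous there, as uniform approximation on compact sets demands. *)
Let F k := if k == 0 then f2 p / 2 else phi k / k ^+ 2.

Let FE k : k ^+ 2 * F k = phi k.
Proof.
rewrite /F; case: eqVneq => [->|k0]; first by rewrite phi_0 expr0n mul0r.
by rewrite mulrC divfK// expf_neq0.
Qed.

Let F_cont : continuous F.
Proof.
move=> k; have [->|k0] := eqVneq k 0.
  have [C [m [C0 hC]]] := sin_remainder_bound3.
  have F0 : F 0 = f2 p / 2 by rewrite /F eqxx.
  apply/cvgrPdist_le => e e0.
  have c : (fun y : R => C * wt y ^+ m * `|y|) y @[y --> (0 : R)] --> C * wt 0 ^+ m * `|(0 : R)|.
    apply: cvgM; last exact: norm_continuous.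
    by apply: cvgMr; exact: wtX_continuous.
  rewrite normr0 mulr0 in c.
  have /cvgrPdist_le/(_ _ e0) := c; apply: filterS => y; rewrite sub0r normrN => hy.
  rewrite F0 /F; case: eqVneq => [_|y0]; first by rewrite subrr normr0 ltW.
  have y20 : 0 < `|y| ^+ 2 by rewrite exprn_gt0// normr_gt0.
  apply: le_trans hy; apply: le_trans (ler_norm _).
  rewrite -(ler_pM2r y20) -{1}normrX -normrM mulrBl divfK ?expf_neq0// distrC.
  by rewrite -(mulrA (C * _)) -(exprS `|y|); exact: hC.
have : phi y / y ^+ 2 @[y --> k] --> F k.
  rewrite /F (negbTE k0); apply: cvgM; first exact: is_derive_continuous.
  by apply: cvgV; [rewrite expf_neq0|exact: exprn_continuous].
apply: cvg_trans; apply: near_eq_cvg.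
have : \forall y \near k, y != 0.
  exists `|k|; first by rewrite /= normr_gt0.
  by move=> y /= ky; apply/eqP => y0; move: ky; rewrite y0 subr0 ltxx.
by apply: filterS => y y0; rewrite /F (negbTE y0).
Qed.

Let F_bound : exists (C : R) (m : nat), 0 <= C /\ forall k, `|F k| <= C * wt k ^+ m.
Proof.
have [C [m [C0 hC]]] := sin_remainder_bound.
exists (C + `|f2 p / 2|), m; split => [|k]; first exact: addr_ge0.
rewrite /F; case: eqVneq => [_|k0].
  by rewrite -[X in X <= _]mulr1 ler_pM ?wtX_ge1// lerDr.
have k20 : 0 < k ^+ 2 by rewrite lt_neqAle eq_sym expf_neq0// sqr_ge0.
rewrite normrM normfV (gtr0_norm k20) ler_pdivrMr// (le_trans (hC k))//.
rewrite -(mulrA (C + _)) (mulrC (wt k ^+ m)) ler_wpM2r ?lerDl//; nonneg.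
Qed.

Let phi_cont : continuous phi.
Proof. by move=> k; exact: is_derive_continuous. Qed.

Let f_cont : continuous f.
Proof. by move=> k; exact: is_derive_continuous. Qed.

Let phi_integrable : nu.-integrable setT (EFin \o phi).
Proof.
have [C [m [C0 hC]]] := sin_remainder_bound.
by apply: (levy_integrable nu_levy nu_mom _ hC); exact: continuous_measurable.
Qed.

Let jump_integrandE k :
  jump_integrand f p k = phi k + f1 p * (sin (1 * k) - 1 * k * \1_(@small_jumps R) k).
Proof. by rewrite /jump_integrand /phi /sin_remainder derive1E derive_val !mul1r; ring. Qed.

Lemma jump_integrand_integrable : nu.-integrable setT (EFin \o jump_integrand f p).
Proof.
rewrite (_ : jump_integrand f p = fun k => phi k + f1 p * (sin (1 * k) - 1 * k * \1_(@small_jumps R) k)).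
  apply: integrable_add => //; apply: integrable_scale => //.
  exact: (integrable_compensated_sin nu_levy nu_mom).
by apply/funext => k; exact: jump_integrandE.
Qed.

(** The compensators [sin k] and [k] cut off at 1 differ by an odd function, whose integral
    vanishes. *)
Lemma integral_jump_integrand : \int[nu]_k jump_integrand f p k = \int[nu]_k sin_remainder k.
Proof.
have h := integrable_compensated_sin nu_levy nu_mom 1.
under eq_Rintegral do rewrite jump_integrandE.
rewrite RintegralD//; last by apply: integrable_scale.
rewrite (@RintegralZl _ _ _ nu setT _ (f1 p) measurableT h).
rewrite [X in _ + _ * X](Rintegral_odd nu_sym)// ?mulr0 ?addr0// => k.
rewrite !mulrN sinN !indicE (_ : (- k \in _) = (k \in @small_jumps R)); last first.
  by apply/idP/idP; rewrite !inE /small_jumps/= normrN.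
by rewrite opprB mulNr opprK addrC.
Qed.

Lemma sin_remainder_moment : exists2 K : R, 0 <= K &
  forall h, 0 <= h <= 1 -> L1le P setT (fun w => sin_remainder (xi h w)) (K * h).
Proof.
have [C [m [C0 hC]]] := sin_remainder_bound.
have [K K0 hK] := xi_sqr_moment nu_levy nu_sym nu_mom xi_chf xi0 1 m.
exists (C * K) => [|h h1]; first exact: mulr_ge0.
rewrite -mulrA -[X in X * (K * h)]ger0_norm//.
refine (L1le_dom measurableT _ _ (L1le_scale measurableT C (hK h h1))).
  exact: measurable_xi.
by move=> w _; rewrite (le_trans (hC _))// ler_norm.
Qed.

Lemma f_integrable h : 0 <= h <= 1 -> P.-integrable setT (EFin \o (fun w => f (p + xi h w))).
Proof.
move=> h1; have [K K0 hK] := sin_remainder_moment.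
have i1 := L1le_integrable (hK h h1).
have i2 : P.-integrable setT (EFin \o (fun w => sin (1 * xi h w))).
  exact: (trig_integrable xi h (trig_sin 1)).
have i3 : P.-integrable setT (EFin \o cst (f p)) by exact: finite_measure_integrable_cst.
have := integrable_add measurableT (integrable_add measurableT i1 (integrable_scale measurableT (f1 p) i2)) i3.
congr (_.-integrable _ (_ \o _)); apply/funext => w.
by rewrite /sin_remainder mul1r /=; ring.
Qed.

(** The increment of [f] is split into [phi - S], the trigonometric [S] and the compensator
    [f1 p * sin]. The last two have explicit expectations. The first is at most
    [e' * (k ^+ 2 * wt k ^+ m.+1)], which costs [e' * K1 * h] in expectation and [e' * K2] in the
    integral for [nu]. *)
Theorem generator_limit (e : R) : 0 < e -> exists2 r : R, 0 < r & forall h, 0 < h -> h < r ->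
  `|(EP (fun w => f (p + xi h w)) - f p) / h -
    (b * f1 p + sigma ^+ 2 / 2 * f2 p + \int[nu]_k jump_integrand f p k)| <= e.
Proof.
move=> e0; have [C [m [C0 FC]]] := F_bound.
have [K1 K10 hK1] := xi_sqr_moment nu_levy nu_sym nu_mom xi_chf xi0 1 m.+1.
have [K2 hK2] := levy_moment nu_levy nu_mom m.+1.
have K20 := L1le_ge0 hK2.
(* The five summands are the coefficients with which [e'] enters the five error terms at the end. *)
pose M : R := K1 + K2 + sigma ^+ 2 + 1 + `|f1 p|.
have M0 : 0 < M by rewrite /M; have := sqr_ge0 sigma; have := normr_ge0 (f1 p); lra.
pose e' := e / (M * 4); have e'0 : 0 < e' by rewrite divr_gt0// mulr_gt0.
have [dl [tau [dl0 ttau tau0 Ftau]]] := quadratic_trig_approx F_cont FC e'0.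
pose S k := trig_sqr dl k * tau k.
have [S1 [S2 [A [hS iS A0]]]] := quadratic_trig_generator dl0 ttau.
have phiS k : `|phi k - S k| <= e' * (k ^+ 2 * wt k ^+ m.+1).
  by rewrite -FE; exact: Ftau.
have [r1 r10 hr1] := trig_limit hS e'0.
have [r2 r20 hr2] := trig_limit (trigL_sin b sigma nu 1) e'0.
exists (Num.min 1 (Num.min r1 r2)); first by rewrite !lt_min ltr01 r10.
move=> h h0; rewrite !lt_min => /andP[h1 /andP[hltr1 hltr2]].
have h01 : 0 <= h <= 1 by rewrite !ltW.
have tS : trig S by exact: trig_mul (trig_trig_sqr dl) ttau.
have iphi : P.-integrable setT (EFin \o (fun w => phi (xi h w))).
  by have [K K0 hK] := sin_remainder_moment; exact: L1le_integrable (hK h h01).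
have iSP := trig_integrable xi h tS.
have isin : P.-integrable setT (EFin \o (fun w => sin (1 * xi h w))).
  exact: (trig_integrable xi h (trig_sin 1)).
have Ef : EP (fun w => f (p + xi h w)) - f p =
    (EP (fun w => phi (xi h w)) - EP (fun w => S (xi h w))) + EP (fun w => S (xi h w))
    + f1 p * EP (fun w => sin (1 * xi h w)).
  rewrite subrK -RintegralZl// -RintegralD//; last exact: integrable_scale.
  have -> : f p = EP (fun=> f p).
    by rewrite Rintegral_cst// [X in _ * fine X]probability_setT mulr1.
  rewrite -RintegralB//; [|exact: f_integrable|exact: finite_measure_integrable_cst].
  by apply: eq_Rintegral => w _; rewrite mul1r /phi /sin_remainder; ring.
have d1 : `|EP (fun w => phi (xi h w)) - EP (fun w => S (xi h w))| <= e' * K1 * h.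
  rewrite -RintegralB// -mulrA -[X in X * (K1 * h)]gtr0_norm//.
  apply: (L1le_norm measurableT).
  refine (L1le_dom measurableT _ _ (L1le_scale measurableT e' (hK1 h h01))).
    by apply: measurable_funB; apply: measurable_xi => //; exact: trig_continuous.
  by move=> w _; rewrite (le_trans (phiS _))// ler_norm.
have d2 : `|\int[nu]_k phi k - \int[nu]_k S k| <= e' * K2.
  rewrite -RintegralB// -[X in X * K2]gtr0_norm//.
  apply: (L1le_norm measurableT).
  refine (L1le_dom measurableT _ _ (L1le_scale measurableT e' hK2)).
    by apply: measurable_funB; apply: continuous_measurable => //; exact: trig_continuous.
  by move=> k _; rewrite (le_trans (phiS _))// ler_norm.
have S00 : S 0 = 0 by rewrite /S /trig_sqr mulr0 cos0 mulr1 subrr !mul0r.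
have d3 : `|EP (fun w => S (xi h w)) / h - (sigma ^+ 2 * tau 0 + \int[nu]_k S k)| <= e'.
  by have := hr1 h h0 hltr1; rewrite -[trig_sqr dl 0 * tau 0]/(S 0) S00 subr0 A0.
have d4 : `|EP (fun w => sin (1 * xi h w)) / h - b| <= e'.
  by have := hr2 h h0 hltr2; rewrite (mulr0 1) sin0 cos0 mulr0 add0r !mulr1 subr0.
have F0 : F 0 = f2 p / 2 by rewrite /F eqxx.
rewrite F0 in tau0.
rewrite integral_jump_integrand -/phi Ef.
move: d1 d2 tau0 d3 d4.
set x1 := EP (fun w => phi (xi h w)); set x2 := EP (fun w => S (xi h w)).
set x3 := EP (fun w => sin (1 * xi h w)); set y1 := \int[nu]_k phi k.
set y2 := \int[nu]_k S k => d1 d2 d5 d3 d4.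
have -> : (x1 - x2 + x2 + f1 p * x3) / h - (b * f1 p + sigma ^+ 2 / 2 * f2 p + y1) =
   (x1 - x2) / h + (x2 / h - (sigma ^+ 2 * tau 0 + y2)) + f1 p * (x3 / h - b)
   - sigma ^+ 2 * (f2 p / 2 - tau 0) - (y1 - y2) by field; rewrite gt_eqF.
have d1' : `|(x1 - x2) / h| <= e' * K1.
  by rewrite normrM (@gtr0_norm _ h^-1) ?invr_gt0// ler_pdivrMr.
have d4' : `|f1 p * (x3 / h - b)| <= `|f1 p| * e' by rewrite normrM ler_wpM2l.
have d5' : `|sigma ^+ 2 * (f2 p / 2 - tau 0)| <= sigma ^+ 2 * e'.
  by rewrite normrM (ger0_norm (sqr_ge0 _)) ler_wpM2l ?sqr_ge0.
have eE : e' * M = e / 4 by rewrite /e'; field; rewrite gt_eqF.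
rewrite (le_trans (ler_normB _ _))// (le_trans (lerD (ler_normB _ _) (lexx _)))//.
rewrite (le_trans (lerD (lerD (ler_normD _ _) (lexx _)) (lexx _)))//.
rewrite (le_trans (lerD (lerD (lerD (ler_normD _ _) (lexx _)) (lexx _)) (lexx _)))//.
apply: (@le_trans _ _ (e' * K1 + e' + `|f1 p| * e' + sigma ^+ 2 * e' + e' * K2)).
  by rewrite !lerD.
have : e' * M = e' * K1 + e' + `|f1 p| * e' + sigma ^+ 2 * e' + e' * K2 by rewrite /M; ring.
by rewrite eE => <-; lra.
Qed.

End jump.

End generator.

(** * Riemann sums along right-continuous paths *)

Section real_integral_tools.
Context d (T : measurableType d) (R : realType) (mu : {measure set T -> \bar R}).
Variables (D : set T) (mD : measurable D).

Lemma Rdominated_convergence (f_ : nat -> T -> R) (f G : T -> R) :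
  (forall n, measurable_fun D (f_ n)) ->
  (forall x, D x -> f_ n x @[n --> \oo] --> f x) ->
  mu.-integrable D (EFin \o G) ->
  (forall n x, D x -> `|f_ n x| <= G x) ->
  mu.-integrable D (EFin \o f) /\
  \int[mu]_(x in D) f_ n x @[n --> \oo] --> \int[mu]_(x in D) f x.
Proof.
move=> mf ff iG fG.
have mf' n : measurable_fun D (EFin \o f_ n) by exact/measurable_EFinP.
have mlim : measurable_fun D f by exact: measurable_fun_cvg mf ff.
have mlim' : measurable_fun D (EFin \o f) by exact/measurable_EFinP.
have ff' : {ae mu, forall x, D x -> (EFin \o f_ n) x @[n --> \oo] --> (EFin \o f) x}.
  by apply: aeW => x Dx; apply: cvg_EFin; [exact: nearW|exact: ff].
have fG' : {ae mu, forall x n, D x -> (`|(EFin \o f_ n) x| <= (EFin \o G) x)%E}.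
  by apply: aeW => x n Dx /=; rewrite lee_fin; exact: fG.
have [i _ c] := dominated_convergence mD mf' mlim' ff' iG fG'.
split => //; apply: fine_cvg; rewrite fineK//; exact: integrable_fin_num.
Qed.

Lemma Rintegral_sum (I : Type) (s : seq I) (f : I -> T -> R) :
  (forall i, mu.-integrable D (EFin \o f i)) ->
  mu.-integrable D (EFin \o (fun x => \sum_(i <- s) f i x)) /\
  \int[mu]_(x in D) (\sum_(i <- s) f i x) = \sum_(i <- s) \int[mu]_(x in D) f i x.
Proof.
move=> fi; elim: s => [|i s [ih1 ih2]].
  split; first by under eq_fun do rewrite big_nil; exact: integrable0.
  by under eq_Rintegral do rewrite big_nil; rewrite big_nil Rintegral_cst// mul0r.
split; first by under eq_fun do rewrite big_cons; exact: integrable_add.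
under eq_Rintegral do rewrite big_cons.
by rewrite big_cons RintegralD// ih2.
Qed.

End real_integral_tools.

Section cadlag.
Context (R : realType).
Implicit Types (x y : R -> R) (t s B : R).

(** Near each [s] the values are within 1 of the left limit on the left, and within 1 of [x s] on
    the right; compactness of the segment makes the local bound global. *)
Lemma cadlag_bounded x t : cadlag x -> exists M : R, forall s, 0 <= s <= t -> `|x s| <= M.
Proof.
move=> [xr xl].
have /compact_near_coveringP/near_covering_withinP := @segment_compact R 0 t.
move=> /(_ _ (+oo%R) (fun M s => `|x s| <= M) _).
case.
  move=> s; rewrite /= in_itv/= => /andP[s0 st].
  have /cvgrPdist_lt/(_ 1 ltr01)[r1 /= r10 h1] := xr s s0.
  have [l [r2 r20 h2]] : exists l : R, exists2 r : R, 0 < r &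
      forall z, 0 <= z -> `|s - z| < r -> z < s -> `|l - x z| < 1.
    (* At [s = 0] there is no left limit, but no admissible [z] lies to the left either, so any
       value of [l] serves. *)
    move: s0; rewrite le_eqVlt => /predU1P[<-|s0].
      by exists 0, 1 => // z z0 _; rewrite ltNge z0.
    have /cvg_ex[l /cvgrPdist_lt/(_ 1 ltr01)[r2 /= r20 h2]] := xl s s0.
    by exists l, r2 => // z z0; exact: h2.
  exists (ball s (Num.min r1 r2), `](`|x s| + `|l| + 1), +oo[%classic) => /=.
    split; first by apply: nbhsx_ballx; rewrite lt_min r10.
    by exists (`|x s| + `|l| + 1); split; rewrite ?num_real// => M; rewrite /= in_itv/= andbT.
  move=> [z M]/= [sz]; rewrite in_itv/= andbT => hM /andP[z0 _].
  move: sz; rewrite /ball/= lt_min => /andP[sz1 sz2].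
  have [zs|sz|->] := ltgtP z s.
  - have := h2 z z0 sz2 zs; rewrite distrC => h.
    rewrite -[x z](subrK l) (le_trans (ler_normD _ _))//.
    by have := normr_ge0 (x s); lra.
  - have := h1 z sz1 sz; rewrite distrC => h.
    rewrite -[x z](subrK (x s)) (le_trans (ler_normD _ _))//.
    by have := normr_ge0 l; lra.
  - by have := normr_ge0 l; lra.
move=> M [_ h]; exists (M + 1) => s s0t.
by apply: (h (M + 1)); [rewrite ltrDl|rewrite /= in_itv].
Qed.

Notation mu := (@lebesgue_measure R).

(** The sums use right endpoints of the cells: these approach each point strictly from the right, so
    right continuity gives pointwise convergence of the step functions, and domination by [B]
    concludes. Measurability of [y] is obtained on the way, as that of a limit of step functions. *)
Lemma right_continuous_riemann_sum y t B : 0 <= t ->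
  (forall s, 0 <= s < t -> y z @[z --> s^'+] --> y s) ->
  (forall s, 0 <= s <= t -> `|y s| <= B) ->
  mu.-integrable `[0, t] (EFin \o y) /\
  (\sum_(j < n.+1) t / n.+1%:R * y (j.+1%:R * t / n.+1%:R)) @[n --> \oo] -->
     \int[mu]_(s in `[0, t]) y s.
Proof.
rewrite le_eqVlt => /predU1P[<- _ _|t0 yr yB].
  split.
    rewrite set_itv1; apply/integrableP; split; first exact: measurable_fun_set1.
    by rewrite integral_set1.
  rewrite set_itv1 Rintegral_set1; apply: cvg_near_cst; apply: nearW => n.
  by rewrite big1// => j _; rewrite mul0r mul0r.
have t0' := ltW t0.
(* The right endpoint of the cell that contains [s] in the mesh of [n.+1] equal cells; it lies
   strictly beyond [s]. *)
pose r n s : R := (Num.truncn (n.+1%:R * s / t)).+1%:R * t / n.+1%:R.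
pose a (n j : nat) : R := j%:R * t / n.+1%:R.
have n0 n : 0 < n.+1%:R :> R by rewrite ltr0n.
have yE n s : 0 <= s < t -> y (r n s) =
    \sum_(j < n.+1) y (a n j.+1) * \1_(`[a n j, a n j.+1[%classic) s.
  move=> /andP[s0 st].
  have z0 : 0 <= n.+1%:R * s / t by rewrite divr_ge0 ?mulr_ge0.
  have /andP[z1 z2] := truncn_itv z0.
  have zn : (Num.truncn (n.+1%:R * s / t) < n.+1)%N.
    rewrite -(ltr_nat R) (le_lt_trans z1)// ltr_pdivrMr// ltr_pM2l//.
  rewrite (bigD1 (Ordinal zn))//= big1 ?addr0.
    rewrite indicE mem_set ?mulr1//= in_itv/= /a.
    move: z1 z2; rewrite ler_pdivlMr// ltr_pdivrMr// => z1 z2.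
    by rewrite ler_pdivrMr// ltr_pdivlMr// (mulrC s) z1 z2.
  move=> j jz; rewrite indicE memNset ?mulr0//= in_itv/= /a.
  rewrite ler_pdivrMr// ltr_pdivlMr// (mulrC s) -ler_pdivlMr// -ltr_pdivrMr//.
  move=> /andP[j1 j2]; move/eqP : jz; apply; apply/val_inj => /=.
  by apply/esym/eqP; rewrite truncn_eq// j1.
have aS n j : a n j < a n j.+1.
  by rewrite /a ltr_pM2r ?invr_gt0// ltr_pM2r// ltr_nat.
have sub n (j : 'I_n.+1) : `[a n j, a n j.+1[ `<=` `[0, t[.
  move=> s /=; rewrite !in_itv/= => /andP[s1 s2]; apply/andP; split.
    by apply: le_trans s1; rewrite divr_ge0 ?mulr_ge0.
  apply: lt_le_trans s2 _; rewrite /a ler_pdivrMr// mulrC ler_pM2l// ler_nat; exact: ltn_ord.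
have mI : measurable (`[0, t[%classic : set (measurableTypeR R)) by exact: measurable_itv.
have cst_int (c : R) : mu.-integrable `[0, t[ (EFin \o cst c).
  apply: integrableS (continuous_integrable_itv 0 t (@cst_continuous _ _ c)) => //.
  by apply: subset_itvl; rewrite bnd_simp.
have indint n (j : 'I_n.+1) : mu.-integrable `[0, t[
    (EFin \o (fun s => y (a n j.+1) * \1_(`[a n j, a n j.+1[%classic) s)).
  apply: integrable_scale => //; apply: integrable_dom (cst_int 1) => //.
  by move=> s _ /=; rewrite indicE ger0_norm ?ler0n// lern1; case: (s \in _).
have sumE n : \int[mu]_(s in `[0, t[) y (r n s) = \sum_(j < n.+1) t / n.+1%:R * y (a n j.+1).
  transitivity (\int[mu]_(s in `[0, t[)
      \sum_(j < n.+1) y (a n j.+1) * \1_(`[a n j, a n j.+1[%classic) s).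
    by apply: eq_Rintegral => s; rewrite inE/= in_itv/= => /yE.
  rewrite (Rintegral_sum _ _ (indint n)).2//.
  apply: eq_bigr => j _; rewrite RintegralZl//; last first.
    apply: integrable_dom (cst_int 1) => //.
    by move=> s _ /=; rewrite indicE ger0_norm ?ler0n// lern1; case: (s \in _).
  rewrite /Rintegral integral_indic// setIidl; last exact: sub.
  rewrite /= lebesgue_measure_itv/= lte_fin aS -EFinB/= mulrC; congr (_ * _).
  by rewrite /a -mulrBl -mulrBl -natr1 addrAC subrr add0r mul1r.
have my n : measurable_fun `[0, t[ (fun s => y (r n s)).
  apply: (eq_measurable_fun (fun s => \sum_(j < n.+1) y (a n j.+1) * \1_(`[a n j, a n j.+1[%classic) s)).
    by move=> s; rewrite inE/= in_itv/= => /yE.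
  have [h _] := Rintegral_sum mI (index_enum 'I_n.+1) (indint n).
  by apply/measurable_EFinP; exact: measurable_int h.
have rE n s : 0 <= s < t -> s < r n s <= t /\ r n s - s <= t / n.+1%:R.
  move=> /andP[s0 st].
  have z0 : 0 <= n.+1%:R * s / t by rewrite divr_ge0 ?mulr_ge0.
  have /andP[z1 z2] := truncn_itv z0.
  have zn : (Num.truncn (n.+1%:R * s / t) < n.+1)%N.
    by rewrite -(ltr_nat R) (le_lt_trans z1)// ltr_pdivrMr// ltr_pM2l.
  move: z1 z2; rewrite ler_pdivlMr// ltr_pdivrMr// => z1 z2.
  rewrite /r ltr_pdivlMr// ler_pdivrMr// (mulrC s) z2 (mulrC t) ler_pM2r// ler_nat zn.
  split=> //; rewrite -natr1 lerBlDr mulrDl mul1r mulrDl addrC lerD2l ler_pdivrMr//.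
  by rewrite (mulrC s).
have ry s : `[0, t[%classic s -> y (r n s) @[n --> \oo] --> y s.
  rewrite /= in_itv/= => st.
  have h := yr s st; apply/cvgrPdist_lt => e e0.
  have /cvgrPdist_lt/(_ e e0)[q /= q0 hq] := h.
  have p0 : 0 < q / t by rewrite divr_gt0.
  near=> n.
  have [/andP[sr _] rs] := rE n s st.
  apply: hq => //=; rewrite distrC gtr0_norm ?subr_gt0// (le_lt_trans rs)//.
  rewrite mulrC -ltr_pdivlMr//; near: n.
  exact: (near_infty_natSinv_lt (PosNum p0)).
have yrB n s : `[0, t[%classic s -> `|y (r n s)| <= B.
  rewrite /= in_itv/= => st; have [/andP[sr rt] _] := rE n s st.
  by apply: yB; rewrite rt andbT; case/andP: st => s0 _; rewrite (le_trans s0)// ltW.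
have [iy c] := Rdominated_convergence mI my ry (cst_int B) yrB.
have iy' : mu.-integrable `[0, t] (EFin \o y).
  have h1 : measurable_fun `[0, t] y.
    apply/measurable_fun_itv_bndo_bndcP; apply/measurable_EFinP.
    exact: measurable_int iy.
  apply: integrable_dom (continuous_integrable_itv 0 t (@cst_continuous _ _ B)) => //.
split=> //.
rewrite -Rintegral_itv_bndo_bndc//.
by under eq_cvg do rewrite -sumE.
Unshelve. all: by end_near. Qed.

End cadlag.

(** * Markov property along a grid *)

Section independence.
Context (R : realType) d (Omega : measurableType d) (P : probability Omega R).
Context d1 d2 (T1 : measurableType d1) (T2 : measurableType d2).
Variables (X1 : Omega -> T1) (X2 : Omega -> T2).
Hypotheses (mX1 : measurable_fun setT X1) (mX2 : measurable_fun setT X2).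
Hypothesis X12 : forall A B, measurable A -> measurable B ->
  P (X1 @^-1` A `&` X2 @^-1` B) = (P (X1 @^-1` A) * P (X2 @^-1` B))%E.

(** Independence identifies the joint law with the product of the marginals, and Tonelli applies.
    The first space is kept abstract because it will be [Omega] itself, equipped with the
    sigma-algebra of the past. *)
Lemma ge0_expectation_indep (psi : T1 * T2 -> \bar R) : measurable_fun setT psi ->
  (forall z, 0 <= psi z)%E ->
  measurable_fun setT (fun x => \int[P]_w psi (x, X2 w))%E /\
  (\int[P]_w psi (X1 w, X2 w) = \int[P]_w \int[P]_w' psi (X1 w, X2 w'))%E.
Proof.
move=> mpsi psi0.
pose Y1 : {mfun Omega >-> T1} := HB.pack X1 (isMeasurableFun.Build _ _ _ _ _ mX1).
pose Y2 : {mfun Omega >-> T2} := HB.pack X2 (isMeasurableFun.Build _ _ _ _ _ mX2).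
have mZ : measurable_fun setT (fun w => (X1 w, X2 w)) by exact: measurable_fun_pair.
pose Z : {mfun Omega >-> (T1 * T2)%type} := HB.pack (fun w => (X1 w, X2 w)) (isMeasurableFun.Build _ _ _ _ _ mZ).
have pE A : measurable A -> (distribution P Y1 \x distribution P Y2)%E A = distribution P Z A.
  by move=> mA; apply: product_measure_unique.
have inner x : (\int[distribution P Y2]_y psi (x, y) = \int[P]_w psi (x, X2 w))%E.
  rewrite ge0_integral_distribution//.
  by apply: measurableT_comp => //; exact: measurable_pair1.
split.
  under eq_fun do rewrite -inner.
  exact: (@measurable_fun_fubini_tonelli_F _ _ _ _ _ (distribution P Y2)).
transitivity (\int[distribution P Z]_z psi z)%E.
  by rewrite ge0_integral_distribution.
transitivity (\int[(distribution P Y1 \x distribution P Y2)%E]_z psi z)%E.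
  by apply: eq_measure_integral => A mA _; exact/esym/pE.
rewrite fubini_tonelli1// /fubini_F.
under eq_integral do rewrite inner.
rewrite ge0_integral_distribution//.
  under eq_fun do rewrite -inner.
  exact: (@measurable_fun_fubini_tonelli_F _ _ _ _ _ (distribution P Y2)).
by move=> x; apply: integral_ge0.
Qed.

Lemma bounded_expectation_indep (psi : T1 * T2 -> R) M : measurable_fun setT psi ->
  (forall z, `|psi z| <= M) ->
  measurable_fun setT (fun x => \int[P]_w psi (x, X2 w)) /\
  \int[P]_w psi (X1 w, X2 w) = \int[P]_w \int[P]_w' psi (X1 w, X2 w').
Proof.
move=> mpsi psiM.
have M0 : 0 <= M by apply: le_trans (psiM point).
(* Adding the bound [M] makes the integrand nonnegative and reduces the claim to Tonelli. *)
pose phi z := psi z + M.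
have phi0 z : 0 <= phi z by have := psiM z; rewrite ler_norml /phi => /andP[]; lra.
have mphi : measurable_fun setT phi by exact: measurable_funD.
have [m1 e1] := @ge0_expectation_indep (EFin \o phi) (iffRL (measurable_EFinP _ _) mphi)
  (fun z => ltac:(by rewrite lee_fin phi0)).
have phi2M z : `|phi z| <= 2 * M.
  by rewrite (le_trans (ler_normD _ _))// (ger0_norm M0); have := psiM z; lra.
have mp1 x : measurable_fun setT (fun w => psi (x, X2 w)).
  apply: (measurableT_comp mpsi); exact: measurable_fun_pair.
have mp2 : measurable_fun setT (fun w => psi (X1 w, X2 w)).
  apply: (measurableT_comp mpsi); exact: measurable_fun_pair.
have i1 x : P.-integrable setT (EFin \o (fun w => psi (x, X2 w))).
  by apply: (L1le_integrable (c := M)); apply: bounded_L1le.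
have i2 : P.-integrable setT (EFin \o (fun w => psi (X1 w, X2 w))).
  by apply: (L1le_integrable (c := M)); apply: bounded_L1le.
have ic (c : R) : P.-integrable setT (EFin \o cst c) by exact: finite_measure_integrable_cst.
have cE (c : R) : \int[P]_w c = c.
  by rewrite Rintegral_cst// [X in _ * fine X]probability_setT mulr1.
have innerE x : (\int[P]_w (phi (x, X2 w))%:E = (\int[P]_w psi (x, X2 w) + M)%:E)%E.
  have h : \int[P]_w phi (x, X2 w) = \int[P]_w psi (x, X2 w) + M.
    by rewrite /phi (RintegralD measurableT (i1 x) (ic M)) cE.
  rewrite -h /Rintegral fineK//; apply: integrable_fin_num => //.
  exact: (integrable_add measurableT (i1 x) (ic M)).
have m3 : measurable_fun setT (fun x => \int[P]_w psi (x, X2 w)).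
  have m2 : measurable_fun setT (EFin \o (fun x => \int[P]_w psi (x, X2 w) + M)).
    rewrite (_ : EFin \o _ = (fun x => \int[P]_w (EFin \o phi) (x, X2 w))%E)//.
    by apply/funext => x /=; rewrite innerE.
  have {}m2 := iffLR (measurable_EFinP _ _) m2.
  rewrite (_ : (fun x => _) = (fun x => (\int[P]_w psi (x, X2 w) + M) - M)).
    by apply: measurable_funB.
  by apply/funext => x; rewrite addrK.
split => //.
have bnd x : `|\int[P]_w psi (x, X2 w)| <= M.
  by apply: (L1le_norm measurableT); apply: bounded_L1le.
have i3 : P.-integrable setT (EFin \o (fun w => \int[P]_w' psi (X1 w, X2 w'))).
  apply: (L1le_integrable (c := M)); apply: bounded_L1le => //.
  exact: (measurableT_comp m3).
apply: (addIr M); rewrite -[M]cE -(RintegralD measurableT i2 (ic M)) -(RintegralD measurableT i3 (ic M)).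
rewrite /Rintegral; congr fine.
transitivity (\int[P]_w (EFin \o phi) (X1 w, X2 w))%E; first by [].
by rewrite e1; apply: eq_integral => w _; rewrite innerE.
Qed.

End independence.

Section markov.
Context (R : realType) (dO : measure_display) (Omega : measurableType dO)
        (P : probability Omega R) (xi : R -> {RV P >-> R}).
Hypotheses (xi_indep : independent_increments xi) (xi_stat : stationary_increments xi).
Hypothesis xi0 : forall w, xi 0 w = 0.
Implicit Types (f g h : R -> R) (t : nat -> R) (p q : R).

Notation EP f := (\int[P]_w f w).

Definition bdd_measurable f := measurable_fun setT f /\ exists M : R, forall x, `|f x| <= M.

Lemma bdd_measurable_mul f g : bdd_measurable f -> bdd_measurable g ->
  bdd_measurable (fun x => f x * g x).
Proof.
move=> [mf [M fM]] [mg [N gN]]; split; first exact: measurable_funM.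
by exists (M * N) => x; rewrite normrM ler_pM.
Qed.

Lemma bdd_expectation_cst (c : R) : EP (fun=> c) = c.
Proof. by rewrite Rintegral_cst// [X in _ * fine X]probability_setT mulr1. Qed.

Lemma bdd_integrable (X : Omega -> R) (M : R) : measurable_fun setT X ->
  (forall w, `|X w| <= M) -> P.-integrable setT (EFin \o X).
Proof. by move=> mX XM; apply: (L1le_integrable (c := M)); exact: bounded_L1le. Qed.

Definition transition (r : R) f q : R := EP (fun w => f (q + xi r w)).

Lemma bdd_measurable_transition r f : bdd_measurable f -> bdd_measurable (transition r f).
Proof.
move=> [mf [M fM]].
have mx q : measurable_fun setT (fun w => f (q + xi r w)).
  by apply: (measurableT_comp mf); exact: measurable_funD.
split; last first.
  exists M => q; apply: (L1le_norm measurableT); exact: bounded_L1le.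
(* A constant is independent of every variable, so the measurability half of the product formula can
   be applied. *)
pose X0 (w : Omega) : R := 0.
have := @bounded_expectation_indep R _ Omega P _ _ R R X0 (xi r) _ _ _
  (fun z => f (z.1 + z.2)) M _ _.
case=> //.
- exact: measurable_cst.
- move=> A B mA mB; rewrite preimage_cst; case: ifP => _.
    by rewrite setTI [X in (_ = X * _)%E]probability_setT mul1e.
  by rewrite set0I !measure0 mul0e.
- by apply: (measurableT_comp mf); exact: measurable_funD.
Qed.

Lemma expectation_same_law (X Y : {RV P >-> R}) f : bdd_measurable f ->
  (forall A, measurable A -> P (X @^-1` A) = P (Y @^-1` A)) ->
  EP (fun w => f (X w)) = EP (fun w => f (Y w)).
Proof.
move=> [mf [M fM]] XY.
have iX (Z : {RV P >-> R}) : P.-integrable setT ((EFin \o f) \o Z).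
  apply: (@bdd_integrable (f \o Z) M); last by move=> w; exact: fM.
  by apply: (measurableT_comp mf).
have mf' : measurable_fun setT (EFin \o f) by exact/measurable_EFinP.
rewrite /Rintegral; congr fine.
have E (Z : {RV P >-> R}) := integral_distribution mf' (iX Z).
rewrite /= in E; rewrite -!E.
by apply: eq_measure_integral => A mA _; exact: XY.
Qed.

Section grid.
Variables (t : nat -> R) (n : nat).
Hypotheses (t0 : t 0%N = 0) (tmono : forall i, t i <= t i.+1).

Let inc i := increment xi (t i) (t i.+1).

Let minc i : measurable_fun setT (inc i).
Proof. exact: measurable_funB. Qed.

(** The independence hypothesis speaks of these finite intersections only. They form a pi-system,
    which gives access to the whole sigma-algebra they generate. *)
Definition past_events : set (set Omega) :=
  [set E | exists2 A : nat -> set R, (forall i, measurable (A i)) &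
     E = \big[setI/setT]_(i < n) (inc i @^-1` A i)].

Let past_measurable : past_events `<=` measurable.
Proof.
move=> _ [A mA ->]; apply: (big_ind measurable); first exact: measurableT.
- exact: measurableI.
- by move=> i _; rewrite -[X in measurable X]setTI; exact: minc.
Qed.

Let past_setI : setI_closed past_events.
Proof.
move=> _ _ [A mA ->] [B mB ->]; exists (fun i => A i `&` B i).
  by move=> i; exact: measurableI.
by rewrite -big_split.
Qed.

(** As functions of [E], the two sides are finite measures that agree on the pi-system
    [past_events], hence on the sigma-algebra it generates. The next increment is conditioned on as
    the [n]-th factor of a product of [n.+1] events. *)
Lemma past_event_indep E B : <<s past_events >> E -> measurable B ->
  P (E `&` inc n @^-1` B) = (P E * P (inc n @^-1` B))%E.
Proof.
move=> pE mB.
have mX : measurable (inc n @^-1` B) by rewrite -[X in measurable X]setTI; exact: minc.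
have pos : 0 <= fine (P (inc n @^-1` B)) by exact: fine_ge0.
pose m1 : {measure set Omega -> \bar R} := mrestr P mX.
pose m2 : {measure set Omega -> \bar R} := mscale (NngNum pos) P.
have HE : [set X | past_events X /\ X `<=` setT] = past_events.
  by apply/seteqP; split => X /=; [case|].
have fP : (fine (P (inc n @^-1` B)))%:E = P (inc n @^-1` B).
  by rewrite fineK// fin_num_measure.
have := @g_sigma_algebra_measure_unique_trace _ R Omega past_events setT.
rewrite HE => /(_ measurableT past_measurable past_setI m1 m2).
rewrite /m1 /m2 /mrestr /mscale/= => h.
have {}h := h _ _ _ _ E pE.
rewrite [LHS](_ : _ = mrestr P mX E)// h; last 4 first.
- by rewrite /mrestr /mscale/= fP setTI [X in (_ = _ * X)%E]probability_setT mule1.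
- move=> _ [A mA ->].
  pose A' i := if i == n then B else A i.
  have mA' i : measurable (A' i) by rewrite /A'; case: eqP.
  have tm i : (i < n.+1)%N -> t i <= t i.+1 by [].
  have h1 := xi_indep (n := n.+1) (A := A') (eq_ind_r (fun z => 0 <= z) (lexx 0) t0)
    (fun i _ => tmono i) (fun i _ => mA' i).
  have h2 := xi_indep (n := n) (A := A) (eq_ind_r (fun z => 0 <= z) (lexx 0) t0)
    (fun i _ => tmono i) (fun i _ => mA i).
  rewrite /mrestr /mscale/= fP /inc.
  move: h1; rewrite !big_ord_recr/= /A' eqxx.
  under eq_bigr do rewrite ltn_eqF//.
  under [in X in _ = X -> _]eq_bigr do rewrite ltn_eqF//.
  by move=> ->; rewrite h2 muleC.
- by rewrite /mrestr setTI (le_lt_trans (probability_le1 _ _))// ltry.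
- by [].
by rewrite /mscale/= fP muleC.
Qed.

Let Tn := g_sigma_algebraType past_events.

Lemma past_measurable_increment i : (i < n)%N -> measurable_fun [set: Tn] (inc i : Tn -> R).
Proof.
move=> iltn _ B mB; rewrite setTI; apply: sub_sigma_algebra.
exists (fun j => if j == i then B else setT); first by move=> j; case: ifP.
rewrite (bigD1 (Ordinal iltn))//= eqxx big1 ?setIT// => j.
by move=> /negPf ne; rewrite -val_eqE/= in ne; rewrite ne preimage_setT.
Qed.

Lemma past_measurable_value k : (k <= n)%N ->
  measurable_fun [set: Tn] ((fun w => xi (t k) w) : Tn -> R).
Proof.
elim: k => [_|k ih kn].
  rewrite (_ : (fun w => _) = cst 0); first exact: measurable_cst.
  by apply/funext => w; rewrite t0 xi0.
rewrite (_ : (fun w => _) = (fun w => xi (t k) w + inc k w)); last first.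
  by apply/funext => w; rewrite /inc /increment; ring.
by apply: measurable_funD; [exact: ih (ltnW kn) | exact: past_measurable_increment].
Qed.

(** The independent pair is the identity of [Omega], seen as a map into [Omega] with the
    sigma-algebra of the past, and the next increment. Stationarity then replaces this increment by
    the process at time [t n.+1 - t n]. *)
Lemma markov_step (Phi : Tn -> R) (M : R) p f : measurable_fun [set: Tn] Phi ->
  (forall w, `|Phi w| <= M) -> bdd_measurable f ->
  EP (fun w => Phi w * f (p + xi (t n.+1) w)) =
  EP (fun w => Phi w * transition (t n.+1 - t n) f (p + xi (t n) w)).
Proof.
move=> mPhi PhiM [mf [N fN]].
pose psi (z : Tn * R) := Phi z.1 * f (p + xi (t n) z.1 + z.2).
have mid : measurable_fun [set: Omega] (id : Omega -> Tn).
  move=> _ B mB; rewrite setTI preimage_id.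
  have := @smallest_sub _ (sigma_algebra setT) past_events measurable.
  by apply; [exact: sigma_algebra_measurable | exact: past_measurable | exact: mB].
have mpsi : measurable_fun setT psi.
  apply: measurable_funM; first exact: (measurableT_comp mPhi).
  apply: (measurableT_comp mf); apply: measurable_funD => //.
  apply: measurable_funD => //.
  exact: (measurableT_comp (past_measurable_value (leqnn n))).
have bpsi z : `|psi z| <= M * N by rewrite normrM ler_pM.
have t_ge0 k : 0 <= t k by elim: k => [|k ih]; rewrite ?t0// (le_trans ih).
have [_] := @bounded_expectation_indep R _ Omega P _ _ Tn R id (inc n) mid (minc n)
  (fun A B mA mB => past_event_indep mA mB) psi _ mpsi bpsi.
rewrite /psi/= => E.
transitivity (\int[P]_w (Phi w * f (p + xi (t n) w + inc n w))).
  by apply: eq_Rintegral => w _; congr (_ * f _); rewrite /inc /increment; ring.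
rewrite E; apply: eq_Rintegral => w _.
have mfc q : bdd_measurable (fun x => f (q + x)).
  by split; [apply: (measurableT_comp mf); exact: measurable_funD | exists N].
pose Y : {RV P >-> R} := HB.pack (inc n) (isMeasurableFun.Build _ _ _ _ _ (minc n)).
have iY q : P.-integrable setT (EFin \o (fun w => f (q + inc n w))).
  apply: (@bdd_integrable _ N) => //.
  by apply: (measurableT_comp mf); exact: measurable_funD.
rewrite (@RintegralZl _ _ _ P setT _ (Phi w) measurableT (iY _)); congr (_ * _).
apply: (@expectation_same_law Y (xi (t n.+1 - t n)) (fun x => f (p + xi (t n) w + x))) => //.
move=> A mA /=; have d0 : 0 <= t n.+1 - t n by rewrite subr_ge0.
by have := xi_stat (t_ge0 n) d0 mA; rewrite subrKC.
Qed.

End grid.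

(* Iterated kernels: [chain r f n h p] is the expectation, along a walk started at [p] with
   steps [r 0, ..., r (n - 1)], of [h] at the final position times the product of the [f i] at
   the successive positions. *)
Fixpoint chain (r : nat -> R) (f : nat -> R -> R) (n : nat) (h : R -> R) : R -> R :=
  if n is n'.+1 then chain r f n' (transition (r n') (fun x => f n' x * h x)) else h.

Lemma chain_cat r (f : nat -> R -> R) n1 n2 h : chain r f (n1 + n2) h =
  chain r f n1 (chain (fun i => r (n1 + i)%N) (fun i => f (n1 + i)%N) n2 h).
Proof. by elim: n2 h => [|n2 ih] h; rewrite ?addn0// addnS/= ih. Qed.

(** Induction peels off the last step, whose kernel stands innermost in [chain]; conditioning on the
    past turns it into a [transition]. *)
Lemma chain_expectation (r : nat -> R) (f : nat -> R -> R) n h p : (forall i, 0 <= r i) ->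
  (forall i, bdd_measurable (f i)) -> bdd_measurable h ->
  EP (fun w => (\prod_(i < n) f i (p + xi (\sum_(j < i.+1) r j) w)) *
               h (p + xi (\sum_(j < n) r j) w)) = chain r f n h p.
Proof.
move=> r0 bf; elim: n h => [|n ih] h bh.
  rewrite (_ : (fun w => _) = cst (h p)) ?bdd_expectation_cst//.
  by apply/funext => w; rewrite !big_ord0 xi0 mul1r addr0.
rewrite /= -ih; last by apply: bdd_measurable_transition; exact: bdd_measurable_mul.
pose t n := \sum_(j < n) r j.
have t0 : t 0%N = 0 by rewrite /t big_ord0.
have tS i : t i.+1 = t i + r i by rewrite /t big_ord_recr.
have tm i : t i <= t i.+1 by rewrite tS lerDl.
pose Tn := g_sigma_algebraType (past_events t n).
have [M hM] : exists M : R, forall w : Omega, `|\prod_(i < n) f i (p + xi (t i.+1) w)| <= M.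
  elim: (n) => [|m [M hM]]; first by exists 1 => w; rewrite big_ord0 normr1.
  have [_ [N hN]] := bf m.
  by exists (M * N) => w; rewrite big_ord_recr normrM ler_pM.
have mm : measurable_fun [set: Tn] (fun w : Tn => \prod_(i < n) f i (p + xi (t i.+1) w)).
  rewrite (_ : (fun w => _) = (fun w : Tn => \prod_(i <- enum 'I_n) f i (p + xi (t i.+1) w))); last first.
    by apply/funext => w; rewrite big_enum.
  apply: measurable_prod => i _; apply: (measurableT_comp (bf i).1).
  by apply: measurable_funD => //; exact: past_measurable_value.
rewrite -(_ : t n.+1 - t n = r n); last by rewrite tS addrC addKr.
rewrite -(markov_step t0 tm p mm hM); last exact: bdd_measurable_mul.
by apply: eq_Rintegral => w _; rewrite big_ord_recr/= -mulrA.
Qed.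

End markov.

(** * The Feynman-Kac semigroup *)

Section translation.
Context (R : realType).
Notation mu := (@lebesgue_measure R).

Lemma Rintegral_translation (y : R -> R) (h : R) (D : set R) : measurable D ->
  mu.-integrable D (EFin \o y) -> mu.-integrable ((+%R h) @^-1` D) (EFin \o (fun s => y (h + s))) ->
  \int[mu]_(s in D) y s = \int[mu]_(s in (+%R h) @^-1` D) y (h + s).
Proof.
move=> mD iy iyh.
pose phi : measurableTypeR R -> measurableTypeR R := +%R h.
have mphi : measurable_fun [set: measurableTypeR R] phi by exact: measurable_funD.
have mD' : measurable (phi @^-1` D) by rewrite -[X in measurable X]setTI; exact: mphi.
have muE (A : set R) : measurable A -> pushforward mu phi A = mu A.
  move=> mA; apply/esym/lebesgue_measure_unique => //= _ [[a b]] _ <-.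
  rewrite /pushforward (_ : phi @^-1` _ = `]a - h, b - h]%classic).
    by rewrite !lebesgue_measure_itv/= !lte_fin ltrD2r; case: ifP => // _; rewrite -!EFinB; congr EFin; ring.
  by apply/seteqP; split => s /=; rewrite /phi !in_itv/= ltrBlDl lerBrDl.
rewrite /Rintegral; congr fine.
rewrite integral_mkcond [RHS]integral_mkcond.
pose f : measurableTypeR R -> \bar R := (EFin \o y) \_ D.
have resE : (EFin \o (fun s : R => y (h + s)%R)) \_ (phi @^-1` D) = f \o phi.
  by apply/funext => s; rewrite /f /patch/=.
transitivity (\int[mu]_s (f \o phi) s)%E; last by rewrite -resE.
have mres : measurable_fun [set: measurableTypeR R] f.
  by apply/(measurable_restrictT _ mD); exact: (measurable_int mu).
transitivity (\int[pushforward mu phi]_s f s)%E.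
  by apply: eq_measure_integral => A mA _; exact/esym/muE.
rewrite (@integral_pushforward _ _ _ _ R phi mphi mu setT f mres) ?preimage_setT//.
by rewrite -resE; apply/(integrable_mkcond _ mD').
Qed.

End translation.

Section paths.
Context (R : realType) (x : R -> R).
Hypothesis cx : cadlag x.
Notation mu := (@lebesgue_measure R).

Lemma cadlag_comp_bounded (F : R -> R) (t : R) : continuous F ->
  exists M : R, forall s, 0 <= s <= t -> `|F (x s)| <= M.
Proof.
move=> cF; have [B hB] := cadlag_bounded t cx.
have [M _ hM] := continuous_itv_bounded (normr_ge0 B) cF.
by exists M => s hs; apply: hM; rewrite (le_trans (hB _ hs)) ?ler_norm.
Qed.

Lemma path_riemann (F : R -> R) (h t : R) : continuous F -> 0 <= h -> 0 <= t ->
  mu.-integrable `[0, t] (EFin \o (fun s => F (x (h + s)))) /\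
  (\sum_(j < n.+1) t / n.+1%:R * F (x (h + j.+1%:R * t / n.+1%:R))) @[n --> \oo] -->
     \int[mu]_(s in `[0, t]) F (x (h + s)).
Proof.
move=> cF h0 t0; have [M hM] := cadlag_comp_bounded (h + t) cF.
apply: (@right_continuous_riemann_sum _ (fun s => F (x (h + s))) t M) => //.
- move=> s /andP[s0 st]; have hs : 0 <= h + s by rewrite addr_ge0.
  have := cx.1 _ hs => cxs.
  apply: continuous_cvg; first exact: cF.
  apply: (cvg_comp (fun z => h + z) x _ cxs) => A [e /= e0 hA]; exists e => //= z zs sz.
  by apply: hA; rewrite /= ?ltrD2l// (_ : h + s - (h + z) = s - z)//; ring.
- by move=> s /andP[s0 st]; apply: hM; rewrite addr_ge0//= lerD2l.
Qed.

Lemma path_riemann0 (F : R -> R) (t : R) : continuous F -> 0 <= t ->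
  mu.-integrable `[0, t] (EFin \o (fun s => F (x s))) /\
  (\sum_(j < n.+1) t / n.+1%:R * F (x (j.+1%:R * t / n.+1%:R))) @[n --> \oo] -->
     \int[mu]_(s in `[0, t]) F (x s).
Proof.
move=> cF t0; have [i h] := path_riemann cF (lexx 0) t0.
have E : (fun s : R => F (x (0 + s))) = (fun s => F (x s)).
  by apply/funext => s; rewrite add0r.
rewrite E in i h; split => //; move: h.
by under eq_fun do under eq_bigr do rewrite add0r.
Qed.

Lemma path_integralD (F : R -> R) (h t : R) : continuous F -> 0 <= h -> 0 <= t ->
  \int[mu]_(s in `[0, h + t]) F (x s) =
  \int[mu]_(s in `[0, h]) F (x s) + \int[mu]_(s in `[0, t]) F (x (h + s)).
Proof.
move=> cF h0 t0.
have i0 (r : R) : 0 <= r -> mu.-integrable `[0, r] (EFin \o (fun s => F (x s))).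
  by move=> r0; have [] := path_riemann0 cF r0.
have [i1 _] := path_riemann cF h0 t0.
have ht : 0 <= h + t by exact: addr_ge0.
apply/eqP; rewrite [eqbRHS]addrC -subr_eq; apply/eqP.
rewrite (Rintegral_itvB (i0 _ ht)) ?bnd_simp ?lerDl//.
rewrite Rintegral_itv_obnd_cbnd; last first.
  by apply: integrableS (i0 _ ht) => // s /=; rewrite !in_itv/= => /andP[/ltW hs ->]; rewrite (le_trans h0).
have E : (+%R h) @^-1` `[h, h + t]%classic = `[0, t]%classic.
  by apply/seteqP; split => s /=; rewrite !in_itv/= lerDl lerD2l.
rewrite (@Rintegral_translation _ (fun s => F (x s)) h)// ?E//.
by apply: integrableS (i0 _ ht) => // s /=; rewrite !in_itv/= => /andP[hs ->]; rewrite (le_trans h0).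
Qed.

End paths.

Section semigroup.
Context (R : realType) (dO : measure_display) (Omega : measurableType dO)
        (P : probability Omega R) (xi : R -> {RV P >-> R}).
Hypotheses (xi_indep : independent_increments xi) (xi_stat : stationary_increments xi).
Hypothesis xi0 : forall w, xi 0 w = 0.
Hypothesis xi_cadlag : forall w, cadlag (fun t => xi t w).
Implicit Types (f F : R -> R) (p q t h s M : R) (n : nat) (w : Omega).

Notation EP f := (\int[P]_w f w).
Notation mu := (@lebesgue_measure R).

Definition path_int F t p w : R := \int[mu]_(s in `[0, t]) F (p + xi s w).

Definition riemann_sum F n t p w : R :=
  \sum_(j < n.+1) t / n.+1%:R * F (p + xi (j.+1%:R * t / n.+1%:R) w).

Lemma shift_continuous F p : continuous F -> continuous (fun z => F (p + z)).
Proof.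
move=> cF z; apply: continuous_comp; last exact: cF.
by apply: cvgD; [exact: cvg_cst|exact: cvg_id].
Qed.

Lemma path_int_integrable F t p w : continuous F -> 0 <= t ->
  mu.-integrable `[0, t] (EFin \o (fun s => F (p + xi s w))).
Proof. by move=> cF t0; have [] := path_riemann0 (xi_cadlag w) (@shift_continuous F p cF) t0. Qed.

Lemma riemann_sum_cvg F t p w : continuous F -> 0 <= t ->
  riemann_sum F n t p w @[n --> \oo] --> path_int F t p w.
Proof. by move=> cF t0; have [] := path_riemann0 (xi_cadlag w) (@shift_continuous F p cF) t0. Qed.

Lemma measurable_riemann_sum F n t p : continuous F -> measurable_fun setT (riemann_sum F n t p).
Proof.
move=> cF; apply: measurable_sum => i; apply: measurable_funM => //.
exact: (measurable_xi xi _ (@shift_continuous F p cF)).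
Qed.

(** As a limit of Riemann sums the path integral is measurable in [w], without any recourse to joint
    measurability in time and [w]. *)
Lemma measurable_path_int F t p : continuous F -> 0 <= t -> measurable_fun setT (path_int F t p).
Proof.
move=> cF t0; refine (@measurable_fun_cvg _ _ _ _ (fun n => riemann_sum F n t p) _ _ _).
- by move=> n; exact: measurable_riemann_sum.
- by move=> w _; exact: riemann_sum_cvg.
Qed.

Section bounded_below.
Variables (U : R -> R) (K : R).
Hypotheses (cU : continuous U) (K0 : 0 <= K) (UK : forall x, - K <= U x).

Lemma riemann_sum_ge n t p w : 0 <= t -> - (K * t) <= riemann_sum U n t p w.
Proof.
move=> t0; rewrite /riemann_sum.
apply: (@le_trans _ _ (\sum_(j < n.+1) t / n.+1%:R * - K)).
  rewrite sumr_const card_ord -[X in _ <= X]mulr_natl le_eqVlt; apply/orP; left; apply/eqP.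
  have : (n.+1%:R : R) != 0 by rewrite pnatr_eq0.
  by move: (n.+1%:R) => N N0; field.
by apply: ler_sum => j _; apply: ler_wpM2l => //; rewrite divr_ge0.
Qed.

Lemma path_int_ge t p w : 0 <= t -> - (K * t) <= path_int U t p w.
Proof.
move=> t0; have h := @riemann_sum_cvg U t p w cU t0.
rewrite -(cvg_lim (@Rhausdorff R) h); apply: limr_ge; first by apply/cvg_ex; exists (path_int U t p w).
by apply: nearW => n; exact: riemann_sum_ge.
Qed.

Definition fk f t p := EP (fun w => expR (- path_int U t p w) * f (p + xi t w)).

Let kern (dl : R) x : R := expR (- (dl * U x)).

Let kern_bdd dl : 0 <= dl -> bdd_measurable (kern dl).
Proof.
move=> d0; split.
  apply: (measurableT_comp (@measurable_expR R)); apply: measurable_funN.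
  by apply: measurable_funM => //; exact: continuous_measurable.
exists (expR (K * dl)) => x; rewrite ger0_norm ?expR_ge0// ler_expR.
by have := ler_wpM2l d0 (UK x); lra.
Qed.

(** The Feynman-Kac functional with its exponent replaced by a Riemann sum over [n.+1] equal steps;
    weighting at the position after each step matches the right endpoints of [riemann_sum]. *)
Let kchain (t : R) n f := chain (P := P) xi (fun=> t / n.+1%:R) (fun=> kern (t / n.+1%:R)) n.+1 f.

Lemma chain_bdd (r : nat -> R) (fs : nat -> R -> R) n f : (forall i, bdd_measurable (fs i)) ->
  bdd_measurable f -> bdd_measurable (chain (P := P) xi r fs n f).
Proof.
move=> bfs; elim: n f => [//|n ih] f bf /=.
by apply: ih; apply: bdd_measurable_transition; exact: bdd_measurable_mul.
Qed.

Lemma chain_ext (r r' : nat -> R) (fs fs' : nat -> R -> R) n f :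
  (forall i, (i < n)%N -> r i = r' i /\ fs i = fs' i) ->
  chain (P := P) xi r fs n f = chain (P := P) xi r' fs' n f.
Proof.
elim: n f => [//|n ih] f h /=.
have [-> ->] := h n (ltnSn n); apply: ih => i ilt.
by apply: h; exact: leqW.
Qed.

Let kchainE t n f p : 0 <= t -> bdd_measurable f ->
  kchain t n f p = EP (fun w => expR (- riemann_sum U n t p w) * f (p + xi t w)).
Proof.
move=> t0 bf; rewrite /kchain -(chain_expectation xi_indep xi_stat xi0)//; last 2 first.
- by move=> _; rewrite divr_ge0.
- by move=> i; apply: kern_bdd; rewrite divr_ge0.
apply: eq_Rintegral => w _; rewrite /riemann_sum -sumrN expR_sum.
have E (k : nat) : \sum_(j < k) t / n.+1%:R = k%:R * t / n.+1%:R.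
  by rewrite sumr_const card_ord -[LHS]mulr_natl mulrA.
congr (_ * f (p + xi _ w)); last by rewrite E mulrAC divff ?pnatr_eq0// mul1r.
by apply: eq_bigr => i _; rewrite /kern E.
Qed.

(** The grid is uniform on each of the two intervals separately: a single uniform grid on
    [[0, h + s]] need not contain the time [h]. *)
Let riemann_sum2 n h s p w := riemann_sum U n h p w +
  \sum_(j < n.+1) s / n.+1%:R * U (p + xi (h + j.+1%:R * s / n.+1%:R) w).

Let kchain2E h s n f p : 0 <= h -> 0 <= s -> bdd_measurable f ->
  kchain h n (kchain s n f) p =
  EP (fun w => expR (- riemann_sum2 n h s p w) * f (p + xi (h + s) w)).
Proof.
move=> h0 s0 bf.
pose r i := if (i < n.+1)%N then h / n.+1%:R else s / n.+1%:R.
pose fs i := kern (r i).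
have r0 i : 0 <= r i by rewrite /r; case: ifP => _; rewrite divr_ge0.
have bfs i : bdd_measurable (fs i) by exact: kern_bdd.
transitivity (chain (P := P) xi r fs (n.+1 + n.+1) f p).
  rewrite chain_cat; apply: (congr1 (fun F => F p)); rewrite {1}/kchain.
  rewrite (_ : chain _ _ _ _ f = kchain s n f); last first.
    by apply: chain_ext => i _; rewrite /fs /r ltnNge leq_addr.
  by apply: chain_ext => i ilt; rewrite /fs /r ilt.
rewrite -(chain_expectation xi_indep xi_stat xi0)//.
have E1 (k : nat) : (k <= n.+1)%N -> \sum_(j < k) r j = k%:R * h / n.+1%:R.
  move=> kn; rewrite (eq_bigr (fun=> h / n.+1%:R)).
    by rewrite sumr_const card_ord -[LHS]mulr_natl mulrA.
  by move=> j _; rewrite /r (leq_trans (ltn_ord j) kn).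
have E2 (k : nat) : \sum_(j < n.+1 + k) r j = h + k%:R * s / n.+1%:R.
  rewrite big_split_ord/= E1// mulrAC divff ?pnatr_eq0// mul1r; congr (_ + _).
  rewrite (eq_bigr (fun=> s / n.+1%:R)).
    by rewrite sumr_const card_ord -[LHS]mulr_natl mulrA.
  by move=> j _; rewrite /r ltnNge leq_addr.
apply: eq_Rintegral => w _; rewrite /riemann_sum2 /riemann_sum opprD expRD -!sumrN !expR_sum.
congr (_ * f (p + xi _ w)); last by rewrite E2 mulrAC divff ?pnatr_eq0// mul1r.
rewrite big_split_ord/=; congr (_ * _); apply: eq_bigr => i _.
  by rewrite E1// /fs /kern /r ltn_ord.
by rewrite -addnS E2 /fs /kern /r ltnNge leq_addr.
Qed.

Let bdd_cont f M : continuous f -> (forall x, `|f x| <= M) -> bdd_measurable f.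
Proof. by move=> cf fM; split; [exact: continuous_measurable | exists M]. Qed.

Let exp_mul_bound (a c x M : R) : - c <= a -> `|x| <= M -> `|expR (- a) * x| <= expR c * M.
Proof.
move=> ca xM; rewrite normrM ger0_norm ?expR_ge0// ler_pM ?expR_ge0//.
by rewrite ler_expR; lra.
Qed.

Lemma fk_measurable_integrand f t p : continuous f -> 0 <= t ->
  measurable_fun setT (fun w => expR (- path_int U t p w) * f (p + xi t w)).
Proof.
move=> cf t0; apply: measurable_funM.
  apply: (measurableT_comp (@measurable_expR R)); apply: measurable_funN.
  exact: measurable_path_int.
exact: (measurable_xi xi _ (@shift_continuous f p cf)).
Qed.

Lemma fk_integrand_bound f M t p w : 0 <= t -> (forall x, `|f x| <= M) ->
  `|expR (- path_int U t p w) * f (p + xi t w)| <= expR (K * t) * M.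
Proof. by move=> t0 fM; apply: exp_mul_bound => //; exact: path_int_ge. Qed.

Lemma fk_bound f M t p : continuous f -> 0 <= t -> (forall x, `|f x| <= M) ->
  `|fk f t p| <= expR (K * t) * M.
Proof.
move=> cf t0 fM; apply: (L1le_norm measurableT); apply: bounded_L1le.
- exact: fk_measurable_integrand.
- by move=> w; exact: fk_integrand_bound.
Qed.

Let kchain_cvg f M t p : continuous f -> 0 <= t -> (forall x, `|f x| <= M) ->
  kchain t n f p @[n --> \oo] --> fk f t p.
Proof.
move=> cf t0 fM; have bf := bdd_cont cf fM.
under eq_fun do rewrite kchainE//.
apply: (Rdominated_convergence measurableT _ _ _ _).2 => /=.
- move=> n; apply: measurable_funM; last exact: (measurable_xi xi _ (@shift_continuous f p cf)).
  apply: (measurableT_comp (@measurable_expR R)); apply: measurable_funN.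
  exact: measurable_riemann_sum.
- move=> w _; apply: cvgM; last (by exact: cvg_cst); apply: continuous_cvg; first exact: continuous_expR.
  by apply: cvgN; exact: riemann_sum_cvg.
- exact: (@finite_measure_integrable_cst _ _ _ _ _ (expR (K * t) * M)).
- by move=> n w _; apply: exp_mul_bound => //; exact: riemann_sum_ge.
Qed.

Let kchain_bound f M t n p : continuous f -> 0 <= t -> (forall x, `|f x| <= M) ->
  `|kchain t n f p| <= expR (K * t) * M.
Proof.
move=> cf t0 fM; rewrite (kchainE _ _ t0 (bdd_cont cf fM)).
apply: (L1le_norm measurableT); apply: bounded_L1le.
- apply: measurable_funM; last exact: (measurable_xi xi _ (@shift_continuous f p cf)).
  apply: (measurableT_comp (@measurable_expR R)); apply: measurable_funN.
  exact: measurable_riemann_sum.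
- by move=> w; apply: exp_mul_bound => //; exact: riemann_sum_ge.
Qed.

Let kchain_bdd f M t n : continuous f -> 0 <= t -> (forall x, `|f x| <= M) ->
  bdd_measurable (kchain t n f).
Proof.
move=> cf t0 fM; apply: chain_bdd; last exact: bdd_cont fM.
by move=> _; apply: kern_bdd; rewrite divr_ge0.
Qed.

(** The composed chain [kchain h n (kchain s n f)] is read in two ways: as one expectation along the
    two-block grid, converging to the left-hand side, and as an outer expectation whose inner chain
    converges at the random point [p + xi h w]. The lower bound [- K] on [U] supplies constant
    dominating functions for both limits. *)
Lemma fk_semigroup f M h s p : continuous f -> continuous (fk f s) ->
  0 <= h -> 0 <= s -> (forall x, `|f x| <= M) ->
  fk f (h + s) p = fk (fk f s) h p.
Proof.
move=> cf cfk h0 s0 fM; have bf := bdd_cont cf fM.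
have mfp q t : measurable_fun setT (fun w => f (q + xi t w)).
  exact: (measurable_xi xi _ (@shift_continuous f q cf)).
have hs0 : 0 <= h + s by exact: addr_ge0.
have L1 : kchain h n (kchain s n f) p @[n --> \oo] --> fk f (h + s) p.
  under eq_fun do rewrite kchain2E//.
  have ms2 n : measurable_fun setT (riemann_sum2 n h s p).
    apply: measurable_funD; first exact: measurable_riemann_sum.
    apply: measurable_sum => i; apply: measurable_funM => //.
    exact: (measurable_xi xi _ (@shift_continuous U p cU)).
  apply: (Rdominated_convergence measurableT _ _ _ _).2 => /=.
  - move=> n; apply: measurable_funM => //.
    by apply: (measurableT_comp (@measurable_expR R)); exact: measurable_funN.
  - move=> w _; apply: cvgM; last (by exact: cvg_cst); apply: continuous_cvg; first exact: continuous_expR.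
    apply: cvgN; rewrite /path_int (path_integralD (xi_cadlag w) (@shift_continuous U p cU))//.
    apply: cvgD; first exact: riemann_sum_cvg.
    by have [] := path_riemann (xi_cadlag w) (@shift_continuous U p cU) h0 s0.
  - exact: (@finite_measure_integrable_cst _ _ _ _ _ (expR (K * (h + s)) * M)).
  - move=> n w _; apply: exp_mul_bound => //.
    rewrite mulrDr opprD /riemann_sum2 lerD ?riemann_sum_ge//.
    apply: (@le_trans _ _ (\sum_(j < n.+1) s / n.+1%:R * - K)).
      rewrite sumr_const card_ord -[X in _ <= X]mulr_natl le_eqVlt; apply/orP; left; apply/eqP.
      have : (n.+1%:R : R) != 0 by rewrite pnatr_eq0.
      by move: (n.+1%:R) => N N0; field.
    by apply: ler_sum => j _; apply: ler_wpM2l => //; rewrite divr_ge0.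
have L2 : kchain h n (kchain s n f) p @[n --> \oo] --> fk (fk f s) h p.
  under eq_fun => n do rewrite (kchainE n _ h0 (kchain_bdd n cf s0 fM)).
  apply: (Rdominated_convergence measurableT _ _ _ _).2 => /=.
  - move=> n; apply: measurable_funM.
      apply: (measurableT_comp (@measurable_expR R)); apply: measurable_funN.
      exact: measurable_riemann_sum.
    apply: (measurableT_comp (kchain_bdd n cf s0 fM).1).
    exact: measurable_funD.
  - move=> w _; have h1 := @kchain_cvg f M s (p + xi h w) cf s0 fM.
    have h2 : expR (- riemann_sum U n h p w) @[n --> \oo] --> expR (- path_int U h p w).
      apply: continuous_cvg; first exact: continuous_expR.
      by apply: cvgN; exact: riemann_sum_cvg.
    exact: cvgM h2 h1.
  - exact: (@finite_measure_integrable_cst _ _ _ _ _ (expR (K * h) * (expR (K * s) * M))).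
  - move=> n w _; apply: exp_mul_bound; first exact: riemann_sum_ge.
    exact: kchain_bound.
by apply: (cvg_unique (@Rhausdorff R) L1 L2).
Qed.

End bounded_below.
End semigroup.

(** * Regularity in the starting point *)

Section under_integral.
Context (R : realType) d (T : measurableType d) (mu : {measure set T -> \bar R}).

Lemma is_derive_under_integral (D : set T) (f f' : R -> T -> R) (G : T -> R) (p : R) :
  measurable D -> (forall x, mu.-integrable D (EFin \o f x)) ->
  (forall (x : R) y, D y -> is_derive x 1 (f ^~ y) (f' x y)) ->
  mu.-integrable D (EFin \o G) -> (forall y, 0 <= G y) ->
  (forall x y, `|x - p| < 1 -> D y -> `|f' x y| <= G y) ->
  is_derive p 1 (fun x => \int[mu]_(y in D) f x y) (\int[mu]_(y in D) f' p y).
Proof.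
move=> mD fi fd Gi G0 fG.
have pI : `]p - 1, p + 1[%classic p by rewrite /= in_itv/=; apply/andP; split; lra.
have dE x y : D y -> partial1of2 f x y = f' x y.
  by move=> Dy; have h := fd x y Dy; rewrite /partial1of2 derive1E derive_val.
have h1 : forall x, `]p - 1, p + 1[%classic x -> mu.-integrable D (EFin \o f x) by [].
have h2 : forall x y, `]p - 1, p + 1[%classic x -> D y -> derivable (f ^~ y) x 1.
  by move=> x y _ Dy; have h := fd x y Dy; exact: ex_derive.
have h3 : forall x y, `]p - 1, p + 1[%classic x -> D y -> `|partial1of2 f x y| <= G y.
  move=> x y; rewrite /= in_itv/= => /andP[x1 x2] Dy; rewrite dE//; apply: fG => //.
  by rewrite ltr_norml; apply/andP; split; lra.
apply: DeriveDef.
  exact: (derivable_under_integral mD pI h1 h2 G0 Gi h3).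
rewrite -derive1E (differentiation_under_integral mD pI h1 h2 G0 Gi h3).
by apply: eq_Rintegral => y /set_mem Dy; rewrite dE.
Qed.

End under_integral.

(** * Integrals along a path *)

Section path_estimates.
Context (R : realType) (dO : measure_display) (Omega : measurableType dO)
        (P : probability Omega R) (xi : R -> {RV P >-> R}).
Hypothesis xi_cadlag : forall w, cadlag (fun t => xi t w).
Implicit Types (F V W : R -> R) (p q t h s c M T : R) (n : nat) (w : Omega).

Notation EP f := (\int[P]_w f w).
Notation mu := (@lebesgue_measure R).

Lemma sum_mesh (n : nat) (t c : R) : \sum_(j < n.+1) t / n.+1%:R * c = t * c.
Proof.
rewrite sumr_const card_ord -[LHS]mulr_natl.
have : (n.+1%:R : R) != 0 by rewrite pnatr_eq0.
by move: (n.+1%:R) => N N0; field.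
Qed.

Lemma path_int_le F V t p q w : continuous F -> continuous V -> 0 <= t ->
  (forall s, 0 <= s <= t -> `|F (p + xi s w)| <= V (q + xi s w)) ->
  `|path_int xi F t p w| <= path_int xi V t q w.
Proof.
move=> cF cV t0 FV.
have h1 := path_int_integrable xi_cadlag p w cF t0.
have h2 := path_int_integrable xi_cadlag q w cV t0.
rewrite (le_trans (le_normr_Rintegral _ h1))//.
apply: le_Rintegral => //.
  exact: (integrable_norm h1).
Qed.

Lemma path_int_sub F G t p w : continuous F -> continuous G -> 0 <= t ->
  path_int xi (fun x => F x - G x) t p w = path_int xi F t p w - path_int xi G t p w.
Proof.
move=> cF cG t0; rewrite /path_int (@RintegralB _ _ _ mu)//.
- exact: path_int_integrable.
- exact: path_int_integrable.
Qed.

Lemma path_int_cst c t p w : 0 <= t -> path_int xi (fun=> c) t p w = t * c.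
Proof.
have cc : continuous (fun _ : R => c) by exact: cst_continuous.
move=> t0; have h := @riemann_sum_cvg _ _ _ _ _ xi_cadlag _ t p w cc t0.
rewrite -(cvg_lim (@Rhausdorff R) h).
rewrite (_ : (fun n => _) = (fun=> t * c)) ?lim_cst//.
by apply/funext => n; rewrite /riemann_sum sum_mesh.
Qed.

(** Cauchy-Schwarz, read off from the nonnegativity of the integral of [(F - m) ^+ 2], where [m] is
    the mean of [F] along the path. *)
Lemma path_int_sqr F t p w : continuous F -> 0 <= t ->
  path_int xi F t p w ^+ 2 <= t * path_int xi (fun x => F x ^+ 2) t p w.
Proof.
move=> cF t0.
have cF2 : continuous (fun x => F x ^+ 2).
  by move=> x; apply: continuousM; exact: cF.
have i1 := path_int_integrable xi_cadlag p w cF t0.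
have i2 := path_int_integrable xi_cadlag p w cF2 t0.
have [->|tn0] := eqVneq t 0.
  by rewrite /path_int set_itv1 !Rintegral_set1 expr2 !mul0r.
have t1 : 0 < t by rewrite lt_def tn0.
pose m := path_int xi F t p w / t.
have h : 0 <= path_int xi (fun x => (F x - m) ^+ 2) t p w.
  by apply: Rintegral_ge0 => // s _; exact: sqr_ge0.
have E : path_int xi (fun x => (F x - m) ^+ 2) t p w =
   path_int xi (fun x => F x ^+ 2) t p w - 2 * m * path_int xi F t p w + t * m ^+ 2.
  have mI : measurable (`[0%R, t]%classic : set (measurableTypeR R)) by exact: measurable_itv.
  have i3 := integrable_scale mI (- (2 * m)) i1.
  have cc : continuous (fun _ : R => m ^+ 2) by exact: cst_continuous.
  have i4 := path_int_integrable xi_cadlag p w cc t0.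
  rewrite -(path_int_cst (m ^+ 2) p w t0) /path_int.
  have e1 := @RintegralZl _ _ _ mu `[0, t]%classic _ (- (2 * m)) mI i1.
  have e2 := RintegralD mI i2 i3.
  have e3 := RintegralD mI (integrable_add mI i2 i3) i4.
  transitivity (\int[mu]_(s in `[0, t])
     (F (p + xi s w) ^+ 2 + - (2 * m) * F (p + xi s w) + m ^+ 2)).
    by apply: eq_Rintegral => s _; ring.
  refine (etrans e3 _); congr (_ + _); refine (etrans e2 _); congr (_ + _).
  by refine (etrans e1 _); rewrite mulNr.
rewrite E /m in h.
move: h; move: (path_int xi F t p w) (path_int xi _ t p w) => a b h.
have : 0 <= t * (b - 2 * (a / t) * a + t * (a / t) ^+ 2) by rewrite mulr_ge0.
rewrite (_ : t * _ = t * b - a ^+ 2) ?subr_ge0//.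
by field.
Qed.

(** A convex combination of the values at fixed times, scaled by [t], obeys the bound; Fatou along
    the Riemann sums then plays the part of Fubini in time and [w]. *)
Lemma path_int_L1le F t p c : continuous F -> 0 <= t ->
  (forall s, 0 <= s <= t -> L1le P setT (fun w => F (p + xi s w)) c) ->
  L1le P setT (path_int xi F t p) (t * c).
Proof.
move=> cF t0 h.
apply: (L1le_lim measurableT (X := fun n => riemann_sum xi F n t p)).
  move=> n; rewrite -(sum_mesh n t c).
  have := @L1le_sum _ _ _ P setT measurableT _ (index_enum 'I_n.+1)
    (fun j : 'I_n.+1 => fun w => t / n.+1%:R * F (p + xi (j.+1%:R * t / n.+1%:R) w))
    (fun=> t / n.+1%:R * c).
  apply => j; rewrite -[X in X * c]ger0_norm ?divr_ge0//.
  apply: L1le_scale => //; apply: h.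
  rewrite divr_ge0 ?mulr_ge0//= ler_pdivrMr// mulrC ler_wpM2l// ler_nat.
  exact: ltn_ord.
by move=> w _; exact: riemann_sum_cvg.
Qed.

Lemma is_derive_path_int F F1 F2 t p w : (forall x : R, is_derive x 1 F (F1 x)) ->
  (forall x : R, is_derive x 1 F1 (F2 x)) -> 0 <= t ->
  is_derive p 1 (fun q => path_int xi F t q w) (path_int xi F1 t p w).
Proof.
move=> dF dF1 t0.
have cF : continuous F by move=> x; exact: is_derive_continuous (dF x).
have cF1 : continuous F1 by move=> x; exact: is_derive_continuous (dF1 x).
have [B hB] := cadlag_bounded t (xi_cadlag w).
have BB : 0 <= `|p| + 1 + `|B| by rewrite !addr_ge0.
have [c c0 hc] := continuous_itv_bounded BB cF1.
apply: (@is_derive_under_integral _ _ _ mu _ (fun q s => F (q + xi s w))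
  (fun q s => F1 (q + xi s w)) (fun=> c)) => //.
- by move=> q; exact: path_int_integrable.
- by move=> q s _; exact: is_derive_translate.
- have cc : continuous (fun _ : R => c) by exact: cst_continuous.
  by have := path_int_integrable xi_cadlag p w cc t0.
- move=> q s qp; rewrite /= in_itv/= => st; apply: hc.
  rewrite (le_trans (ler_normD _ _))// lerD//; last first.
    by rewrite (le_trans (hB _ st))// ler_norm.
  by rewrite -[q](subrK p) (le_trans (ler_normD _ _))// addrC lerD// ltW.
Qed.

End path_estimates.

(** * The Feynman-Kac integrand and its derivatives *)

Section weights.
Context (R : realType).

(* If each of the families [G] and [a] consists of the successive derivatives of its first
   member, then [fk_jet j G a] is the [j]-th derivative of [G 0 * exp (- a 0)], [j <= 3]. *)
Definition fk_jet (j : nat) (G a : nat -> R) : R :=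
  match j with
  | 0%N => G 0%N
  | 1%N => G 1%N - G 0%N * a 1%N
  | 2%N => G 2%N - 2 * G 1%N * a 1%N - G 0%N * a 2%N + G 0%N * a 1%N ^+ 2
  | _ => G 3%N - 3 * G 2%N * a 1%N - 3 * G 1%N * a 2%N + 3 * G 1%N * a 1%N ^+ 2
         - G 0%N * a 3%N + 3 * G 0%N * a 1%N * a 2%N - G 0%N * a 1%N ^+ 3
  end * expR (- a 0%N).

Lemma is_derive_fk_jet (j : nat) (G a : nat -> R -> R) (p : R) : (j < 3)%N ->
  (forall i, is_derive p 1 (G i) (G i.+1 p)) -> (forall i, is_derive p 1 (a i) (a i.+1 p)) ->
  is_derive p 1 (fun q => fk_jet j (G ^~ q) (a ^~ q)) (fk_jet j.+1 (G ^~ p) (a ^~ p)).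
Proof.
move=> j3 dG da.
have G0 := dG 0%N; have G1 := dG 1%N; have G2 := dG 2%N.
have a0 := da 0%N; have a1 := da 1%N; have a2 := da 2%N.
have dN : is_derive p 1 (fun q => - a 0%N q) (- a 1%N p) by exact: is_deriveN.
have dE : is_derive p 1 (fun q => expR (- a 0%N q)) (- a 1%N p * expR (- a 0%N p)).
  have h := @is_derive1_comp _ expR (fun q => - a 0%N q) p _ _ (is_derive_expR (- a 0%N p)) dN.
  by apply: is_derive_eq; rewrite mulrC.
clear dN dG da; case: j j3 => [|[|[|//]]] _; rewrite /fk_jet /=.
- by apply: is_derive_eq; rewrite /GRing.scale/=; ring.
- by apply: is_derive_eq; rewrite /GRing.scale/=; ring.
- by apply: is_derive_eq; rewrite /GRing.scale/=; ring.
Qed.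

Lemma measurable_fk_jet d (T : measurableType d) (j : nat) (G a : nat -> T -> R) :
  (forall i, measurable_fun setT (G i)) -> (forall i, measurable_fun setT (a i)) ->
  measurable_fun setT (fun w => fk_jet j (G ^~ w) (a ^~ w)).
Proof.
move=> mG ma; rewrite /fk_jet; apply: measurable_funM; last first.
  by apply: (measurableT_comp (@measurable_expR R)); exact: measurable_funN.
by case: j => [|[|[|j]]];
  repeat first [apply: measurable_funD | apply: measurable_funB | apply: measurable_funM
               | apply: measurable_funX | apply: measurable_funN].
Qed.

(** The third jet is the largest: its coefficients add up to 15 in absolute value, and each of its
    terms is at most [M] times a power of [b] of degree at most 3. With
    [(1 + b) ^+ 3 <= 8 * (1 + b ^+ 4)] this gives 120. *)
Lemma fk_jet_bound (j : nat) (G a : nat -> R) (M b K : R) : (j <= 3)%N ->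
  (forall i, (i <= 3)%N -> `|G i| <= M) -> (forall i, (0 < i <= 3)%N -> `|a i| <= b) -> - K <= a 0%N ->
  `|fk_jet j G a| <= 120 * expR K * M * (1 + b ^+ 4).
Proof.
move=> j3 GM ab aK.
have b0 : 0 <= b by apply: le_trans (ab 1%N isT).
have M0 : 0 <= M by apply: le_trans (GM 0%N isT).
have eK : `|expR (- a 0%N)| <= expR K by rewrite ger0_norm ?expR_ge0// ler_expR; lra.
have G0 := GM 0%N isT; have G1 := GM 1%N isT; have G2 := GM 2%N isT; have G3 := GM 3%N isT.
have a1 := ab 1%N isT; have a2 := ab 2%N isT; have a3 := ab 3%N isT.
have b4 : (1 + b) ^+ 3 <= 8 * (1 + b ^+ 4).
  have b40 : 0 <= b ^+ 4 by exact: exprn_ge0.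
  have [b1|/ltW b1] := leP b 1.
    have : (1 + b) ^+ 3 <= 2 ^+ 3 by rewrite lerXn2r ?nnegrE; lra.
    by rewrite -natrX; lra.
  have : (1 + b) ^+ 3 <= (2 * b) ^+ 3 by rewrite lerXn2r ?nnegrE; lra.
  have : b ^+ 3 <= b ^+ 4 by rewrite ler_weXn2l.
  by rewrite exprMn -natrX; lra.
have E : `|match j with
  | 0%N => G 0%N
  | 1%N => G 1%N - G 0%N * a 1%N
  | 2%N => G 2%N - 2 * G 1%N * a 1%N - G 0%N * a 2%N + G 0%N * a 1%N ^+ 2
  | _ => G 3%N - 3 * G 2%N * a 1%N - 3 * G 1%N * a 2%N + 3 * G 1%N * a 1%N ^+ 2
         - G 0%N * a 3%N + 3 * G 0%N * a 1%N * a 2%N - G 0%N * a 1%N ^+ 3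
  end| <= 15 * M * (1 + b) ^+ 3.
  have P (x y B : R) : `|x| <= M -> `|y| <= B -> `|x * y| <= M * B.
    by move=> xM yB; rewrite normrM ler_pM.
  have sq : `|a 1%N ^+ 2| <= b ^+ 2 by rewrite normrX lerXn2r ?nnegrE.
  have cu : `|a 1%N ^+ 3| <= b ^+ 3 by rewrite normrX lerXn2r ?nnegrE.
  have pr : `|a 1%N * a 2%N| <= b ^+ 2 by rewrite normrM expr2 ler_pM.
  have Mb : 0 <= M * b by exact: mulr_ge0.
  have Mb2 : 0 <= M * b ^+ 2 by rewrite mulr_ge0// exprn_ge0.
  have Mb3 : 0 <= M * b ^+ 3 by rewrite mulr_ge0// exprn_ge0.
  have EM : 15 * M * (1 + b) ^+ 3 = 15 * M + 45 * (M * b) + 45 * (M * b ^+ 2) + 15 * (M * b ^+ 3) by ring.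
  have D (x y A B : R) : `|x| <= A -> `|y| <= B -> `|x + y| <= A + B.
    by move=> xA yB; rewrite (le_trans (ler_normD _ _))// lerD.
  have B (x y A B : R) : `|x| <= A -> `|y| <= B -> `|x - y| <= A + B.
    by move=> xA yB; rewrite (le_trans (ler_normB _ _))// lerD.
  have S (n : nat) (x A : R) : `|x| <= A -> `|n%:R * x| <= n%:R * A.
    by move=> xA; rewrite normrM normr_nat ler_wpM2l.
  have F1 := B _ _ _ _ G1 (P _ _ _ G0 a1).
  have F2 := D _ _ _ _ (B _ _ _ _ (B _ _ _ _ G2 (S 2%N _ _ (P _ _ _ G1 a1))) (P _ _ _ G0 a2))
    (P _ _ _ G0 sq).
  have F3 := B _ _ _ _ (D _ _ _ _ (B _ _ _ _ (D _ _ _ _ (B _ _ _ _ (B _ _ _ _ G3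
    (S 3%N _ _ (P _ _ _ G2 a1))) (S 3%N _ _ (P _ _ _ G1 a2))) (S 3%N _ _ (P _ _ _ G1 sq)))
    (P _ _ _ G0 a3)) (S 3%N _ _ (P _ _ _ G0 pr))) (P _ _ _ G0 cu).
  rewrite EM; move: Mb Mb2 Mb3 M0 G0 F1 F2 F3.
  move: (M * b) (M * b ^+ 2) (M * b ^+ 3) => x y z x0 y0 z0 M0' G0' F1 F2 F3.
  case: j j3 => [|[|[|[|//]]]] _; rewrite -?mulrA.
  - by apply: le_trans G0' _; lra.
  - by apply: le_trans F1 _; lra.
  - by apply: le_trans F2 _; lra.
  - by apply: le_trans F3 _; lra.
have b40 : 0 <= (1 + b) ^+ 3 by apply: exprn_ge0; lra.
rewrite /fk_jet normrM (le_trans (ler_pM _ _ E eK))//.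
rewrite (_ : 120 * expR K * M * (1 + b ^+ 4) = 15 * M * (8 * (1 + b ^+ 4)) * expR K); last by ring.
by rewrite ler_wpM2r ?expR_ge0// ler_wpM2l// mulr_ge0.
Qed.

End weights.

Section regularity.
Context (R : realType) (b sigma : R) (nu : {measure set (measurableTypeR R) -> \bar R}).
Context (d : measure_display) (Omega : measurableType d) (P : probability Omega R)
        (xi : R -> {RV P >-> R}).
Hypothesis nu_levy : levy_measure nu.
Hypothesis nu_sym : symmetric_measure nu.
Hypothesis nu_mom : moments_of_all_orders nu.
Hypothesis xi_chf : forall t x, 0 <= t ->
  cintegral P setT (fun w => cexp (- ('i%C * (x * xi t w)%:C%C)))
  = cexp (- (t%:C%C * levy_symbol b sigma nu x)).
Hypothesis xi0 : forall w, xi 0 w = 0.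
Hypothesis xi_cadlag : forall w, cadlag (fun t => xi t w).
Implicit Types (t p q T C M c : R) (m : nat) (w : Omega) (F : R -> R).

Notation EP f := (\int[P]_w f w).

(* The jets grow like the third power of the path integral; the fourth power is used because
   two applications of Cauchy-Schwarz bring it down to a single integral. *)
Definition path_weight m t w := 1 + path_int xi (fun x => wt x ^+ m) t 0 w ^+ 4.

Lemma path_weight_ge0 m t w : 0 <= path_weight m t w.
Proof.
have : 0 <= (path_int xi (fun x => wt x ^+ m) t 0 w ^+ 2) ^+ 2 by exact: sqr_ge0.
by rewrite -exprM /path_weight => h; rewrite addr_ge0.
Qed.

Lemma path_weight_moment T m : exists2 C : R, 0 <= C &
  forall t, 0 <= t <= T -> L1le P setT (path_weight m t) C.
Proof.
have [K K0 hK] := xi_wt_moment nu_levy nu_sym nu_mom xi_chf xi0 T (m * 4).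
exists (1 + `|T| ^+ 3 * (`|T| * K)); first by nonneg.
move=> t tT; have /andP[t0 tleT] := tT.
have tT' : t <= `|T| by rewrite (le_trans tleT) ?ler_norm.
have cw k : continuous (fun x : R => wt x ^+ k) by exact: wtX_continuous.
have I4 w : path_int xi (fun x => wt x ^+ m) t 0 w ^+ 4 <=
    t ^+ 3 * path_int xi (fun x => wt x ^+ (m * 4)) t 0 w.
  have h1 := path_int_sqr xi_cadlag 0 w (cw m) t0.
  have h2 := path_int_sqr xi_cadlag 0 w (cw (m * 2)%N) t0.
  have E k : (fun x : R => (wt x ^+ k) ^+ 2) = (fun x => wt x ^+ (k * 2)).
    by apply/funext => x; rewrite exprM.
  rewrite !E -mulnA in h1 h2.
  rewrite (_ : path_int _ _ _ _ _ ^+ 4 = (path_int xi (fun x => wt x ^+ m) t 0 w ^+ 2) ^+ 2); last by rewrite -exprM.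
  apply: (@le_trans _ _ ((t * path_int xi (fun x => wt x ^+ (m * 2)) t 0 w) ^+ 2)).
    by rewrite lerXn2r// nnegrE ?sqr_ge0// (le_trans (sqr_ge0 _) h1).
  by rewrite exprMn (exprSr t 2) -[X in _ <= X]mulrA; apply: ler_wpM2l => //; exact: exprn_ge0.
have hK' s : 0 <= s <= t -> L1le P setT (fun w => wt (0 + xi s w) ^+ (m * 4)) K.
  move=> /andP[s0 st]; rewrite (_ : (fun w => _) = (fun w => wt (xi s w) ^+ (m * 4))).
    by apply: hK; rewrite s0 (le_trans st).
  by apply/funext => w; rewrite add0r.
have L4 := path_int_L1le xi_cadlag (cw (m * 4)%N) t0 hK'.
apply: L1le_add => //.
  by apply: bounded_L1le => // w; rewrite normr1.
have L5 := L1le_scale measurableT (t ^+ 3) L4.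
apply: (L1le_weak _ (L1le_dom measurableT _ _ L5)).
- by rewrite ger0_norm ?exprn_ge0// ler_pM ?exprn_ge0 ?mulr_ge0// ?lerXn2r ?nnegrE// ler_wpM2r.
- by apply: measurable_funX; exact: measurable_path_int.
- move=> w _; apply: le_trans (ler_norm _); rewrite ger0_norm ?I4//.
  by rewrite (_ : 4%N = (2 * 2)%N)// exprM sqr_ge0.
Qed.

Lemma path_int_scale F t p c w : continuous F -> 0 <= t ->
  path_int xi (fun x => c * F x) t p w = c * path_int xi F t p w.
Proof.
move=> cF t0.
have mI : measurable (`[0%R, t]%classic : set (measurableTypeR R)) by exact: measurable_itv.
exact: (@RintegralZl _ _ _ lebesgue_measure `[0, t]%classic _ c mI (path_int_integrable xi_cadlag p w cF t0)).
Qed.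

Section jets.
Variables (Ud gd : nat -> R -> R) (K : R).
Hypothesis dU : forall j (x : R), is_derive x 1 (Ud j) (Ud j.+1 x).
Hypothesis pU : forall j, pbd (Ud j).
Hypotheses (K0 : 0 <= K) (UK : forall x, - K <= Ud 0%N x).
Hypothesis dg : forall j (x : R), is_derive x 1 (gd j) (gd j.+1 x).
Hypothesis gM : forall j, exists M : R, forall x, `|gd j x| <= M.

Let cU j : continuous (Ud j).
Proof. by move=> x; exact: is_derive_continuous (dU j x). Qed.

Let cg j : continuous (gd j).
Proof. by move=> x; exact: is_derive_continuous (dg j x). Qed.

Definition fk_path j t p w :=
  fk_jet j (fun i => gd i (p + xi t w)) (fun i => path_int xi (Ud i) t p w).

Definition fk_deriv j t p := EP (fk_path j t p).

Lemma measurable_fk_path j t p : 0 <= t -> measurable_fun setT (fk_path j t p).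
Proof.
move=> t0.
have mg i : measurable_fun setT (fun w => gd i (p + xi t w)).
  exact: (measurable_xi xi _ (@shift_continuous _ (gd i) p (@cg i))).
have mA i : measurable_fun setT (path_int xi (Ud i) t p) by exact: measurable_path_int.
exact: (measurable_fk_jet j mg mA).
Qed.

(** By [wtXD] the starting point is factored out of the path integrals, so that all randomness sits
    in [path_weight], taken at starting point 0. The same bound then serves for every [p], both for
    integrability and for domination when differentiating. *)
Lemma fk_path_bound T : exists (C : R) (m n : nat), 0 <= C /\
  forall j t p w, (j <= 3)%N -> 0 <= t <= T ->
    `|fk_path j t p w| <= C * wt p ^+ n * path_weight m t w.
Proof.
have [M [M0 hM]] : exists M : R, 0 <= M /\ forall i x, (i <= 3)%N -> `|gd i x| <= M.
  have [M0 h0] := gM 0; have [M1 h1] := gM 1; have [M2 h2] := gM 2; have [M3 h3] := gM 3.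
  have := le_trans (normr_ge0 _) (h0 0); have := le_trans (normr_ge0 _) (h1 0).
  have := le_trans (normr_ge0 _) (h2 0); have := le_trans (normr_ge0 _) (h3 0) => p3 p2 p1 p0.
  exists (M0 + M1 + M2 + M3); split; first by lra.
  move=> [|[|[|[|//]]]] x _.
  - by have := h0 x; lra.
  - by have := h1 x; lra.
  - by have := h2 x; lra.
  - by have := h3 x; lra.
have [c [m [c0 hc]]] : exists (c : R) (m : nat), 0 <= c /\
    forall i x, (0 < i <= 3)%N -> `|Ud i x| <= c * wt x ^+ m.
  have [c1 [m1 [c10 h1]]] := pU 1; have [c2 [m2 [c20 h2]]] := pU 2; have [c3 [m3 [c30 h3]]] := pU 3.
  exists (c1 + c2 + c3), (m1 + m2 + m3)%N; split; first by lra.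
  have W (x : R) k cc : (k <= m1 + m2 + m3)%N -> 0 <= cc -> cc <= c1 + c2 + c3 ->
      cc * wt x ^+ k <= (c1 + c2 + c3) * wt x ^+ (m1 + m2 + m3).
    by move=> km cc0 ccle; rewrite ler_pM ?wtX_ge0 ?wtX_le.
  move=> [//|[|[|[|//]]]] x _.
  - by rewrite (le_trans (h1 x))// W//; [by rewrite -addnA leq_addr|lra].
  - by rewrite (le_trans (h2 x))// W//; [by rewrite addnAC leq_addl|lra].
  - by rewrite (le_trans (h3 x))// W//; [by rewrite leq_addl|lra].
pose c' := c * 2 ^+ m.
have c'0 : 0 <= c' by rewrite mulr_ge0// exprn_ge0.
exists (120 * expR (K * T) * M * (1 + c' ^+ 4)), m, (m * 4)%N; split.
  by rewrite !mulr_ge0 ?expR_ge0 ?addr_ge0 ?exprn_ge0.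
move=> j t p w j3 /andP[t0 tT].
have cw : continuous (fun x : R => wt x ^+ m) by exact: wtX_continuous.
have cV : continuous (fun x : R => (c' * wt p ^+ m) * wt x ^+ m).
  by move=> x; exact: (cvgM (cvg_cst _) (cw x)).
set I := path_int xi (fun x => wt x ^+ m) t 0 w.
have Ab i : (0 < i <= 3)%N -> `|path_int xi (Ud i) t p w| <= c' * wt p ^+ m * I.
  move=> i3; rewrite /I -path_int_scale//; apply: path_int_le => // s st.
  rewrite add0r (le_trans (hc _ _ i3))// /c'.
  have := wtXD p (xi s w) m => h.
  by rewrite -!mulrA ler_wpM2l// (le_trans h)// mulrA.
have A0 : - (K * T) <= path_int xi (Ud 0%N) t p w.
  have := @path_int_ge _ _ _ _ _ xi_cadlag (Ud 0%N) K (@cU 0%N) UK t p w t0.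
  by apply: le_trans; rewrite lerN2 ler_wpM2l.
have := fk_jet_bound j3 (fun i hi => hM i (p + xi t w) hi) Ab A0.
move=> /le_trans; apply; rewrite /path_weight -/I.
rewrite -[X in _ <= X]mulrA -[X in _ <= X]mulrA ler_wpM2l ?mulr_ge0 ?expR_ge0//.
clearbody c' I; rewrite !exprMn -exprM.
have I4 : 0 <= I ^+ 4 by rewrite (_ : 4%N = (2 * 2)%N)// exprM sqr_ge0.
have c4 : 0 <= c' ^+ 4 by exact: exprn_ge0.
have W1 := wtX_ge1 p (m * 4).
move: (I ^+ 4) (c' ^+ 4) (wt p ^+ (m * 4)) I4 c4 W1 => x y z x0 y0 z1.
have h1 : 0 <= z * x by rewrite mulr_ge0//; lra.
have h2 : 0 <= y * z by rewrite mulr_ge0//; lra.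
rewrite (_ : (1 + y) * (z * (1 + x)) = z + z * x + y * z + y * z * x); last by ring.
by lra.
Qed.

Lemma fk_deriv_bound T : exists (C : R) (n : nat), 0 <= C /\
  forall j t p, (j <= 3)%N -> 0 <= t <= T -> `|fk_deriv j t p| <= C * wt p ^+ n.
Proof.
have [C [m [n [C0 h]]]] := fk_path_bound T.
have [C' C'0 hm] := path_weight_moment T m.
exists (C * C'), n; split; first exact: mulr_ge0.
move=> j t p j3 tT; have /andP[t0 _] := tT.
apply: (L1le_norm measurableT).
have h2 := L1le_scale measurableT (C * wt p ^+ n) (hm t tT).
apply: (L1le_weak _ (L1le_dom measurableT _ _ h2)).
- by rewrite ger0_norm ?mulr_ge0 ?wtX_ge0// mulrAC.
- exact: measurable_fk_path.
- by move=> w _; apply: le_trans (ler_norm _); exact: h.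
Qed.

Lemma is_derive_fk_deriv j t p : (j < 3)%N -> 0 <= t ->
  is_derive p 1 (fk_deriv j t) (fk_deriv j.+1 t p).
Proof.
move=> j3 t0.
have [C [m [n [C0 h]]]] := fk_path_bound t.
have [C' C'0 hm] := path_weight_moment t m.
have tt : 0 <= t <= t by rewrite t0 lexx.
have i1 q : P.-integrable setT (EFin \o (fun w => C * wt q ^+ n * path_weight m t w)).
  by apply: (integrable_scale measurableT); exact: L1le_integrable (hm t tt).
pose G w := C * wt (`|p| + 1) ^+ n * path_weight m t w.
apply: (@is_derive_under_integral _ _ _ P setT (fk_path j t) (fk_path j.+1 t) G) => //.
- move=> q; apply: (integrable_dom measurableT _ _ (i1 q)).
    exact: measurable_fk_path.
  by move=> w _; apply: h => //; exact: ltnW.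
- move=> q w _; apply: (is_derive_fk_jet (G := fun i q => gd i (q + xi t w))
    (a := fun i q => path_int xi (Ud i) t q w)) => // i.
    exact: is_derive_translate (dg i) q.
  exact: is_derive_path_int (dU i) (dU i.+1) t0.
- exact: i1.
- by move=> w; rewrite !mulr_ge0 ?wtX_ge0 ?path_weight_ge0.
- move=> q w qp _; rewrite (le_trans (h _ _ _ _ _ tt))//.
  rewrite ler_wpM2r ?path_weight_ge0// ler_wpM2l// wtX_norm_le//.
  rewrite [X in _ <= X]ger0_norm; last by have := normr_ge0 p; lra.
  by rewrite -[q](subrK p) (le_trans (ler_normD _ _))// addrC lerD2l ltW.
Qed.

Lemma fk_deriv0 t p : fk_deriv 0 t p = fk xi (Ud 0%N) (gd 0%N) t p.
Proof. by apply: eq_Rintegral => w _; rewrite /fk_path /fk_jet/= mulrC. Qed.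

End jets.
End regularity.

(** * The time derivative *)

Section expansion.
Context (R : realType) (b sigma : R) (nu : {measure set (measurableTypeR R) -> \bar R}).
Context (d : measure_display) (Omega : measurableType d) (P : probability Omega R)
        (xi : R -> {RV P >-> R}).
Hypothesis nu_levy : levy_measure nu.
Hypothesis nu_sym : symmetric_measure nu.
Hypothesis nu_mom : moments_of_all_orders nu.
Hypothesis xi_chf : forall t x, 0 <= t ->
  cintegral P setT (fun w => cexp (- ('i%C * (x * xi t w)%:C%C)))
  = cexp (- (t%:C%C * levy_symbol b sigma nu x)).
Hypothesis xi0 : forall w, xi 0 w = 0.
Hypothesis xi_cadlag : forall w, cadlag (fun t => xi t w).
Implicit Types (s t h p q k T C D M : R) (m n : nat) (w : Omega) (f U : R -> R).

Notation EP f := (\int[P]_w f w).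

Lemma expectation_sin_le h : 0 <= h -> `|EP (fun w => sin (xi h w))| <= `|b| * h.
Proof.
move=> h0; have [_] := E_cos_sin nu_levy nu_sym nu_mom xi_chf 1 h0.
under eq_Rintegral do rewrite mul1r.
move=> ->; rewrite mulr1 normrM.
have l0 : 0 <= lpsi sigma nu 1.
  rewrite addr_ge0//; first by rewrite expr1n mulr1 divr_ge0 ?sqr_ge0.
  by apply: Rintegral_ge0 => // k _; rewrite subr_ge0 cos_le1.
rewrite -[X in _ <= X]mul1r ler_pM//.
  by rewrite ger0_norm ?expR_ge0// -[X in _ <= X]expR0 ler_expR oppr_le0 mulr_ge0.
by rewrite (le_trans (sin_le_abs _))// normrM mulrC (ger0_norm h0).
Qed.

Lemma increment_norm f f1 C n p k : (forall x : R, is_derive x 1 f (f1 x)) -> 0 <= C ->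
  (forall x, `|f1 x| <= C * wt x ^+ n) ->
  `|f (p + k) - f p| <= C * 2 ^+ n * wt p ^+ n * (wt k ^+ n * `|k|).
Proof.
move=> df C0 fC.
have h := @derive_lipschitz R f f1 p `|k| (C * 2 ^+ n * wt p ^+ n * wt k ^+ n) (p + k) df.
have E : p + k - p = k by ring.
rewrite E in h; rewrite [X in _ <= X]mulrA; apply: h => // y yk.
have -> : y = p + (y - p) by ring.
rewrite (le_trans (fC _))// -!mulrA ler_wpM2l//.
rewrite (le_trans (wtXD _ _ _))// ler_wpM2l ?exprn_ge0// ler_wpM2l ?wtX_ge0//.
exact: wtX_norm_le.
Qed.

Lemma increment_sqr_moment C n : 0 <= C -> exists2 D : R, 0 <= D &
  forall f f1 p h, (forall x : R, is_derive x 1 f (f1 x)) ->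
    (forall x, `|f1 x| <= C * wt x ^+ n) -> 0 <= h <= 1 ->
    L1le P setT (fun w => (f (p + xi h w) - f p) ^+ 2) (D * wt p ^+ (n * 2) * h).
Proof.
move=> C0.
have [K K0 hK] := xi_sqr_moment nu_levy nu_sym nu_mom xi_chf xi0 1 (n * 2).
exists ((C * 2 ^+ n) ^+ 2 * K); first by nonneg.
move=> f f1 p h df fC h01.
have cf : continuous f by move=> x; exact: is_derive_continuous (df x).
have L := L1le_scale measurableT ((C * 2 ^+ n * wt p ^+ n) ^+ 2) (hK h h01).
apply: (L1le_weak _ (L1le_dom measurableT _ _ L)).
- by rewrite ger0_norm ?sqr_ge0// exprMn -exprM -!mulrA le_eqVlt; apply/orP; left; apply/eqP; ring.
- apply: measurable_funX; apply: measurable_funB => //.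
  exact: (measurable_xi xi _ (@shift_continuous _ f p cf)).
- move=> w _.
  rewrite [X in _ <= X]ger0_norm; last by rewrite mulr_ge0 ?sqr_ge0// mulr_ge0 ?sqr_ge0 ?wtX_ge0.
  rewrite ger0_norm ?sqr_ge0// -real_normK ?num_real//.
  have h1 := @increment_norm f f1 C n p (xi h w) df C0 fC.
  have := lerXn2r 2 _ _ h1; rewrite !nnegrE => /(_ (normr_ge0 _)).
  move=> h2; rewrite (le_trans (h2 _))//; first by nonneg.
  rewrite [X in X <= _]exprMn ler_wpM2l ?sqr_ge0// exprMn real_normK ?num_real// mulrC.
  by rewrite exprM.
Qed.

Lemma sqrt_square h : 0 < h -> exists2 r : R, 0 < r & h = r ^+ 2.
Proof. by move=> h0; exists (Num.sqrt h); rewrite ?sqrtr_gt0// sqr_sqrtr// ltW. Qed.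

(** Young's inequality trades a first moment for the second moments that are available; the free
    parameter [r] balances the powers of the time step. *)
Lemma norm_le_young (x r : R) : 0 < r -> `|x| <= r + x ^+ 2 / r.
Proof.
move=> r0; rewrite -real_normK ?num_real//.
have y0 := normr_ge0 x; move: `|x| y0 => y y0.
rewrite -(ler_pM2r r0) mulrDl mulfVK ?gt_eqF//.
have := sqr_ge0 (y - r); nra.
Qed.

Lemma norm_mul_le_young (x y r : R) : 0 < r -> `|x * y| <= x ^+ 2 / r + r * y ^+ 2.
Proof.
move=> r0; rewrite normrM -[X in _ <= X / r + _]real_normK ?num_real//.
rewrite -[X in _ <= _ + r * X]real_normK ?num_real//.
have y0 := normr_ge0 y; have x0 := normr_ge0 x; move: `|x| `|y| x0 y0 => a c a0 c0.
rewrite -(ler_pM2r r0) mulrDl mulfVK ?gt_eqF//.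
have := sqr_ge0 (a - r * c); have : 0 <= a * (r * c) by rewrite !mulr_ge0// ltW.
nra.
Qed.

Lemma expR_taylor1_le (a c : R) : - c <= a -> 0 <= c -> `|expR (- a) - 1 + a| <= expR c * a ^+ 2.
Proof.
move=> ca c0.
have h1 := expR_ge1Dx (- a); have h2 := expR_ge1Dx a.
have E0 := expR_ge0 (- a).
have h3 : expR (- a) * (1 + a) <= 1.
  by rewrite -[X in _ <= X](expRxMexpNx_1 a) mulrC ler_wpM2r.
have Ec : expR (- a) <= expR c by rewrite ler_expR; lra.
have c1 : 1 <= expR c by rewrite -[X in X <= _]expR0 ler_expR.
rewrite ger0_norm; last by lra.
have sq := sqr_ge0 a.
have [a0|a0] := leP 0 a.
  have : expR (- a) - 1 + a <= a ^+ 2 by rewrite expr2; have := ler_wpM2l a0 (_ : 1 - expR (- a) <= a); lra.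
  by move=> /le_trans; apply; rewrite ler_peMl.
have x0 : 0 <= - a by lra.
have : expR (- a) - 1 + a <= expR (- a) * a ^+ 2.
  have h4 : expR (- a) - 1 <= - a * expR (- a) by lra.
  by have := ler_wpM2l x0 h4; lra.
by move=> /le_trans; apply; rewrite ler_wpM2r.
Qed.

Section one_step.
Variables (U U1 : R -> R) (K : R).
Hypothesis dU : forall x : R, is_derive x 1 U (U1 x).
Hypotheses (pU : pbd U) (pU1 : pbd U1) (K0 : 0 <= K) (UK : forall x, - K <= U x).

Let cU : continuous U.
Proof. by move=> x; exact: is_derive_continuous (dU x). Qed.

Lemma path_int_sqr_moment : exists (C : R) (n : nat), 0 <= C /\
  forall p h, 0 <= h <= 1 ->
    L1le P setT (fun w => path_int xi U h p w ^+ 2) (C * wt p ^+ n * h ^+ 2).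
Proof.
have [Cu [mu [Cu0 hU]]] := pU.
have [Kw Kw0 hKw] := xi_wt_moment nu_levy nu_sym nu_mom xi_chf xi0 1 (mu * 2).
exists (Cu ^+ 2 * 2 ^+ (mu * 2) * Kw), (mu * 2)%N; split; first by nonneg.
move=> p h /andP[h0 h1].
have cU2 : continuous (fun x => U x ^+ 2).
  by move=> x; apply: continuousM; exact: cU.
have L s : 0 <= s <= h ->
    L1le P setT (fun w => U (p + xi s w) ^+ 2) (Cu ^+ 2 * 2 ^+ (mu * 2) * wt p ^+ (mu * 2) * Kw).
  move=> /andP[s0 sh]; have s1 : 0 <= s <= 1 by rewrite s0 (le_trans sh).
  have L0 := L1le_scale measurableT (Cu ^+ 2 * 2 ^+ (mu * 2) * wt p ^+ (mu * 2)) (hKw s s1).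
  have c0 : 0 <= Cu ^+ 2 * 2 ^+ (mu * 2) * wt p ^+ (mu * 2).
    by rewrite mulr_ge0 ?wtX_ge0//; nonneg.
  apply: (L1le_weak _ (L1le_dom measurableT _ _ L0)).
  - by rewrite ger0_norm.
  - exact: (measurable_xi xi _ (@shift_continuous _ _ p cU2)).
  - move=> w _; apply: le_trans (ler_norm _).
    rewrite ger0_norm ?sqr_ge0// -real_normK ?num_real//.
    apply: (@le_trans _ _ ((Cu * wt (p + xi s w) ^+ mu) ^+ 2)).
      by rewrite lerXn2r ?nnegrE// mulr_ge0 ?wtX_ge0.
    rewrite exprMn -exprM -!mulrA ler_wpM2l//.
    by rewrite ler_wpM2l// wtXD.
have L2 := L1le_scale measurableT h (path_int_L1le xi_cadlag cU2 h0 L).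
apply: (L1le_weak _ (L1le_dom measurableT _ _ L2)).
- by rewrite ger0_norm// le_eqVlt; apply/orP; left; apply/eqP; ring.
- by apply: measurable_funX; exact: measurable_path_int.
- move=> w _; apply: le_trans (ler_norm _).
  by rewrite ger0_norm ?sqr_ge0//; exact: path_int_sqr.
Qed.

(** Of the three powers of [h], one comes from Cauchy-Schwarz in time, one from the length of the
    interval, and one from the mean square of an increment of [U] along the process. *)
Lemma path_int_deviation_moment : exists (C : R) (n : nat), 0 <= C /\
  forall p h, 0 <= h <= 1 ->
    L1le P setT (fun w => (path_int xi U h p w - h * U p) ^+ 2) (C * wt p ^+ n * h ^+ 3).
Proof.
have [C1 [n1 [C10 hU1]]] := pU1.
have [D D0 hD] := increment_sqr_moment n1 C10.
exists D, (n1 * 2)%N; split => // p h /andP[h0 h1].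
have cc : continuous (fun _ : R => U p) by exact: cst_continuous.
have cV : continuous (fun x => U x - U p).
  by move=> x; apply: continuousB; [exact: cU|exact: cst_continuous].
have cV2 : continuous (fun x => (U x - U p) ^+ 2).
  by move=> x; exact: (cvgM (cV x) (cV x)).
have L s : 0 <= s <= h ->
    L1le P setT (fun w => (U (p + xi s w) - U p) ^+ 2) (D * wt p ^+ (n1 * 2) * h).
  move=> /andP[s0 sh]; have s1 : 0 <= s <= 1 by rewrite s0 (le_trans sh).
  apply: L1le_weak (hD U U1 p s dU hU1 s1).
  by rewrite ler_wpM2l// mulr_ge0 ?wtX_ge0.
have L2 := L1le_scale measurableT h (path_int_L1le xi_cadlag cV2 h0 L).
apply: (L1le_weak _ (L1le_dom measurableT _ _ L2)).
- by rewrite ger0_norm// le_eqVlt; apply/orP; left; apply/eqP; ring.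
- apply: measurable_funX; apply: measurable_funB => //; exact: measurable_path_int.
- move=> w _; apply: le_trans (ler_norm _).
  rewrite -(@path_int_cst _ _ _ _ _ xi_cadlag (U p) h p w h0) -(path_int_sub xi_cadlag p w cU cc h0).
  by rewrite ger0_norm ?sqr_ge0//; exact: path_int_sqr.
Qed.

(* The time step is [r ^+ 2], so that increments of the process have size [r]. *)
Lemma fk_expansion M B n : 0 <= M -> 0 <= B -> exists (C : R) (N : nat), 0 <= C /\
  forall v v1 p r, (forall x : R, is_derive x 1 v (v1 x)) -> (forall x, `|v x| <= M) ->
    (forall x, `|v1 x| <= B * wt x ^+ n) -> 0 < r -> r <= 1 ->
    `|fk (P := P) xi U v (r ^+ 2) p - EP (fun w => v (p + xi (r ^+ 2) w)) + r ^+ 2 * U p * v p|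
      <= C * wt p ^+ N * r ^+ 3.
Proof.
move=> M0 B0.
have [a [na [a0 ha]]] := path_int_sqr_moment.
have [e [ne [e0 he]]] := path_int_deviation_moment.
have [D D0 hD] := increment_sqr_moment n B0.
pose E := M * expR K.
have E0 : 0 <= E by rewrite mulr_ge0 ?expR_ge0.
exists (E * a + (a + D) + M * (1 + e)), (na + ne + n * 2)%N; split.
  by rewrite !addr_ge0 ?mulr_ge0 ?addr_ge0.
move=> v v1 p r dv vM v1B r0 r1.
have cv : continuous v by move=> x; exact: is_derive_continuous (dv x).
set h := r ^+ 2.
have h0 : 0 <= h by exact: sqr_ge0.
have h1 : h <= 1 by rewrite /h expr_le1// ltW.
have h01 : 0 <= h <= 1 by rewrite h0 h1.
pose A w := path_int xi U h p w.
pose dl w := v (p + xi h w) - v p.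
pose X w := expR (- A w) * v (p + xi h w) - v (p + xi h w) + h * U p * v p.
have mA : measurable_fun setT A by exact: measurable_path_int.
have mv : measurable_fun setT (fun w => v (p + xi h w)).
  exact: (measurable_xi xi _ (@shift_continuous _ _ p cv)).
have i1 : P.-integrable setT (EFin \o (fun w => expR (- A w) * v (p + xi h w))).
  apply: (L1le_integrable (c := expR (K * h) * M)); apply: bounded_L1le.
    by apply: fk_measurable_integrand.
  by move=> w; apply: (fk_integrand_bound xi_cadlag cU UK).
have i2 : P.-integrable setT (EFin \o (fun w => v (p + xi h w))).
  by apply: (L1le_integrable (c := M)); exact: bounded_L1le.
have i3 : P.-integrable setT (EFin \o (fun w : Omega => h * U p * v p)).
  exact: finite_measure_integrable_cst.
have XE : EP X = fk (P := P) xi U v h p - EP (fun w => v (p + xi h w)) + h * U p * v p.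
  have e1 := RintegralD measurableT (integrable_sub measurableT i1 i2) i3.
  have e2 := RintegralB measurableT i1 i2.
  rewrite /X; refine (etrans e1 _); congr (_ + _); first exact: e2.
  by rewrite Rintegral_cst// [X in _ * fine X]probability_setT mulr1.
rewrite -XE; apply: (L1le_norm measurableT).
(* Every term has expectation of order [r ^+ 3] at most: the square of [A] is of order [r ^+ 4],
   that of [dl] of order [r ^+ 2], and that of [A - h * U p] of order [r ^+ 6]. *)
pose Y w := E * A w ^+ 2 + (r^-1 * A w ^+ 2 + r * dl w ^+ 2) +
            M * (r ^+ 3 + (r ^+ 3)^-1 * (A w - h * U p) ^+ 2).
have rn0 : r != 0 by rewrite gt_eqF.
have L1 := ha p h h01; have L2 := hD v v1 p h dv v1B h01; have L3 := he p h h01.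
have Lc : L1le P setT (fun w : Omega => r ^+ 3) (r ^+ 3).
  by apply: bounded_L1le => // w; rewrite ger0_norm ?exprn_ge0// ltW.
have LY := L1le_add measurableT (L1le_add measurableT (L1le_scale measurableT E L1)
   (L1le_add measurableT (L1le_scale measurableT r^-1 L1) (L1le_scale measurableT r L2)))
   (L1le_scale measurableT M (L1le_add measurableT Lc (L1le_scale measurableT (r ^+ 3)^-1 L3))).
have r30 : 0 < r ^+ 3 by exact: exprn_gt0.
apply: (L1le_weak _ (L1le_dom measurableT _ _ LY)).
- rewrite (ger0_norm E0) (ger0_norm M0) !(gtr0_norm (x := r))// !gtr0_norm ?invr_gt0//.
  have W (k : nat) : (k <= na + ne + n * 2)%N -> wt p ^+ k <= wt p ^+ (na + ne + n * 2) by exact: wtX_le.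
  have W1 := W na ltac:(by rewrite -addnA leq_addr).
  have W2 := W ne ltac:(by rewrite addnAC leq_addl).
  have W3 := W (n * 2)%N ltac:(by rewrite leq_addl).
  have W4 := wtX_ge1 p (na + ne + n * 2).
  move: (wt p ^+ (na + ne + n * 2)) (wt p ^+ na) (wt p ^+ ne) (wt p ^+ (n * 2)) W1 W2 W3 W4
    (wtX_ge0 p na) (wtX_ge0 p ne) (wtX_ge0 p (n * 2)) => w x y z xw yw zw w1 x0 y0 z0.
  rewrite (_ : _ + _ = r ^+ 3 * (E * a * (x * r) + (a * x + D * z) + M * (1 + e * y))); last first.
    by rewrite /h; field.
  rewrite mulrC ler_wpM2r ?(ltW r30)//.
  have xr : x * r <= w.
    by rewrite (le_trans _ xw)// ler_piMr.
  have := ler_wpM2l (mulr_ge0 E0 a0) xr; have := ler_wpM2l a0 xw; have := ler_wpM2l D0 zw.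
  have := ler_wpM2l M0 w1; have := ler_wpM2l (mulr_ge0 M0 e0) yw; lra.
- by apply: measurable_funD => //; apply: measurable_funB => //; exact: fk_measurable_integrand.
- move=> w _; apply: le_trans (ler_norm _).
  have Ag : - K <= A w.
    have := @path_int_ge _ _ _ _ _ xi_cadlag U K cU UK h p w h0.
    by apply: le_trans; rewrite lerN2 ler_piMr.
  have -> : X w = v (p + xi h w) * (expR (- A w) - 1 + A w)
     - A w * dl w - v p * (A w - h * U p) by rewrite /X /dl; ring.
  have b1 : `|v (p + xi h w) * (expR (- A w) - 1 + A w)| <= E * A w ^+ 2.
    by rewrite normrM /E -mulrA ler_pM// expR_taylor1_le.
  have b2 : `|A w * dl w| <= r^-1 * A w ^+ 2 + r * dl w ^+ 2.
    by rewrite [_^-1 * _]mulrC norm_mul_le_young.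
  have b3 : `|v p * (A w - h * U p)| <= M * (r ^+ 3 + (r ^+ 3)^-1 * (A w - h * U p) ^+ 2).
    by rewrite normrM ler_pM// [_^-1 * _]mulrC norm_le_young.
  rewrite (le_trans (ler_normB _ _))// lerD// (le_trans (ler_normB _ _))// lerD//.
Qed.

(** The rate is only the square root of the time step, which is enough for continuity in time of the
    semigroup. *)
Lemma expectation_increment_le B n : 0 <= B -> exists (C : R) (N : nat), 0 <= C /\
  forall v v1 p r, (forall x : R, is_derive x 1 v (v1 x)) ->
    (forall x, `|v1 x| <= B * wt x ^+ n) -> 0 < r -> r <= 1 ->
    L1le P setT (fun w => v (p + xi (r ^+ 2) w) - v p) (C * wt p ^+ N * r).
Proof.
move=> B0; have [D D0 hD] := increment_sqr_moment n B0.
exists (1 + D), (n * 2)%N; split; first by rewrite addr_ge0.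
move=> v v1 p r dv v1B r0 r1; set h := r ^+ 2.
have cv : continuous v by move=> x; exact: is_derive_continuous (dv x).
have h01 : 0 <= h <= 1 by rewrite /h sqr_ge0 expr_le1// ltW.
have Lr : L1le P setT (fun w : Omega => r) r.
  by apply: bounded_L1le => // w; rewrite gtr0_norm.
have L := L1le_add measurableT Lr (L1le_scale measurableT r^-1 (hD v v1 p h dv v1B h01)).
apply: (L1le_weak _ (L1le_dom measurableT _ _ L)).
- rewrite gtr0_norm ?invr_gt0// (_ : _ + _ = r * (1 + D * wt p ^+ (n * 2))); last first.
    by rewrite /h; field; rewrite gt_eqF.
  rewrite mulrC ler_wpM2r ?(ltW r0)// mulrDl mul1r lerD2r.
  exact: wtX_ge1.
- by apply: measurable_funB => //; exact: (measurable_xi xi _ (@shift_continuous _ _ p cv)).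
- move=> w _; apply: le_trans (ler_norm _).
  by rewrite [_^-1 * _]mulrC norm_le_young.
Qed.

End one_step.

End expansion.

(** A weighted Landau inequality. Over a step [k], [f1 q * k] is a difference of values of [f] up to
    a remainder [B * k ^+ 2]: [k] is fixed first so that the remainder is at most half of the
    target, then [e'] so that the values of [f] account for the other half. *)
Lemma interpolation (R : realType) (n : nat) (B e : R) : 0 <= B -> 0 < e ->
  exists2 e' : R, 0 < e' & forall f f1 f2 : R -> R,
    (forall x : R, is_derive x 1 f (f1 x)) -> (forall x : R, is_derive x 1 f1 (f2 x)) ->
    (forall x, `|f x| <= e' * wt x ^+ n) -> (forall x, `|f2 x| <= B * wt x ^+ n) ->
    forall x, `|f1 x| <= e * wt x ^+ n.
Proof.
(* The constant [c] compares weights at distance at most 1: one factor [2 ^+ n] comes from [wtXD],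
   the other from [wt y <= 2]. *)
move=> B0 e0; pose c : R := 2 ^+ n * 2 ^+ n.
have c0 : 0 < c by rewrite mulr_gt0 ?exprn_gt0.
have Bc : 0 < B * c + 1 by rewrite ltr_wpDl// mulr_ge0// ltW.
pose k : R := Num.min 1 (e / (2 * (B * c + 1))).
have k0 : 0 < k by rewrite lt_min ltr01 divr_gt0// mulr_gt0.
have k1 : k <= 1 by rewrite ge_min lexx.
have kB : B * c * k <= e / 2.
  have : (B * c + 1) * k <= e / 2.
    apply: (@le_trans _ _ ((B * c + 1) * (e / (2 * (B * c + 1))))).
      by rewrite ler_wpM2l ?(ltW Bc)// ge_min lexx orbT.
    by rewrite le_eqVlt; apply/orP; left; apply/eqP; field; rewrite gt_eqF.
  by rewrite mulrDl mul1r; lra.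
exists (e * k / (2 * (c + 1))); first by rewrite divr_gt0 ?mulr_gt0//; lra.
move=> f f1 f2 df df1 fe f2B q.
have W y : `|y| <= 1 -> wt (q + y) ^+ n <= c * wt q ^+ n.
  move=> y1; rewrite (le_trans (wtXD _ _ _))// /c -mulrA ler_wpM2l ?exprn_ge0// mulrC.
  rewrite ler_wpM2r ?wtX_ge0// lerXn2r ?nnegrE ?wt_ge0//.
  have := @wt_norm_le _ y 1; rewrite normr1 => /(_ y1); rewrite /wt expr1n; lra.
have := @taylor2 R (fun y => f (y + q)) (fun y => f1 (y + q)) (fun y => f2 (y + q)) k
   (B * (c * wt q ^+ n)) (is_derive_translate q df) (is_derive_translate q df1).
rewrite add0r [k + q]addrC => /(_ _)/wrap[].
  move=> y yk; rewrite addrC (le_trans (f2B _))// ler_wpM2l// W//.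
  by rewrite (le_trans yk)// gtr0_norm.
move=> tay.
have h1 := fe (q + k); have h2 := fe q.
have h3 := W k ltac:(by rewrite gtr0_norm).
have w0 := wtX_ge0 q n; have w1 := wtX_ge0 (q + k) n.
rewrite -(ler_pM2r k0) -[X in _ * X](gtr0_norm k0) -normrM.
have -> : f1 q * k = f (q + k) - f q - (f (q + k) - f q - f1 q * k) by ring.
rewrite (le_trans (ler_normB _ _))//.
set e' := e * k / (2 * (c + 1)) in h1 h2.
have e'0 : 0 <= e' by rewrite divr_ge0 ?mulr_ge0//; lra.
have e'E : e' * (c + 1) = e * k / 2 by rewrite /e'; field; rewrite gt_eqF//; lra.
apply: (@le_trans _ _ (e' * (c * wt q ^+ n) + e' * wt q ^+ n + B * (c * wt q ^+ n) * k ^+ 2)).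
  rewrite lerD// (le_trans (ler_normB _ _))// lerD//.
  by rewrite (le_trans h1)// ler_wpM2l.
have -> : e' * (c * wt q ^+ n) + e' * wt q ^+ n = e * k / 2 * wt q ^+ n by rewrite -e'E; ring.
have -> : B * (c * wt q ^+ n) * k ^+ 2 = B * c * k * (wt q ^+ n * k) by ring.
have := ler_wpM2r (mulr_ge0 w0 (ltW k0)) kB; lra.
Qed.

Lemma norm_sub3_le (R : realType) (a m v x e1 e2 e3 : R) :
  `|a - m + x| <= e1 -> `|m - v| <= e2 -> `|x| <= e3 -> `|a - v| <= e1 + e2 + e3.
Proof.
move=> h1 h2 h3; have -> : a - v = (a - m + x) + (m - v) - x by ring.
rewrite (le_trans (ler_normB _ _))// lerD// (le_trans (ler_normD _ _))// lerD//.
Qed.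

Lemma quotient_right (R : realType) (h q a v m U L c e : R) : 0 < h -> h = q ^+ 2 -> 0 < q ->
  `|a - m + h * U * v| <= c * q ^+ 3 -> c * q <= e / 4 -> `|(m - v) / h - L| <= e / 4 ->
  `|(a - v) / h - (L - U * v)| <= e.
Proof.
move=> h0 hq q0 E1 cq E2.
have -> : (a - v) / h - (L - U * v) = (a - m + h * U * v) / h + ((m - v) / h - L).
  by field; rewrite gt_eqF.
rewrite (le_trans (ler_normD _ _))//.
have : `|(a - m + h * U * v) / h| <= e / 4.
  rewrite normrM (gtr0_norm (x := h^-1)) ?invr_gt0// ler_pdivrMr// (le_trans E1)//.
  by rewrite hq exprS mulrA ler_wpM2r ?sqr_ge0.
have : 0 <= e / 4 by exact: le_trans (normr_ge0 _) E2.
lra.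
Qed.

(** Here [h] is negative, [a] stands for the value at the present time and [v] for the earlier one,
    with [m'] and [m] their expectations after a step. The limit of difference quotients is known
    for the present function only, so [m] is exchanged for [m']; the cost is [m' - m - (a - v)], and
    [U * v] is exchanged for [U * a] likewise. *)
Lemma quotient_left (R : realType) (h q a v m m' U L c e : R) : 0 < - h -> - h = q ^+ 2 -> 0 < q ->
  `|a - m + - h * U * v| <= c * q ^+ 3 -> c * q <= e / 4 -> `|(m' - a) / - h - L| <= e / 4 ->
  `|m' - m - (a - v)| <= e / 4 * - h -> `|U| * `|a - v| <= e / 4 ->
  `|(v - a) / h - (L - U * a)| <= e.
Proof.
rewrite -[in (v - a) / h](opprK h); move: (- h) => k h0 hq q0 E1 cq E2 E3 E4.
have -> : (v - a) / - k - (L - U * a) = (a - m + k * U * v) / k + ((m' - a) / k - L) -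
    (m' - m - (a - v)) / k + U * (a - v).
  by field; rewrite gt_eqF.
have F1 : `|(a - m + k * U * v) / k| <= e / 4.
  rewrite normrM (gtr0_norm (x := k^-1)) ?invr_gt0// ler_pdivrMr// (le_trans E1)//.
  by rewrite hq exprS mulrA ler_wpM2r ?sqr_ge0.
have F3 : `|(m' - m - (a - v)) / k| <= e / 4.
  by rewrite normrM (gtr0_norm (x := k^-1)) ?invr_gt0// ler_pdivrMr.
rewrite -normrM in E4.
have G1 := ler_normD ((a - m + k * U * v) / k) ((m' - a) / k - L).
have G2 := ler_normB ((a - m + k * U * v) / k + ((m' - a) / k - L)) ((m' - m - (a - v)) / k).
have G3 := ler_normD ((a - m + k * U * v) / k + ((m' - a) / k - L) - (m' - m - (a - v)) / k) (U * (a - v)).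
lra.
Qed.

(** * Right and left difference quotients in time *)

Section assembly.
Context (R : realType) (b sigma : R) (nu : {measure set (measurableTypeR R) -> \bar R}).
Context (d : measure_display) (Omega : measurableType d) (P : probability Omega R)
        (xi : R -> {RV P >-> R}).
Hypothesis nu_levy : levy_measure nu.
Hypothesis nu_sym : symmetric_measure nu.
Hypothesis nu_mom : moments_of_all_orders nu.
Hypothesis xi_chf : forall t x, 0 <= t ->
  cintegral P setT (fun w => cexp (- ('i%C * (x * xi t w)%:C%C)))
  = cexp (- (t%:C%C * levy_symbol b sigma nu x)).
Hypothesis xi0 : forall w, xi 0 w = 0.
Hypothesis xi_cadlag : forall w, cadlag (fun t => xi t w).
Hypotheses (xi_indep : independent_increments xi) (xi_stat : stationary_increments xi).
Implicit Types (s t h p q k T C D M : R) (m n : nat) (w : Omega) (f U : R -> R).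

Notation EP f := (\int[P]_w f w).

(** Unlike [generator_limit], whose rate depends on the function, this bound is uniform over all [f]
    with small first two derivatives, and can be applied to the moving difference of the functional
    at two times. The sine compensator again has expectation of order [h]. *)
Lemma generator_small n : exists (C : R) (N : nat), 0 <= C /\
  forall f f1 f2 (e p h : R), (forall x : R, is_derive x 1 f (f1 x)) ->
    (forall x : R, is_derive x 1 f1 (f2 x)) -> 0 <= e ->
    (forall x, `|f1 x| <= e * wt x ^+ n) -> (forall x, `|f2 x| <= e * wt x ^+ n) ->
    0 <= h -> h <= 1 ->
    `|EP (fun w => f (p + xi h w)) - f p| <= e * (C * wt p ^+ N) * h.
Proof.
have [K K0 hK] := xi_sqr_moment nu_levy nu_sym nu_mom xi_chf xi0 1 n.
exists (`|b| + (2 ^+ n + 1) * K), n; split.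
  by rewrite addr_ge0// mulr_ge0// addr_ge0// exprn_ge0.
move=> f f1 f2 e p h df df1 e0 f1e f2e h0 h1.
have h01 : 0 <= h <= 1 by rewrite h0.
pose rem k := f (p + k) - f p - f1 p * sin k.
have cf : continuous f by move=> x; exact: is_derive_continuous (df x).
have crem : continuous rem.
  move=> k; have c1 : {for k, continuous (fun k => f (p + k) - f p)}.
    exact: (cvgB (@shift_continuous _ f p cf k) (cvg_cst _)).
  exact: (cvgB c1 (cvgM (cvg_cst _) (@continuous_sin R k))).
have w0 := wtX_ge0 p n.
have remb k : `|rem k| <= e * (2 ^+ n + 1) * wt p ^+ n * (k ^+ 2 * wt k ^+ n).
  have := @taylor2 R (fun y => f (y + p)) (fun y => f1 (y + p)) (fun y => f2 (y + p)) k
     (e * (2 ^+ n * (wt p ^+ n * wt k ^+ n))) (is_derive_translate p df) (is_derive_translate p df1).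
  rewrite add0r [k + p]addrC => /(_ _)/wrap[].
    move=> y yk; rewrite addrC (le_trans (f2e _))// ler_wpM2l// (le_trans (wtXD _ _ _))//.
    by rewrite ler_wpM2l ?exprn_ge0// ler_wpM2l// wtX_norm_le.
  move=> tay; have -> : rem k = (f (p + k) - f p - f1 p * k) - f1 p * (sin k - k) by rewrite /rem; ring.
  have s2 : `|f1 p * (sin k - k)| <= e * wt p ^+ n * (k ^+ 2 * wt k ^+ n).
    rewrite normrM ler_pM// (le_trans (sinB_le _))//.
    by rewrite ler_peMr ?sqr_ge0// wtX_ge1.
  rewrite (le_trans (ler_normB _ _))// (le_trans (lerD tay s2))//.
  by rewrite le_eqVlt; apply/orP; left; apply/eqP; ring.
have mrem := measurable_xi xi h crem.
have c0 : 0 <= e * (2 ^+ n + 1) * wt p ^+ n by rewrite !mulr_ge0// addr_ge0// exprn_ge0.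
have Lrem : L1le P setT (fun w => rem (xi h w)) (e * (2 ^+ n + 1) * wt p ^+ n * (K * h)).
  have L := L1le_scale measurableT (e * (2 ^+ n + 1) * wt p ^+ n) (hK h h01).
  apply: (L1le_weak _ (L1le_dom measurableT _ _ L)) => //.
    by rewrite ger0_norm.
  by move=> w _; apply: le_trans (ler_norm _); exact: remb.
have irem := L1le_integrable Lrem.
have isin : P.-integrable setT (EFin \o (fun w => sin (xi h w))).
  apply: (L1le_integrable (c := 1)); apply: bounded_L1le.
    exact: (measurable_xi xi h (@continuous_sin R)).
  by move=> w; rewrite ler_norml sin_geN1 sin_le1.
have ic : P.-integrable setT (EFin \o (fun w : Omega => f p)).
  exact: finite_measure_integrable_cst.
have is1 := integrable_scale measurableT (f1 p) isin.
have e1 := RintegralD measurableT (integrable_add measurableT ic is1) irem.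
have e2 := RintegralD measurableT ic is1.
have e3 := @RintegralZl _ _ _ P setT _ (f1 p) measurableT isin.
have -> : EP (fun w => f (p + xi h w)) - f p =
    f1 p * EP (fun w => sin (xi h w)) + EP (fun w => rem (xi h w)).
  have -> : EP (fun w => f (p + xi h w)) = EP (fun w => f p + f1 p * sin (xi h w) + rem (xi h w)).
    by apply: eq_Rintegral => w _; rewrite /rem; ring.
  have {1}-> := e1; have -> := e2; have -> := e3.
  by rewrite Rintegral_cst// [X in _ * fine X]probability_setT mulr1; ring.
have E1 := L1le_norm measurableT Lrem.
have E2 : `|f1 p * EP (fun w => sin (xi h w))| <= e * wt p ^+ n * (`|b| * h).
  rewrite normrM ler_pM//.
  exact: (expectation_sin_le nu_levy nu_sym nu_mom xi_chf h0).
rewrite (le_trans (ler_normD _ _))// (le_trans (lerD E2 E1))//.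
by rewrite le_eqVlt; apply/orP; left; apply/eqP; ring.
Qed.

Variables (Ud gd : nat -> R -> R) (K : R).
Hypothesis dU : forall j (x : R), is_derive x 1 (Ud j) (Ud j.+1 x).
Hypothesis pU : forall j, pbd (Ud j).
Hypotheses (K0 : 0 <= K) (UK : forall x, - K <= Ud 0%N x).
Hypothesis dg : forall j (x : R), is_derive x 1 (gd j) (gd j.+1 x).
Hypothesis gM : forall j, exists M : R, forall x, `|gd j x| <= M.

Local Notation u := (fk_deriv (P := P) xi Ud gd).

Let cU j : continuous (Ud j).
Proof. by move=> x; exact: is_derive_continuous (dU j x). Qed.

Let cg j : continuous (gd j).
Proof. by move=> x; exact: is_derive_continuous (dg j x). Qed.

Let du j t p : (j < 3)%N -> 0 <= t -> is_derive p 1 (u j t) (u j.+1 t p).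
Proof. exact: (is_derive_fk_deriv nu_levy nu_sym nu_mom xi_chf xi0 xi_cadlag dU pU K0 UK dg gM). Qed.

Let bu T : exists (C : R) (n : nat), 0 <= C /\
  forall j t p, (j <= 3)%N -> 0 <= t <= T -> `|u j t p| <= C * wt p ^+ n.
Proof. exact: (fk_deriv_bound nu_levy nu_sym nu_mom xi_chf xi0 xi_cadlag dU pU K0 UK dg gM). Qed.

Lemma fk_sup_bound T : exists2 M : R, 0 <= M & forall t p, 0 <= t <= T -> `|u 0 t p| <= M.
Proof.
have [M hM] := gM 0.
have M0 : 0 <= M by exact: le_trans (normr_ge0 _) (hM 0).
exists (expR (K * T) * M); first by rewrite mulr_ge0 ?expR_ge0.
move=> t p /andP[t0 tT]; rewrite fk_deriv0.
have := @fk_bound _ _ _ P _ xi_cadlag _ K (@cU 0%N) UK _ M t p (@cg 0%N) t0 hM.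
by move=> /le_trans; apply; rewrite ler_wpM2r// ler_expR ler_wpM2l.
Qed.

Lemma fk_deriv_semigroup s h p : 0 <= s -> 0 <= h ->
  u 0 (h + s) p = fk (P := P) xi (Ud 0%N) (u 0 s) h p.
Proof.
move=> s0 h0; have [M hM] := gM 0.
have E : u 0 s = fk (P := P) xi (Ud 0%N) (gd 0%N) s by apply/funext => y; exact: fk_deriv0.
have cu : continuous (fk (P := P) xi (Ud 0%N) (gd 0%N) s).
  move=> x; have h1 := du x (isT : (0 < 3)%N) s0.
  by rewrite -E; exact: is_derive_continuous h1.
have sg := @fk_semigroup _ _ _ P xi xi_indep xi_stat xi0 xi_cadlag _ K (@cU 0%N) UK _ M h s p
  (@cg 0%N) cu h0 s0 hM.
refine (etrans (fk_deriv0 _ _ _ _ _) (etrans sg _)).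
exact: (congr1 (fun f => fk (P := P) xi (Ud 0%N) f h p) (esym E)).
Qed.

Lemma fk_step T : exists (C : R) (N : nat), 0 <= C /\ forall s p r, 0 <= s <= T -> 0 < r -> r <= 1 ->
  `|u 0 (r ^+ 2 + s) p - EP (fun w => u 0 s (p + xi (r ^+ 2) w)) + r ^+ 2 * Ud 0%N p * u 0 s p|
    <= C * wt p ^+ N * r ^+ 3.
Proof.
have [B [n [B0 hB]]] := bu T; have [M M0 hM] := fk_sup_bound T.
have [C [N [C0 hC]]] := fk_expansion nu_levy nu_sym nu_mom xi_chf xi0 xi_cadlag (dU 0)
  (pU 0) (pU 1) K0 UK n M0 B0.
exists C, N; split => // s p r sT r0 r1; have /andP[s0 _] := sT.
rewrite fk_deriv_semigroup ?sqr_ge0//; apply: (hC (u 0 s) (u 1 s)) => //.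
- by move=> x; exact: du.
- by move=> x; exact: hM.
- by move=> x; exact: hB.
Qed.

(** For [j = 0] the one-step expansion bounds the change by a multiple of the square root of the
    step. Interpolating against the bounded second derivative gives [j = 1], and then against the
    bounded third derivative gives [j = 2]. *)
Lemma fk_deriv_small T j : (j <= 2)%N -> exists N : nat, forall e : R, 0 < e ->
  exists2 r : R, 0 < r & forall s h q, 0 <= s -> 0 < h -> h < r -> h + s <= T ->
    `|u j (h + s) q - u j s q| <= e * wt q ^+ N.
Proof.
have [B [n [B0 hB]]] := bu T; have [M M0 hM] := fk_sup_bound T.
have [C [N [C0 hC]]] := fk_step T.
have [C1 [N1 [C10 hC1]]] := expectation_increment_le nu_levy nu_sym nu_mom xi_chf xi0 n B0.
have [Cu [mu [Cu0 hU]]] := pU 0.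
pose L := (n + N + N1 + mu)%N.
have small0 (e : R) : 0 < e -> exists2 r : R, 0 < r & forall s h q, 0 <= s -> 0 < h -> h < r ->
    h + s <= T -> `|u 0 (h + s) q - u 0 s q| <= e * wt q ^+ L.
  move=> e0; pose D := C + C1 + Cu * M + 1.
  have D0 : 0 < D by rewrite ltr_wpDl// !addr_ge0// mulr_ge0.
  pose r1 := Num.min 1 (e / D).
  have r10 : 0 < r1 by rewrite lt_min ltr01 divr_gt0.
  exists (r1 ^+ 2); first by rewrite exprn_gt0.
  move=> s h q s0 h0 hr hsT; have [r r0 hE] := sqrt_square h0.
  have rr1 : r <= r1.
    by rewrite -(@ler_pXn2r _ 2)// ?nnegrE ?(ltW r0) ?(ltW r10)// -hE ltW.
  have r1' : r <= 1 by rewrite (le_trans rr1)// ge_min lexx.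
  have sT : 0 <= s <= T by rewrite s0/=; lra.
  have cont : continuous (u 0 s) by move=> x; exact: is_derive_continuous (du x (isT : (0 < 3)%N) s0).
  have d1 (x : R) : is_derive x 1 (u 0 s) (u 1 s x) by exact: du.
  have b1 x : `|u 1 s x| <= B * wt x ^+ n by exact: hB.
  have E1 := hC s q r sT r0 r1'; rewrite -hE in E1.
  have LE2 := hC1 (u 0 s) (u 1 s) q r d1 b1 r0 r1'; rewrite -hE in LE2.
  have iv : P.-integrable setT (EFin \o (fun w => u 0 s (q + xi h w))).
    apply: (L1le_integrable (c := M)); apply: bounded_L1le.
      exact: (measurable_xi xi _ (@shift_continuous _ _ q cont)).
    by move=> w; exact: hM.
  have ic : P.-integrable setT (EFin \o (fun w : Omega => u 0 s q)).
    exact: finite_measure_integrable_cst.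
  have eB := RintegralB measurableT iv ic.
  have EQ : EP (fun w => u 0 s (q + xi h w) - u 0 s q) = EP (fun w => u 0 s (q + xi h w)) - u 0 s q.
    refine (etrans eB _).
    exact: (congr1 (fun z => EP (fun w => u 0 s (q + xi h w)) - z) (bdd_expectation_cst P (u 0 s q))).
  have E2 : `|EP (fun w => u 0 s (q + xi h w)) - u 0 s q| <= C1 * wt q ^+ N1 * r :=
    eq_ind _ (fun z => `|z| <= C1 * wt q ^+ N1 * r) (L1le_norm measurableT LE2) _ EQ.
  have E3 : `|h * Ud 0%N q * u 0 s q| <= r * (Cu * wt q ^+ mu * M).
    have hr1 : `|h| <= r by rewrite gtr0_norm// hE expr2 ler_piMr// ltW.
    have hUM : `|Ud 0%N q * u 0 s q| <= Cu * wt q ^+ mu * M.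
      by rewrite normrM; apply: ler_pM (normr_ge0 _) (normr_ge0 _) (hU q) (hM s q sT).
    by rewrite -mulrA normrM; apply: ler_pM (normr_ge0 _) (normr_ge0 _) hr1 hUM.
  apply: (le_trans (norm_sub3_le E1 E2 E3)).
  have WW (i : nat) : (i <= L)%N -> wt q ^+ i <= wt q ^+ L by exact: wtX_le.
  have W1 := WW N ltac:(by rewrite /L; apply: leq_trans (leq_addr _ _); apply: leq_trans (leq_addr _ _); exact: leq_addl).
  have W2 := WW N1 ltac:(by rewrite /L; apply: leq_trans (leq_addr _ _); exact: leq_addl).
  have W3 := WW mu ltac:(by rewrite /L; exact: leq_addl).
  have wL := wtX_ge0 q L.
  have r3 : r ^+ 3 <= r by rewrite -[X in _ <= X]expr1 ler_wiXn2l// ltW.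
  have r30 : 0 <= r ^+ 3 by rewrite exprn_ge0// ltW.
  have rD : r * D <= e.
    by rewrite -ler_pdivlMr// (le_trans rr1)// ge_min lexx orbT.
  apply: (@le_trans _ _ (r * D * wt q ^+ L)); last by rewrite ler_wpM2r.
  have F1 : C * wt q ^+ N * r ^+ 3 <= C * wt q ^+ L * r by apply: ler_pM (mulr_ge0 C0 (wtX_ge0 _ _)) r30 (ler_wpM2l C0 W1) r3.
  have F2 : C1 * wt q ^+ N1 * r <= C1 * wt q ^+ L * r by rewrite ler_wpM2r ?(ltW r0)// ler_wpM2l.
  have F3 : r * (Cu * wt q ^+ mu * M) <= r * (Cu * wt q ^+ L * M).
    by rewrite ler_wpM2l ?(ltW r0)// ler_wpM2r// ler_wpM2l.
  have rw0 : 0 <= r * wt q ^+ L by rewrite mulr_ge0// ltW.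
  have -> : r * D * wt q ^+ L = C * wt q ^+ L * r + C1 * wt q ^+ L * r +
     r * (Cu * wt q ^+ L * M) + r * wt q ^+ L by rewrite /D; ring.
  exact: ler_wpDr rw0 (lerD (lerD F1 F2) F3).
have bL i t p : (i <= 3)%N -> 0 <= t <= T -> `|u i t p| <= B * wt p ^+ L.
  move=> i3 tT; rewrite (le_trans (hB _ _ _ i3 tT))// ler_wpM2l// wtX_le// /L -!addnA.
  exact: leq_addr.
have step i : (i < 2)%N -> (forall e : R, 0 < e -> exists2 r : R, 0 < r & forall s h q,
      0 <= s -> 0 < h -> h < r -> h + s <= T -> `|u i (h + s) q - u i s q| <= e * wt q ^+ L) ->
    forall e : R, 0 < e -> exists2 r : R, 0 < r & forall s h q,
      0 <= s -> 0 < h -> h < r -> h + s <= T -> `|u i.+1 (h + s) q - u i.+1 s q| <= e * wt q ^+ L.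
  move=> i2 sm e e0.
  (* The bound is [2 * B] because the interpolated function is a difference of two members of the
     family. *)
  have [e' e'0 hI] := interpolation L (mulr_ge0 (ler0n R 2) B0) e0.
  have [r r0 hr] := sm e' e'0; exists r => // s h q s0 h0 hlt hsT.
  have hs0 : 0 <= h + s by rewrite addr_ge0// ltW.
  have sT : 0 <= s <= T by rewrite s0/=; lra.
  have hsT' : 0 <= h + s <= T by rewrite hs0.
  apply: (hI (fun q => u i (h + s) q - u i s q) (fun q => u i.+1 (h + s) q - u i.+1 s q)
     (fun q => u i.+2 (h + s) q - u i.+2 s q)).
  - by move=> x; apply: is_deriveB; apply: du => //; apply: ltn_trans i2 _.
  - by move=> x; apply: is_deriveB; apply: du => //.
  - by move=> x; exact: hr.
  - move=> x; rewrite (le_trans (ler_normB _ _))//.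
    have h1 := bL i.+2 (h + s) x ltac:(by rewrite ltnS) hsT'.
    have h2 := bL i.+2 s x ltac:(by rewrite ltnS) sT.
    by rewrite (le_trans (lerD h1 h2))// -mulrA [X in _ <= X]mulr_natl mulr2n.
move=> j2; exists L; case: j j2 => [|[|[|//]]] _.
- exact: small0.
- exact: (step 0).
- exact: (step 1 isT (step 0 isT small0)).
Qed.

Lemma fk_time_derivative t p : 0 < t -> is_derive t 1 (fun s => u 0 s p)
  (b * u 1 t p + sigma ^+ 2 / 2 * u 2 t p + \int[nu]_k jump_integrand (u 0 t) p k
   - Ud 0%N p * u 0 t p).
Proof.
move=> t0; have tge0 := ltW t0.
set L := b * u 1 t p + sigma ^+ 2 / 2 * u 2 t p + \int[nu]_k jump_integrand (u 0 t) p k.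
pose T := t + 1.
have tT : 0 <= t <= T by rewrite tge0/= lerDl.
have [C [N [C0 hC]]] := fk_step T.
have [N0 sm0] := fk_deriv_small T (isT : (0 <= 2)%N).
have [N1 sm1] := fk_deriv_small T (isT : (1 <= 2)%N).
have [N2 sm2] := fk_deriv_small T (isT : (2 <= 2)%N).
pose n := (N1 + N2)%N.
have [D [m [D0 hD]]] := generator_small n.
have [M M0 hM] := fk_sup_bound T.
have [B [l [B0 hB]]] := bu T.
apply: quotient_is_derive => e e0.
have b2 : pbd (u 2 t) by exists B, l; split => // x; exact: hB.
have b3 : pbd (u 3 t) by exists B, l; split => // x; exact: hB.
have e4 : 0 < e / 4 by rewrite divr_gt0.
have [rg rg0 hg] := generator_limit nu_levy nu_sym nu_mom xi_chf xi0 p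
  (fun x => du x (isT : (0 < 3)%N) tge0) (fun x => du x (isT : (1 < 3)%N) tge0)
  (fun x => du x (isT : (2 < 3)%N) tge0) b2 b3 e4.
pose c := C * wt p ^+ N.
have c0 : 0 <= c by rewrite mulr_ge0 ?wtX_ge0.
pose rc := Num.min 1 (e / 4 / (c + 1)).
have c1 : 0 < c + 1 by rewrite ltr_wpDl.
have rc0 : 0 < rc by rewrite lt_min ltr01 divr_gt0.
(* [a1] and [a2] normalise the two errors special to a left increment, the change of the potential
   term and that of the expected increment; adding 1 keeps the denominators positive. *)
pose a1 := `|Ud 0%N p| * wt p ^+ N0 + 1.
have a10 : 0 < a1 by rewrite ltr_wpDl// mulr_ge0 ?wtX_ge0.
pose a2 := D * wt p ^+ m + 1.
have a20 : 0 < a2 by rewrite ltr_wpDl// mulr_ge0 ?wtX_ge0.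
have [r0 r00 h0] := sm0 (e / 4 / a1) (divr_gt0 e4 a10).
have [r1 r10 h1] := sm1 (e / 4 / a2) (divr_gt0 e4 a20).
have [r2 r20 h2] := sm2 (e / 4 / a2) (divr_gt0 e4 a20).
(* The bound by [t] keeps the earlier time nonnegative, the bound by 1 keeps the step in the range
   of the moment estimates, and [rc ^+ 2] is squared because the expansion uses the square root of
   the step. *)
pose r := Num.min (Num.min (Num.min rg (rc ^+ 2)) (Num.min r0 r1)) (Num.min r2 (Num.min t 1)).
exists r; first by rewrite !lt_min rg0 exprn_gt0// r00 r10 r20 t0 ltr01.
have step h : 0 < h -> h < r -> [/\ h < rg, (h < r0) && (h < r1) && (h < r2), h < t, h <= 1 &
    exists2 q : R, 0 < q & [/\ h = q ^+ 2, q <= 1 & c * q <= e / 4]].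
  move=> hpos; rewrite !lt_min => /andP[/andP[/andP[ha hb] /andP[hc hd]] /andP[he /andP[hf hi]]].
  split => //; [by rewrite hc hd he | exact: ltW |].
  have [q q0 hq] := sqrt_square hpos; exists q => //.
  have qrc : q <= rc.
    by rewrite -(@ler_pXn2r _ 2)// ?nnegrE ?(ltW q0) ?(ltW rc0)// -hq ltW.
  split => //; first by rewrite (le_trans qrc)// ge_min lexx.
  have qe : q <= e / 4 / (c + 1) by rewrite (le_trans qrc)// ge_min lexx orbT.
  rewrite ler_pdivlMr// mulrDr mulr1 in qe.
  by rewrite mulrC (le_trans _ qe)// lerDl ltW.
move=> h hn0 hr.
have [hpos|hneg] := ltP 0 h.
  rewrite gtr0_norm// in hr.
  have [hg' _ _ h1' [q q0 [hq q1 cq]]] := step h hpos hr.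
  have E1 := hC t p q tT q0 q1; rewrite -hq in E1.
  have E2 := hg h hpos hg'.
  rewrite [t + h]addrC; apply: (quotient_right hpos hq q0 _ cq E2); exact: E1.
have kpos : 0 < - h by rewrite oppr_gt0 lt_neqAle hn0.
rewrite ltr0_norm in hr; last by rewrite -oppr_gt0.
have [hg' /andP[/andP[k0 k1] k2] kt k1' [q q0 [hq q1 cq]]] := step _ kpos hr.
(* For negative [h] the expansion starts from the earlier time [s] and reaches [t] after a step of
   length [- h]. *)
pose s := t + h.
have s0 : 0 <= s by rewrite /s -[h]opprK subr_ge0 ltW.
have ks : - h + s = t by rewrite /s addrC addrK.
have sT : 0 <= s <= T.
  by rewrite s0/= (le_trans _ (andP tT).2)// /s gerDl.
have ksT : - h + s <= T by rewrite ks (andP tT).2.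
have E1 := hC s p q sT q0 q1; rewrite -hq ks in E1.
have E2 := hg _ kpos hg'.
have S0 x : `|u 0 t x - u 0 s x| <= e / 4 / a1 * wt x ^+ N0.
  by have := h0 s (- h) x s0 kpos k0 ksT; rewrite ks.
have S1 x : `|u 1 t x - u 1 s x| <= e / 4 / a2 * wt x ^+ n.
  have := h1 s (- h) x s0 kpos k1 ksT; rewrite ks => /le_trans; apply.
  by rewrite ler_wpM2l ?wtX_le ?leq_addr// ltW// divr_gt0.
have S2 x : `|u 2 t x - u 2 s x| <= e / 4 / a2 * wt x ^+ n.
  have := h2 s (- h) x s0 kpos k2 ksT; rewrite ks => /le_trans; apply.
  by rewrite ler_wpM2l ?wtX_le ?leq_addl// ltW// divr_gt0.
have ea2 : 0 <= e / 4 / a2 by rewrite ltW// divr_gt0.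
have E3 := hD (fun x => u 0 t x - u 0 s x) (fun x => u 1 t x - u 1 s x)
  (fun x => u 2 t x - u 2 s x) (e / 4 / a2) p (- h)
  (fun x => is_deriveB (du x (isT : (0 < 3)%N) tge0) (du x (isT : (0 < 3)%N) s0))
  (fun x => is_deriveB (du x (isT : (1 < 3)%N) tge0) (du x (isT : (1 < 3)%N) s0)) ea2 S1 S2
  (ltW kpos) k1'.
have iu z : 0 <= z <= T -> P.-integrable setT (EFin \o (fun w => u 0 z (p + xi (- h) w))).
  move=> zT; have z0 := (andP zT).1.
  have cont : continuous (u 0 z) by move=> x; exact: is_derive_continuous (du x (isT : (0 < 3)%N) z0).
  apply: (L1le_integrable (c := M)); apply: bounded_L1le.
    exact: (measurable_xi xi _ (@shift_continuous _ _ p cont)).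
  by move=> w; exact: hM.
have eB := RintegralB measurableT (iu t tT) (iu s sT).
have E3' := eq_ind _ (fun z => `|z - (u 0 t p - u 0 s p)| <= _) E3 _ eB.
have F3 : e / 4 / a2 * (D * wt p ^+ m) <= e / 4.
  by rewrite mulrAC ler_pdivrMr// ler_wpM2l ?(ltW e4)// lerDl.
have F0 : `|Ud 0%N p| * (e / 4 / a1 * wt p ^+ N0) <= e / 4.
  by rewrite mulrCA mulrAC ler_pdivrMr// ler_wpM2l ?(ltW e4)// lerDl.
have E3'' := le_trans E3' (ler_wpM2r (ltW kpos) F3).
have E0 := le_trans (ler_wpM2l (normr_ge0 (Ud 0%N p)) (S0 p)) F0.
exact: (quotient_left kpos hq q0 E1 cq E2 E3'' E0).
Qed.

End assembly.

(** * Reduction to a process started at zero everywhere *)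

Section hypotheses.
Context (R : realType).
Implicit Types (f U g : R -> R) (c a C x p : R).

Lemma smooth_is_derive f j (x : R) : smooth f -> is_derive x 1 (derive1n j f) (derive1n j.+1 f x).
Proof. by move=> sf; apply: DeriveDef; [exact: sf | rewrite derive1nS derive1E]. Qed.

Lemma smooth_continuous f j : smooth f -> continuous (derive1n j f).
Proof. by move=> sf x; exact: is_derive_continuous (smooth_is_derive j x sf). Qed.

Lemma schwartz_bounded g j : schwartz g -> exists M : R, forall x, `|derive1n j g x| <= M.
Proof. by move=> [_ /(_ 0 j)] [M hM]; exists M => x; have := hM x; rewrite expr0 mul1r. Qed.

(** The real exponent is rounded up to an integer power of [wt], and on the compact set where no
    growth bound is given continuity provides the constant [M]. *)
Lemma powR_growth_pbd f (cn kn C : R) : 0 < cn -> 0 < kn -> 0 <= C -> continuous f ->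
  (forall p, C < `|p| -> `|f p| <= cn * (1 + `|p| `^ kn)) -> pbd f.
Proof.
move=> cn0 kn0 C0 cf hf; have [M M0 hM] := continuous_itv_bounded C0 cf.
have [m hm] : exists m : nat, kn <= m%:R.
  by exists (Num.bound kn); exact: ltW (archi_boundP (ltW kn0)).
exists (2 * cn + M), m; split; first by rewrite addr_ge0 ?mulr_ge0// ltW.
move=> x; have w1 := wtX_ge1 x m.
have [xC|xC] := leP `|x| C.
  rewrite (le_trans (hM _ xC))//.
  have : 0 <= (2 * cn + M) * (wt x ^+ m - 1).
    by rewrite mulr_ge0 ?subr_ge0// addr_ge0// mulr_ge0// ltW.
  lra.
have pw : `|x| `^ kn <= wt x ^+ m.
  rewrite -powR_mulrn ?wt_ge0// (@le_trans _ _ (wt x `^ kn))//.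
    by apply: ge0_ler_powR; rewrite ?nnegrE ?wt_ge0 ?(ltW kn0)// norm_le_wt.
  by apply: ler_powR => //; exact: wt_ge1.
rewrite (le_trans (hf _ xC))//.
have h1 : cn * (1 + `|x| `^ kn) <= cn * (2 * wt x ^+ m) by rewrite ler_pM2l//; lra.
rewrite (le_trans h1)//.
have : 0 <= M * wt x ^+ m by rewrite mulr_ge0 ?wtX_ge0.
lra.
Qed.

(** Growth is assumed for the derivatives of [U] of order at least 1; the polynomial bound on [U]
    itself is recovered by the mean value theorem, at the cost of one power of [wt]. *)
Lemma pbd_primitive f f1 : (forall x : R, is_derive x 1 f (f1 x)) -> pbd f1 -> pbd f.
Proof.
move=> df [C [m [C0 hC]]]; exists (`|f 0| + C), m.+1; split; first by rewrite addr_ge0.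
move=> x; have h := @derive_lipschitz R f f1 0 `|x| (C * wt x ^+ m) x df.
rewrite subr0 in h; have {}h : `|f x - f 0| <= C * wt x ^+ m * `|x|.
  apply: h => // y; rewrite subr0 => yx; rewrite (le_trans (hC _))// ler_wpM2l//.
  exact: wtX_norm_le.
rewrite -[f x](subrK (f 0)) (le_trans (ler_normD _ _))// [`|f 0| + C]addrC mulrDl lerD//.
  by rewrite (le_trans h)// -mulrA ler_wpM2l// exprSr ler_wpM2l ?wtX_ge0// norm_le_wt.
by rewrite ler_peMr// wtX_ge1.
Qed.

Lemma growth_bounded_below U c a C : continuous U -> 0 < c -> 0 < C ->
  (forall p, C < `|p| -> c * `|p| `^ a <= U p) -> exists2 K : R, 0 <= K & forall x, - K <= U x.
Proof.
move=> cU c0 C0 hU; have [K K0 hK] := continuous_itv_bounded (ltW C0) cU.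
exists K => // x; have [xC|xC] := leP `|x| C.
  by have := hK _ xC; rewrite ler_norml => /andP[].
by rewrite (le_trans _ (hU _ xC))// (@le_trans _ _ 0) ?oppr_le0// mulr_ge0 ?powR_ge0// ltW.
Qed.

End hypotheses.

Section started_at_zero.
Context (R : realType) (d : measure_display) (Omega : measurableType d)
        (P : probability Omega R) (xi : R -> {RV P >-> R}).
Implicit Types (t h x p : R) (w : Omega).
Notation EP f := (\int[P]_w f w).

Let m_shift t : measurable_fun setT (fun w => xi t w - xi 0 w).
Proof. exact: measurable_funB. Qed.

(* The hypotheses only give [xi 0 = 0] almost surely. *)
Definition recentred t : {RV P >-> R} :=
  HB.pack (fun w => xi t w - xi 0 w) (isMeasurableFun.Build _ _ _ _ _ (m_shift t)).

Lemma recentred0 w : recentred 0 w = 0.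
Proof. exact: subrr. Qed.

Lemma increment_recentred s t : increment recentred s t = increment xi s t.
Proof. by apply/funext => w; rewrite /increment /=; ring. Qed.

Lemma recentred_independent : independent_increments xi -> independent_increments recentred.
Proof.
move=> h n t A t0 tm mA; have := h n t A t0 tm mA.
by under eq_bigr do rewrite -increment_recentred;
   under [in X in _ = X -> _]eq_bigr do rewrite -increment_recentred.
Qed.

Lemma recentred_stationary : stationary_increments xi -> stationary_increments recentred.
Proof.
move=> hs s h A s0 h0 mA; rewrite increment_recentred hs//.
by rewrite -(hs 0 h A (lexx 0) h0 mA) add0r.
Qed.

Lemma recentred_cadlag : (forall w, cadlag (fun t => xi t w)) ->
  forall w, cadlag (fun t => recentred t w).
Proof.
move=> hc w; have [h1 h2] := hc w; split.
  by move=> t t0; apply: cvgB; [exact: h1 | exact: cvg_cst].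
by move=> t t0; apply: is_cvgB; [exact: h2 | exact: is_cvg_cst].
Qed.

Hypothesis xi_start : P (xi 0 @^-1` [set 0]) = 1%E.

Lemma expectation_recentred (F G : Omega -> R) : measurable_fun setT F -> measurable_fun setT G ->
  (forall w, xi 0 w = 0 -> F w = G w) -> EP F = EP G.
Proof.
move=> mF mG FG; rewrite /Rintegral; congr fine.
apply: ae_eq_integral => //; [exact/measurable_EFinP | exact/measurable_EFinP |].
have mS : measurable (xi 0 @^-1` [set 0]).
  by rewrite -[X in measurable X]setTI; apply: measurable_funPT.
exists (~` (xi 0 @^-1` [set 0])); split; first exact: measurableC.
  by have := probability_setC P mS; rewrite xi_start subee.
by move=> w /= nw x0; apply: nw => _; rewrite /= FG.
Qed.

Lemma cexp_imaginary (y : R) : cexp (- ('i%C * y%:C%C)) = Complex (cos y) (- sin y).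
Proof.
rewrite /cexp /= !(mul0r, mul1r, mulr0, add0r, addr0, subr0, oppr0, sub0r).
by rewrite expR0 cosN sinN !mul1r.
Qed.

Lemma cintegral_recentred t x :
  cintegral P setT (fun w => cexp (- ('i%C * (x * recentred t w)%:C%C))) =
  cintegral P setT (fun w => cexp (- ('i%C * (x * xi t w)%:C%C))).
Proof.
have E (X : {RV P >-> R}) : (fun w => cexp (- ('i%C * (x * X w)%:C%C))) =
    (fun w => Complex (cos (x * X w)) (- sin (x * X w))).
  by apply/funext => w; rewrite cexp_imaginary.
rewrite !E /cintegral/=.
have mc (X : {RV P >-> R}) : measurable_fun setT (fun w => cos (x * X w)).
  by apply: (measurableT_comp (f := fun y => cos (x * y))) => //;
    apply: continuous_measurable; exact: continuous_cosM.
have ms (X : {RV P >-> R}) : measurable_fun setT (fun w => - sin (x * X w)).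
  apply: measurable_funN; apply: (measurableT_comp (f := fun y => sin (x * y))) => //.
  by apply: continuous_measurable; exact: continuous_sinM.
congr Complex.
  by apply: (expectation_recentred (mc (recentred t)) (mc (xi t))) => w w0; rewrite /= w0 subr0.
by apply: (expectation_recentred (ms (recentred t)) (ms (xi t))) => w w0; rewrite /= w0 subr0.
Qed.

Lemma feynman_kacE U g t p :
  feynman_kac xi U g t p = EP (fun w => g (p + xi t w) * expR (- path_int xi U t p w)).
Proof. by rewrite /feynman_kac unlock. Qed.

Lemma feynman_kac_recentred U g t p : (forall w, cadlag (fun t => xi t w)) ->
  continuous U -> continuous g -> 0 <= t ->
  feynman_kac xi U g t p = fk (P := P) recentred U g t p.
Proof.
move=> xi_cadlag cU cg t0; rewrite feynman_kacE.
apply: expectation_recentred.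
- apply: measurable_funM; first exact: (measurable_xi xi _ (@shift_continuous _ g p cg)).
  apply: (measurableT_comp (@measurable_expR R)); apply: measurable_funN.
  exact: measurable_path_int.
- by apply: fk_measurable_integrand => //; exact: recentred_cadlag.
- move=> w w0; rewrite mulrC /= w0 subr0; congr (expR (- _) * _).
  by rewrite /path_int; apply: eq_Rintegral => s _; rewrite /= w0 subr0.
Qed.

End started_at_zero.

Theorem theorem2p1 (R : realType) (b sigma : R)
    (nu : {measure set (measurableTypeR R) -> \bar R})
    (d : measure_display) (Omega : measurableType d) (P : probability Omega R)
    (xi : R -> {RV P >-> R})
    (U : R -> R) (c a C : R) (g : R -> R) :
  levy_measure nu ->
  symmetric_measure nu ->
  levy_process b sigma nu xi ->
  moments_of_all_orders nu ->
  smooth U ->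
  0 < c -> 1 <= a -> 0 < C ->
  (forall p : R, C < `|p| -> c * `|p| `^ a <= U p) ->
  (forall n : nat, (1 <= n)%N ->
     exists cn kn : R, [/\ 0 < cn, 0 < kn &
       forall p : R, C < `|p| -> `|derive1n n U p| <= cn * (1 + `|p| `^ kn)]) ->
  schwartz g ->
  is_solution b sigma nu U g (feynman_kac xi U g).
Proof.
move=> nu_levy nu_sym [xi_start xi_indep xi_stat xi_cadlag xi_chf] nu_mom sU c0 a1 C0 U_ge U_growth sg.
have dU j (x : R) : is_derive x 1 (derive1n j U) (derive1n j.+1 U x) by exact: smooth_is_derive.
have dg j (x : R) : is_derive x 1 (derive1n j g) (derive1n j.+1 g x) by exact: smooth_is_derive sg.1.
have gM j : exists M : R, forall x, `|derive1n j g x| <= M by exact: schwartz_bounded.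
have cU : continuous U by exact: (@smooth_continuous R U 0 sU).
have cg : continuous g by exact: (@smooth_continuous R g 0 sg.1).
have [K K0 UK] := growth_bounded_below cU c0 C0 U_ge.
have pU1 j : pbd (derive1n j.+1 U).
  have [cn [kn [cn0 kn0 h]]] := U_growth j.+1 isT.
  exact: powR_growth_pbd cn0 kn0 (ltW C0) (@smooth_continuous R U j.+1 sU) h.
have pU j : pbd (derive1n j U) by exact: pbd_primitive (dU j) (pU1 j).
pose xi' := recentred xi.
have xi'_chf t x : 0 <= t -> cintegral P setT (fun w => cexp (- ('i%C * (x * xi' t w)%:C%C)))
    = cexp (- (t%:C%C * levy_symbol b sigma nu x)).
  by move=> t0; rewrite cintegral_recentred// xi_chf.
have xi'0 w : xi' 0 w = 0 by exact: recentred0.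
have xi'_cadlag w : cadlag (fun t => xi' t w) by exact: recentred_cadlag.
pose u j := fk_deriv (P := P) xi' (fun j => derive1n j U) (fun j => derive1n j g) j.
have uE t : 0 <= t -> feynman_kac xi U g t = u 0 t.
  move=> t0; apply/funext => p; rewrite (feynman_kac_recentred xi_start p xi_cadlag cU cg t0).
  by rewrite /u fk_deriv0.
have du j t (p : R) : (j < 3)%N -> 0 <= t -> is_derive p 1 (u j t) (u j.+1 t p).
  exact: (is_derive_fk_deriv nu_levy nu_sym nu_mom xi'_chf xi'0 xi'_cadlag dU pU K0 UK dg gM).
split; last first.
  move=> p; rewrite uE// /u fk_deriv0 /fk.
  transitivity (\int[P]_w g p); last exact: bdd_expectation_cst.
  apply: eq_Rintegral => w _; rewrite xi'0 addr0 /path_int set_itv1 Rintegral_set1.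
  by rewrite oppr0 expR0 mul1r.
move=> t t0; have tge0 := ltW t0; rewrite uE//.
have d0 (p : R) : is_derive p 1 (u 0 t) (u 1 t p) by exact: du.
have d1 (p : R) : is_derive p 1 (u 1 t) (u 2 t p) by exact: du.
have E1 : derive1 (u 0 t) = u 1 t by apply/funext => p; rewrite derive1E; apply: derive_val.
have E2 : derive1 (u 1 t) = u 2 t by apply/funext => p; rewrite derive1E; apply: derive_val.
split => [p|p].
  split; rewrite ?E1; [exact: ex_derive | exact: ex_derive |].
  apply: integrable_punctured; apply: (jump_integrand_integrable nu_levy nu_mom p d0 d1).
  have [B [n [B0 hB]]] := fk_deriv_bound nu_levy nu_sym nu_mom xi'_chf xi'0 xi'_cadlag dU pU K0 UK dg gM t.
  by exists B, n; split => // x; apply: hB; rewrite // tge0 lexx.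
have dt := fk_time_derivative nu_levy nu_sym nu_mom xi'_chf xi'0 xi'_cadlag
  (recentred_independent xi_indep) (recentred_stationary xi_stat) dU pU K0 UK dg gM p t0.
have dt' : is_derive t 1 (fun s => feynman_kac xi U g s p)
   (b * u 1 t p + sigma ^+ 2 / 2 * u 2 t p + \int[nu]_k jump_integrand (u 0 t) p k - U p * u 0 t p).
  (* The functional and [u 0] are identified at nonnegative times only, so increments are restricted
     to [|h| < t] before the derivative is transferred. *)
  apply: quotient_is_derive => e e0.
  have [r r0 hr] := is_derive_quotient dt e0.
  exists (Num.min r t); first by rewrite lt_min r0.
  move=> h hn0; rewrite lt_min => /andP[hlt ht].
  have th : 0 <= t + h by move: ht; rewrite ltr_norml => /andP[]; lra.
  by rewrite !uE//; exact: hr.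
split; first exact: ex_derive.
rewrite derive1E derive_val /V_inabla derive1nS derive1n1 E1 E2.
rewrite Rintegral_punctured; last first.
  by rewrite /jump_integrand addr0 subrr !mul0r subrr.
generalize (u 0 t p) (u 1 t p) (u 2 t p) (\int[nu]_k jump_integrand (u 0 t) p k).
by move=> v0 v1 v2 J; ring.
Qed.
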